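(* Let $\ell \ge 1$ be an integer and let $\ell_o$ denote the odd part of $\ell$. Then for every $\epsilon>0$ and all $X \ge 1$, $$\sum_{n \leq X} H(n) H(n+\ell) = \frac{\pi^2 X^2}{252\,\zeta(3)}\Big(2\sigma_{-2}\big(\tfrac{\ell}{4}\big) - \sigma_{-2}\big(\tfrac{\ell}{2}\big) + \sigma_{-2}(\ell_o)\Big) + O_\epsilon\big(X^{\frac{5}{3}+\epsilon} + X^{1+\epsilon}\ell\big),$$ where the sum runs over integers $1 \le n \le X$ and the implied constant depends only on $\epsilon$ (so the estimate is uniform in $\ell$).
   Context: $H(n)$ denotes the Hurwitz class number: for $n\ge 1$ it is the number of $\mathrm{SL}_2(\mathbb{Z})$-equivalence classes of positive definite integral binary quadratic forms $ax^2+bxy+cy^2$ (not necessarily primitive) of discriminant $b^2-4ac=-n$, where classes containing a multiple of $x^2+y^2$ are counted with weight $\frac12$ and classes containing a multiple of $x^2-xy+y^2$ are counted with weight $\frac13$. $\sigma_\nu(m) = \sum_{d\mid m} d^\nu$ (sum over positive divisors), with the convention $\sigma_\nu(m)=0$ if $m\notin\mathbb{Z}$. The odd part of $\ell$ is the largest odd divisor of $\ell$. $\zeta$ is the Riemann zeta function. *)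

(* Defs.v *)
From mathcomp Require Import all_boot all_order all_algebra.
From mathcomp Require Import all_classical all_reals all_analysis.

Set Implicit Arguments.
Unset Strict Implicit.
Unset Printing Implicit Defensive.

Import Order.TTheory GRing.Theory Num.Theory.
Import numFieldNormedType.Exports.

Local Open Scope classical_set_scope.
Local Open Scope ring_scope.

(* [BQF a b c] is the integral form a x^2 + b x y + c y^2. *)
Record bqf := BQF { qa : int; qb : int; qc : int }.

Definition qf_eval (f : bqf) (v : 'cV[int]_2) : int :=
  let x := v ord0 ord0 in let y := v ord_max ord0 in
  qa f * x ^+ 2 + qb f * x * y + qc f * y ^+ 2.

Definition disc (f : bqf) : int := qb f ^+ 2 - 4 * qa f * qc f.

(* For a form of nonzero discriminant, positivity on the nonzero integral
   vectors is the same as positivity on the nonzero real vectors. *)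
Definition posdef (f : bqf) : Prop :=
  forall v : 'cV[int]_2, v != 0 -> 0 < qf_eval f v.

(* A binary quadratic form is determined by its values on Z^2, so this is
   equality of g with the form obtained from f by the substitution M. *)
Definition sl2_equiv (f g : bqf) : Prop :=
  exists M : 'M[int]_2,
    \det M = 1 /\ forall v, qf_eval f (M *m v) = qf_eval g v.

Definition form_class (f : bqf) : set bqf := [set g | sl2_equiv f g].

Definition form_classes (n : nat) : set (set bqf) :=
  form_class @` [set f | posdef f /\ disc f = - n%:Z].

Definition class_weight (R : realType) (C : set bqf) : R :=
  if `[< exists k : int, C (BQF k 0 k) >] then 2^-1
  else if `[< exists k : int, C (BQF k (- k) k) >] then 3^-1
  else 1.

(* The sum is finitely supported, since there are finitely many classes of
   each negative discriminant. *)
Definition hurwitz (R : realType) (n : nat) : R :=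
  \sum_(C \in form_classes n) class_weight R C.

Definition sigma (R : realType) (nu : int) (m : rat) : R :=
  if m \is a Num.int then \sum_(d <- divisors `|numq m|%N) d%:R ^ nu else 0.

Definition odd_part (l : nat) : nat := (\max_(d <- divisors l | odd d) d)%N.

(* The Dirichlet series: this is the Riemann zeta function only for 1 < s. *)
Definition zeta (R : realType) (s : R) : R :=
  limn (series (fun k : nat => k.+1%:R `^ (- s))).

(* Main.v *)
(** Selling's parameters turn H(n) into a smooth count. Up to O(tau(n)), H(n) is
    twice the number of reduced forms (a, b, c) with 0 < b < a < c, and these
    correspond one-to-six to the triples of positive integers A, B, C of equal
    parity with AB + BC + CA = n. The weight B/(A + B + C) sums to 1 over the
    rotations of a triple, so H(n) is also the weighted number of triples; with
    a = (A + C)/2 and b = C it becomes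
      H(n) = sum_a sum_(b < 2a) [4a divides n + b^2] w(a, n, b) + O(tau(n)),
    where w has bounded variation in b and in n.

    In H(n) H(n + l) the two congruences are detected by additive characters. The
    frequencies k/4a + k'/4a' that are not integers contribute O(X^(3/2 + eps)), by
    Weyl's bound for quadratic exponential sums and a geometric sum over n. The
    others leave the congruence b^2 = l + b'^2 mod 4 gcd(a, a'), whose solutions
    have density sum over D | gcd(a, a') of lam(D). Summing over the multiples a of
    D, the average of w over b contributes (pi/6) sqrt(n)/D + O(log n), and
    sum_D lam(D)/D^2 is evaluated with sum_d mu(d)/d^3 = 1/zeta(3). When l > X, the
    bound H(n) << n^(1/2 + eps) suffices. *)

Require Import Defs.
From mathcomp Require Import all_boot all_order all_algebra.
From mathcomp Require Import all_classical all_reals all_analysis.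
From mathcomp Require Import zify ring lra.
From mathcomp Require Import complex.
Set Implicit Arguments.
Unset Strict Implicit.
Unset Printing Implicit Defensive.
Import Order.TTheory GRing.Theory Num.Theory.
Import numFieldNormedType.Exports.
Local Open Scope ring_scope.

(** * The divisor bound *)

(** The cutoff of the reduced domain is the obstacle: an indicator jumps once in [n] for every [b],
    so its variation in [n], added over [b], would be of order [a]. The weight [B/(A + B + C)]
    vanishes continuously at [B = 0], and summation by parts in both [b] and [n] costs only
    [O(min(1, X/a^2))]. Weyl's bound supplies [sqrt a] per modulus, and
    [sqrt a * min(1, X/a^2) <= X^(3/4)/a]; two moduli thus give [X^(3/2)], up to logarithms, divisor
    functions and gcds.

    The factor [pi/6] arises on the lines [b = a - t] and [b = a + t]: summed over [a], the weight
    gives about [ln(1 + n/(4t^2))/3 - ln(1 + n/t^2)/12]. As [ln(1 + c/t^2)] sums over [t] to about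
    [pi sqrt c], each side contributes [pi sqrt n (1/6 - 1/12)].

    Replacing [sqrt(n(n + l))] by [n] costs at most [l] per term, which is the [X l] of the error.
    The main term is [(pi/6)^2 X^2/2] times a singular series equal to [2/(7 zeta(3))] times the
    bracket, whence [252 = 36 * 2 * 7/2]. *)

Definition tau (n : nat) : nat := size (divisors n).

Lemma tau_primepow_mul (p e m : nat) : prime p -> (0 < m)%N -> ~~ (p %| m)%N ->
  (tau (p ^ e * m) <= e.+1 * tau m)%N.
Proof.
move=> pp m0 pm.
have pe0 : (0 < p ^ e)%N by rewrite expn_gt0 prime_gt0.
rewrite /tau -[X in (_ <= X * _)%N](size_iota 0) -(size_allpairs (fun i d => p ^ i * d)%N).
apply: uniq_leq_size; first exact: divisors_uniq.
move=> d; rewrite -dvdn_divisors ?muln_gt0 ?pe0 // => ddiv.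
have d0 : (0 < d)%N by apply: dvdn_gt0 ddiv; rewrite muln_gt0 pe0.
have [f fp df] := pfactor_coprime pp d0.
apply/allpairsP; exists (logn p d, f); split => /=.
- rewrite -[0%N :: _]/(iota 0 e.+1) mem_iota /= add0n ltnS -(pfactorK e pp).
  have := dvdn_leq_log p (_ : 0 < p ^ e * m)%N ddiv; rewrite muln_gt0 pe0 m0 => /(_ isT).
  by rewrite lognM // (@logn_coprime _ m) ?addn0 // prime_coprime.
- rewrite -dvdn_divisors // -(@Gauss_dvdr _ (p ^ e)) ?coprimeXr 1?coprime_sym //.
  by apply: dvdn_trans ddiv; rewrite df dvdn_mulr.
- by rewrite {1}df mulnC.
Qed.

Section DivisorBound.
Variables (R : realType) (dl : R).
Hypothesis dl_gt0 : 0 < dl.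

Let C : R := 1 + (dl * ln 2)^-1.

Let ln2 : 0 < ln (2 : R). Proof. by apply: ln_gt0; lra. Qed.

Let C_ge1 : 1 <= C.
Proof. by rewrite lerDl invr_ge0 ltW // mulr_gt0. Qed.

(** [p^(e dl) >= exp(dl ln 2 e) >= 1 + dl ln 2 e], and [C] is chosen so that [C] times the last
    quantity is at least [e + 1]. *)
Lemma succ_le_powR (p e : nat) : (2 <= p)%N -> e.+1%:R <= C * (p ^ e)%:R `^ dl.
Proof.
move=> p2; have dl2 : 0 < dl * ln 2 by exact: mulr_gt0.
have h : expR (dl * ln 2 * e%:R) <= (p ^ e)%:R `^ dl.
  rewrite /powR pnatr_eq0 expn_eq0; case: eqP => [p0|_]; first by rewrite p0 in p2.
  rewrite /= ler_expR natrX lnXn ?ltr0n ?(ltn_trans _ p2) // -mulrA ler_pM2l //.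
  rewrite mulr_natr ler_wMn2r // ler_ln ?posrE ?ltr0n ?(ltn_trans _ p2) //.
  by rewrite ler_nat.
apply: le_trans (_ : C * (1 + dl * ln 2 * e%:R) <= _); last first.
  by rewrite ler_pM2l ?(lt_le_trans _ C_ge1) //; apply: le_trans h; exact: expR_ge1Dx.
rewrite /C mulrDl mul1r mulrDr mulr1 mulKf ?gt_eqF // -(natr1 e).
have : 0 <= dl * ln 2 * e%:R by rewrite mulr_ge0 // ltW.
have : 0 <= (dl * ln 2)^-1 by rewrite invr_ge0 ltW.
by lra.
Qed.

(** Each prime below [P] costs one factor [C], by [succ_le_powR]. *)
Lemma tau_small_primes (P : nat) : exists2 K : R, 0 < K & forall n, (0 < n)%N ->
  (forall p, prime p -> (p %| n)%N -> (p < P)%N) -> (tau n)%:R <= K * n%:R `^ dl.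
Proof.
elim: P => [|P [K K0 IH]].
  exists 1 => // n n0 h.
  have -> : n = 1%N.
    by case: n n0 h => [//|[//|n]] _ h; have := h _ (pdiv_prime (isT : (1 < n.+2)%N)) (pdiv_dvd _).
  by rewrite powR1 mulr1.
exists (C * K) => [|n n0 h]; first by rewrite mulr_gt0 // (lt_le_trans _ C_ge1).
have [Pp|nPp] := boolP (prime P); last first.
  apply: le_trans (IH n n0 _) _.
    move=> p pp pn; have := h p pp pn; rewrite ltnS leq_eqVlt => /orP[/eqP pP|//].
    by rewrite -pP pp in nPp.
  by rewrite ler_wpM2r ?powR_ge0 // ler_peMl // ltW.
have [f fp df] := pfactor_coprime Pp n0.
have f0 : (0 < f)%N by case: f df {fp} => // df; rewrite df in n0.
rewrite df mulnC; apply: le_trans (_ : (_ * _)%:R <= _).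
  by rewrite ler_nat; apply: tau_primepow_mul => //; rewrite -prime_coprime.
rewrite !natrM powRM // mulrACA; apply: ler_pM => //.
  by apply: succ_le_powR; exact: prime_gt1.
apply: IH => // p pp pf; have := h p pp.
rewrite df dvdn_mulr // => /(_ isT); rewrite ltnS leq_eqVlt => /orP[/eqP pP|//].
by move: fp; rewrite prime_coprime // -pP pf.
Qed.

(** Take [P] with [P^dl >= 2]. A prime [p >= P] of exponent [e] has [e + 1 <= 2^e <= p^(e dl)], so
    it is stripped off at no cost, and only the primes below [P] contribute to the constant. *)
Lemma divisor_bound : exists2 K : R, 0 < K & forall n, (0 < n)%N ->
  (tau n)%:R <= K * n%:R `^ dl.
Proof.
have [P Ple] : exists P : nat, 2 <= (P%:R : R) `^ dl.
  exists (Num.truncn ((2 : R) `^ dl^-1)).+1.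
  apply: le_trans (_ : ((2 : R) `^ dl^-1) `^ dl <= _).
    by rewrite -powRrM mulVf ?gt_eqF // powRr1.
  by rewrite ge0_ler_powR ?nnegrE ?powR_ge0 // ltW // truncnS_gt.
have [K K0 HK] := tau_small_primes P.
exists K => // n; have [k] := ubnP n; elim: k n => // k IH n; rewrite ltnS => nk n0.
have [[p [pp pn Pp]]|h] := pselect (exists p, [/\ prime p, (p %| n)%N & (P <= p)%N]); last first.
  apply: HK => // p pp pn; rewrite ltnNge; apply/negP => Pp; apply: h; by exists p.
have [f fp df] := pfactor_coprime pp n0.
have f0 : (0 < f)%N by case: f df {fp} => // df; rewrite df in n0.
have e0 : (0 < logn p n)%N by rewrite logn_gt0 mem_primes pp n0 pn.
have fn : (f < n)%N.
  by rewrite df ltn_Pmulr // -(expn0 p) ltn_exp2l // prime_gt1.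
set e := logn p n in df e0.
rewrite df mulnC; apply: le_trans (_ : (_ * _)%:R <= _).
  by rewrite ler_nat; apply: tau_primepow_mul => //; rewrite -prime_coprime.
rewrite !natrM powRM // mulrCA; apply: ler_pM => //; last by apply: IH => //; exact: leq_trans fn nk.
apply: le_trans (_ : 2 ^+ e <= _).
  by rewrite -natrX ler_nat ltn_expl.
rewrite natrX -powR_mulrn // -powRrM mulrC powRrM powR_mulrn ?powR_ge0 //.
apply: lerXn2r; rewrite ?nnegrE ?powR_ge0 //.
apply: le_trans Ple _.
by rewrite ge0_ler_powR ?nnegrE // ?ler_nat // ltW.
Qed.

End DivisorBound.

(** * Exponential sums *)

Section ComplexExponential.
Variable R : realType.
Implicit Types (x y : R) (z : R[i]).

(** The modulus as an element of [R]; the norm that [R[i]] carries takes its values in [R[i]]. *)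
Definition cabs z : R := Normc.normc z.

Lemma cabsM z1 z2 : cabs (z1 * z2) = cabs z1 * cabs z2.
Proof. exact: Normc.normcM. Qed.

Lemma cabsD z1 z2 : cabs (z1 + z2) <= cabs z1 + cabs z2.
Proof. exact: le_normcD. Qed.

Lemma cabsN z : cabs (- z) = cabs z.
Proof. exact: normcN. Qed.

Lemma cabsB z1 z2 : cabs (z1 - z2) <= cabs z1 + cabs z2.
Proof. by rewrite -(cabsN z2); exact: cabsD. Qed.

Lemma cabs_ge0 z : 0 <= cabs z.
Proof. by case: z => a b; exact: sqrtr_ge0. Qed.

Lemma cabs0 : cabs 0 = 0. Proof. exact: Normc.normc0. Qed.


Lemma cabs_sqr z : cabs z ^+ 2 = complex.Re z ^+ 2 + complex.Im z ^+ 2.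
Proof. by case: z => a b; rewrite /cabs /= sqr_sqrtr // addr_ge0 // sqr_ge0. Qed.

Lemma cabs_real (x : R) : cabs x%:C%C = `|x|.
Proof. by rewrite /cabs /= expr0n /= addr0 sqrtr_sqr. Qed.

Lemma cabs_sum (I : Type) (r : seq I) (P : pred I) (F : I -> R[i]) :
  cabs (\sum_(i <- r | P i) F i) <= \sum_(i <- r | P i) cabs (F i).
Proof.
elim/big_ind2: _ => [|z1 x1 z2 x2 h1 h2|//]; first by rewrite cabs0.
by apply: le_trans (cabsD _ _) _; exact: lerD.
Qed.

Definition ee x : R[i] := (cos (x * (pi *+ 2)) +i* sin (x * (pi *+ 2)))%C.

Lemma eeD x y : ee (x + y) = ee x * ee y.
Proof.
rewrite /ee mulrDl cosD sinD; apply/eqP; rewrite eq_complex /=.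
by apply/andP; split; apply/eqP; ring.
Qed.

Lemma ee0 : ee 0 = 1.
Proof. by rewrite /ee mul0r cos0 sin0. Qed.

Lemma ee1 : ee 1 = 1.
Proof. by rewrite /ee mul1r cos2pi sin2pi. Qed.

Lemma ee_nat n : ee n%:R = 1.
Proof. by elim: n => [|n IH]; rewrite ?ee0 // -natr1 eeD IH ee1 mulr1. Qed.

Lemma eeMn x n : ee (x * n%:R) = ee x ^+ n.
Proof.
elim: n => [|n IH]; first by rewrite mulr0 ee0 expr0.
by rewrite -natr1 mulrDr mulr1 eeD IH exprSr.
Qed.

Lemma cabs_ee x : cabs (ee x) = 1.
Proof. by rewrite /cabs /= cos2Dsin2 sqrtr1. Qed.

Lemma eeN_conj x : ee (- x) = ((ee x)^*)%C.
Proof. by rewrite /ee mulNr cosN sinN. Qed.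

Lemma ee_modn (m q : nat) : (0 < q)%N -> ee ((m %% q)%:R / q%:R) = ee (m%:R / q%:R).
Proof.
move=> q0; rewrite [in RHS](divn_eq m q) natrD natrM mulrDl mulfK ?pnatr_eq0 -?lt0n //.
by rewrite eeD ee_nat mul1r.
Qed.

Lemma cabs_subr1_ee x : cabs (ee x - 1) = `|sin (x * pi)| *+ 2.
Proof.
apply/eqP; rewrite -(@eqrXn2 _ 2) ?cabs_ge0 ?mulrn_wge0 ?normr_ge0 //; apply/eqP.
rewrite cabs_sqr /= mulrnAr cos_mulr2n sin_mulr2n subr0.
set s := sin _; set c := cos _.
have h : c ^+ 2 = 1 - s ^+ 2 by exact: cos2sin2.
rewrite -[`|s| *+ 2]mulr_natr exprMn real_normK ?num_real // h.
rewrite -[(c * s) *+ 2]mulr_natr !exprMn h; ring.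
Qed.

(** Any positive slope would serve. Up to [pi/4] the mean value theorem applies with [cos >= 1/2];
    beyond, [sin >= sin(pi/4) >= 1/2] and [y <= pi/2 < 2]. *)
Lemma sin_ge_quarter y : 0 <= y <= pi / 2 -> y / 4 <= sin y.
Proof.
move=> /andP[y0 y2].
have p2 : pi / 2 < 2 :> R by exact: pihalf_lt2.
have pi0 : 0 < pi :> R by exact: pi_gt0.
have c4 : cos (pi / 4) ^+ 2 = 2^-1 :> R.
  have := cos_mulr2n (pi / 4 : R).
  rewrite (_ : (pi / 4) *+ 2 = pi / 2) ?cos_pihalf; last by rewrite -mulr_natr; lra.
  by rewrite -mulr_natr; lra.
have s4 : sin (pi / 4) ^+ 2 = 2^-1 :> R by rewrite sin2cos2 c4; lra.
have hc : 2^-1 <= cos (pi / 4) :> R.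
  have : 0 <= cos (pi / 4) :> R by apply: cos_ge0_pihalf; apply/andP; split; lra.
  by nra.
have hs : 2^-1 <= sin (pi / 4) :> R.
  have : 0 <= sin (pi / 4) :> R by apply: sin_ge0_pi; apply/andP; split; lra.
  by nra.
have [y4|y4] := leP y (pi / 4).
  have cs : {within `[0, y], continuous (@sin R)}%classic.
    by apply: continuous_subspaceT => x; exact: continuous_sin.
  have [c] := MVT_segment y0 (fun x _ => is_derive_sin x) cs.
  rewrite in_itv /= => /andP[c0 cy]; rewrite sin0 !subr0 => ->.
  have : cos (pi / 4) <= cos c.
    by rewrite leNgt ltr_cos ?in_itv /= -?leNgt; [lra|apply/andP; split; lra..].
  by nra.
have : sin (pi / 4) <= sin y.
  by rewrite leNgt ltr_sin ?in_itv /= -?leNgt; [lra|apply/andP; split; lra..].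
by lra.
Qed.

(** The inverse distance of [r/q] to the integers is the larger of [q/r] and [q/(q - r)]. Their sum
    is used instead: it needs no case distinction and is easy to sum over [r]. *)
Lemma cabs_ee_sub1_ge (r q : nat) : (0 < r < q)%N ->
  (cabs (ee (r%:R / q%:R) - 1))^-1 <= q%:R / r%:R + q%:R / (q - r)%:R.
Proof.
move=> /andP[r0 rq]; have q0 : (0 < q)%N by exact: leq_trans rq.
have key (s : nat) : (0 < s)%N -> (s.*2 <= q)%N ->
    s%:R / q%:R <= cabs (ee (s%:R / q%:R) - 1).
  move=> s0 sq; rewrite cabs_subr1_ee.
  have hh : s%:R / q%:R <= 2^-1 :> R.
    rewrite ler_pdivrMr ?ltr0n // mulrC ler_pdivlMr ?ltr0n //.
    by rewrite -natrM ler_nat muln2.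
  have h0 : 0 <= s%:R / q%:R :> R by rewrite divr_ge0.
  set x := s%:R / q%:R in hh h0 *.
  have p2 : 2 <= pi :> R by exact: pi_ge2.
  have : x * pi / 4 <= sin (x * pi) by apply: sin_ge_quarter; apply/andP; split; nra.
  move=> h; apply: le_trans (_ : sin (x * pi) *+ 2 <= _); last by rewrite lerMn2r /= ler_norm.
  by rewrite -mulr_natr; nra.
have pos (s : nat) : (0 < s)%N -> 0 < s%:R / q%:R :> R by move=> s0; rewrite divr_gt0 ?ltr0n.
have nn (s : nat) : 0 <= q%:R / s%:R :> R by rewrite divr_ge0.
have [h|h] := leqP r.*2 q.
  apply: le_trans (_ : (r%:R / q%:R)^-1 <= _).
    by rewrite lef_pV2 ?posrE ?pos ?key // (lt_le_trans (pos r r0)) ?key.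
  by rewrite invf_div lerDl nn.
have qr0 : (0 < q - r)%N by rewrite subn_gt0.
have E : cabs (ee (r%:R / q%:R) - 1) = cabs (ee ((q - r)%:R / q%:R) - 1).
  rewrite !cabs_subr1_ee natrB ?(ltnW rq) // mulrBl mulfV ?pnatr_eq0 -?lt0n //.
  by rewrite mulrBl mul1r sinB sinpi cospi mul0r sub0r mulN1r opprK.
rewrite E; apply: le_trans (_ : ((q - r)%:R / q%:R)^-1 <= _).
  have k : ((q - r).*2 <= q)%N by lia.
  by rewrite lef_pV2 ?posrE ?pos ?key // (lt_le_trans (pos _ qr0)) ?key.
by rewrite invf_div lerDr nn.
Qed.

(* An upper bound, up to a constant, for the inverse of the distance from [m/q] to
   the integers. *)
Definition idist (q m : nat) : R := q%:R / (m %% q)%:R + q%:R / (q - m %% q)%:R.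

Lemma idist_ge0 q m : 0 <= idist q m.
Proof. by rewrite /idist addr_ge0 // divr_ge0. Qed.

Lemma geom_ee_bound (m q i j : nat) : (0 < q)%N -> (m %% q != 0)%N ->
  cabs (\sum_(i <= n < j) ee (m%:R / q%:R) ^+ n) <= 2 * idist q m.
Proof.
move=> q0 mq; have [ji|ij] := leqP j i.
  by rewrite big_geq // cabs0 mulr_ge0 ?idist_ge0.
set z := ee _.
have E : (z - 1) * (\sum_(i <= n < j) z ^+ n) = z ^+ j - z ^+ i.
  rewrite -(telescope_sumr _ (ltnW ij)) mulr_sumr; apply: eq_bigr => n _.
  by rewrite mulrBl -exprS mul1r.
have rq : (0 < m %% q < q)%N by rewrite lt0n mq ltn_mod.
have zE : z = ee ((m %% q)%:R / q%:R) by rewrite ee_modn.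
have c0 : 0 < cabs (z - 1).
  case/andP: rq => r0 rq; rewrite zE cabs_subr1_ee mulrn_wgt0 // normr_gt0 gt_eqF //.
  apply: sin_gt0_pi; rewrite mulr_gt0 ?pi_gt0 ?divr_gt0 ?ltr0n //=.
  by rewrite gtr_pMl ?pi_gt0 // ltr_pdivrMr ?ltr0n // mul1r ltr_nat.
rewrite -(ler_pM2l c0) -cabsM E.
apply: le_trans (cabsB _ _) _.
have cz n : cabs (z ^+ n) = 1 by rewrite -eeMn cabs_ee.
rewrite !cz; have := cabs_ee_sub1_ge rq; rewrite -zE -/(idist q m) => h.
rewrite -(@ler_pM2l _ (cabs (z - 1))) // in h; rewrite mulfV ?gt_eqF // in h.
by lra.
Qed.

Lemma ee_orthogonality (m q : nat) : (0 < q)%N ->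
  \sum_(0 <= k < q) ee (m%:R / q%:R) ^+ k = (q * (q %| m))%:R.
Proof.
move=> q0; have [/dvdnP[c ->]|qm] := boolP (q %| m)%N.
  rewrite natrM mulfK ?pnatr_eq0 -?lt0n // ee_nat muln1.
  rewrite (eq_bigr (fun=> 1)) => [|i _]; last by rewrite expr1n.
  by rewrite sumr_const_nat subn0.
rewrite muln0; set z := ee _.
have E : (z - 1) * (\sum_(0 <= n < q) z ^+ n) = z ^+ q - z ^+ 0.
  rewrite -(telescope_sumr _ (leq0n q)) mulr_sumr; apply: eq_bigr => n _.
  by rewrite mulrBl -exprS mul1r.
move: E; rewrite {2}/z -eeMn mulfVK ?pnatr_eq0 -?lt0n // ee_nat expr0 subrr => /eqP.
rewrite mulf_eq0 => /orP[|/eqP //] /eqP h0; exfalso.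
have := cabs0; rewrite -h0 /z -ee_modn // cabs_subr1_ee => /eqP.
rewrite mulrn_eq0 /= normr_eq0 gt_eqF //; apply: sin_gt0_pi.
have r0 : (0 < m %% q)%N by rewrite lt0n.
rewrite mulr_gt0 ?pi_gt0 ?divr_gt0 ?ltr0n //=.
by rewrite gtr_pMl ?pi_gt0 // ltr_pdivrMr ?ltr0n // mul1r ltr_nat ltn_mod.
Qed.

End ComplexExponential.

Lemma sum_multiples (V : nmodType) (e n : nat) (F : nat -> V) : (0 < e)%N ->
  \sum_(1 <= r < n.+1 | (e %| r)%N) F r = \sum_(1 <= s < (n %/ e).+1) F (s * e)%N.
Proof.
move=> e0; elim: n => [|n IH]; first by rewrite div0n !big_geq.
rewrite big_mkcond big_nat_recr //= -big_mkcond /= IH divnS //.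
case: ifP => [en|_]; last by rewrite addr0.
rewrite add1n [in RHS]big_nat_recr //=; congr (_ + F _).
by have := divnS n e0; rewrite en add1n => <-; rewrite divnK.
Qed.

Section Sums.
Variable R : realType.

Definition harm (n : nat) : R := \sum_(1 <= j < n.+1) j%:R^-1.

Lemma harm_ge0 n : 0 <= harm n.
Proof. by apply: sumr_ge0 => i _; rewrite invr_ge0. Qed.

Lemma harm_le m n : (m <= n)%N -> harm m <= harm n.
Proof.
move=> mn; rewrite /harm (@big_cat_nat _ _ _ m.+1 1 n.+1) //= lerDl.
by apply: sumr_ge0 => i _; rewrite invr_ge0.
Qed.

Lemma harm_ge1 n : (0 < n)%N -> 1 <= harm n.
Proof. by move=> n0; apply: le_trans (harm_le n0); rewrite /harm big_nat1 invr1. Qed.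

Lemma sum_image_le (I J : finType) (h : I -> J) (f : J -> R) :
  injective h -> (forall j, 0 <= f j) -> \sum_i f (h i) <= \sum_j f j.
Proof.
move=> hinj f0; have := @big_imset _ 0 +%R I J h predT f (in2W hinj).
move=> <-; rewrite [leRHS](bigID (mem [set h x | x in predT])) /= lerDl.
exact: sumr_ge0.
Qed.

(** The injectivity hypothesis says that the fibres of [phi] have at most [d] elements, [g]
    labelling the points of each fibre. *)
Lemma sum_fiber_le (I J : finType) (d : nat) (phi : I -> J) (g : I -> 'I_d) (f : J -> R) :
  injective (fun i => (phi i, g i)) -> (forall j, 0 <= f j) ->
  \sum_i f (phi i) <= d%:R * \sum_j f j.
Proof.
move=> hinj f0.
apply: le_trans (@sum_image_le _ _ _ (fun p => f p.1) hinj (fun p => f0 p.1)) _.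
rewrite -(pair_big xpredT xpredT (fun j _ => f j)) /= mulr_sumr.
by apply: ler_sum => j _; rewrite sumr_const card_ord mulr_natl.
Qed.

(** Summation by parts. It removes the weights twice: in [b] from the quadratic sums, and in [n]
    from the geometric ones. *)
Lemma abel_bound (z c : nat -> R[i]) (i j : nat) (G : R) : (i <= j)%N ->
  (forall m, (m <= j.+1)%N -> cabs (\sum_(i <= n < m) z n) <= G) ->
  cabs (\sum_(i <= n < j.+1) z n * c n) <=
  G * (cabs (c j) + \sum_(i <= n < j) cabs (c n.+1 - c n)).
Proof.
move=> ij zG.
have -> : \sum_(i <= n < j.+1) z n * c n = (\sum_(i <= n < j.+1) z n) * c j
    - \sum_(i <= n < j) (\sum_(i <= k < n.+1) z k) * (c n.+1 - c n).
  elim: j ij {zG} => [|j IH] ij.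
    by move: ij; rewrite leqn0 => /eqP ->; rewrite !big_nat1 big_geq // subr0.
  move: ij; rewrite leq_eqVlt => /orP[/eqP ->|ij].
    by rewrite !big_nat1 big_geq // subr0.
  rewrite ltnS in ij; rewrite big_nat_recr ?(leqW ij) //= IH // [X in _ = _ - X]big_nat_recr //=.
  rewrite [X in _ = X * _ - _]big_nat_recr ?(leqW ij) //=; ring.
apply: le_trans (cabsB _ _) _; rewrite cabsM mulrDr; apply: lerD.
  by rewrite ler_wpM2r ?cabs_ge0 ?zG.
apply: le_trans (cabs_sum _ _ _) _; rewrite mulr_sumr !big_nat; apply: ler_sum => n /andP[_ nj].
by rewrite cabsM ler_wpM2r ?cabs_ge0 ?zG // ltnS ltnW.
Qed.

(** Weyl differencing: the terms of the squared modulus are grouped by the shift [h] between the two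
    indices, and negative shifts give the conjugates. *)
Lemma sum_mul_conj (v : nat -> R[i]) (L : nat) :
  (\sum_(0 <= n < L) v n) * ((\sum_(0 <= n < L) v n)^*)%C =
  \sum_(0 <= n < L) v n * ((v n)^*)%C +
  \sum_(1 <= h < L) (\sum_(0 <= c < L - h) v (c + h)%N * ((v c)^*)%C +
    (\sum_(0 <= c < L - h) v (c + h)%N * ((v c)^*)%C)^*%C).
Proof.
rewrite big_split /= -rmorph_sum.
elim: L => [|L IH]; first by rewrite !big_geq // mul0r !add0r rmorph0.
have -> : \sum_(1 <= h < L.+1) \sum_(0 <= c < L.+1 - h) v (c + h)%N * ((v c)^*)%C =
  \sum_(1 <= h < L) (\sum_(0 <= c < L - h) v (c + h)%N * ((v c)^*)%C) +
   v L * ((\sum_(0 <= n < L) v n)^*)%C.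
  transitivity (\sum_(1 <= h < L.+1) (\sum_(0 <= c < L - h) v (c + h)%N * ((v c)^*)%C) +
     \sum_(1 <= h < L.+1) v L * ((v (L - h)%N)^*)%C).
    rewrite -big_split /= !big_nat; apply: eq_bigr => h /andP[h1 hL].
    by rewrite subSn // big_nat_recr //= subnK.
  congr (_ + _).
    case: L {IH} => [|L]; first by rewrite !big_geq.
    by rewrite big_nat_recr //= subnn [X in _ + X]big_geq // addr0.
  rewrite big_nat_rev /= big_add1 /= rmorph_sum mulr_sumr !big_nat; apply: eq_bigr => n nL.
  by congr (_ * (v _)^*%C); lia.
rewrite !(big_nat_recr _ _ _ (leq0n L)) /= !rmorphD rmorphM /= conjcK mulrDl !mulrDr IH.
ring.
Qed.

Lemma sum_idist (Q : nat) : \sum_(1 <= r < Q) idist R Q r <= 2 * Q%:R * harm Q.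
Proof.
apply: le_trans (_ : \sum_(1 <= r < Q) (Q%:R * r%:R^-1) +
   \sum_(1 <= r < Q) (Q%:R * (Q - r)%:R^-1) <= _).
  rewrite -big_split /= !big_nat; apply: ler_sum => r /andP[r1 rQ].
  by rewrite /idist modn_small.
have h : \sum_(1 <= r < Q) (Q%:R * r%:R^-1) <= Q%:R * harm Q.
  rewrite -mulr_sumr ler_wpM2l //; case: Q => [|Q]; first by rewrite big_geq // harm_ge0.
  by apply: le_trans (harm_le (leqnSn Q)); rewrite /harm.
rewrite [X in _ + X]big_nat_rev /=.
rewrite [X in _ + X](_ : _ = \sum_(1 <= r < Q) (Q%:R * r%:R^-1)); first by lra.
by rewrite !big_nat; apply: eq_bigr => r rQ; congr (_ * _%:R^-1); lia.
Qed.

(** Bounds a geometric sum of ratio [ee (r/Q)] and length at most [Q]: trivially when [r/Q] is an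
    integer, by [geom_ee_bound] otherwise. *)
Definition weyl_term (Q r : nat) : R := if (Q %| r)%N then Q%:R else 2 * idist R Q r.

Lemma weyl_term_ge0 Q r : 0 <= weyl_term Q r.
Proof. by rewrite /weyl_term; case: ifP => // _; rewrite mulr_ge0 // idist_ge0. Qed.

Lemma weyl_term_mod Q r : weyl_term Q (r %% Q) = weyl_term Q r.
Proof. by rewrite /weyl_term /idist modn_mod /dvdn modn_mod. Qed.

(** [k * h] modulo [Q] determines [h] modulo [Q / gcd(k, Q)]. The quotient of [h] by that modulus
    takes [gcd(k, Q)] values and labels the fibre. *)
Lemma mulmod_fiber (k Q : nat) (Q0 : (0 < Q)%N) :
  exists g : 'I_Q -> 'I_(gcdn k Q),
  injective (fun h : 'I_Q => (Ordinal (ltn_pmod (k * h) Q0), g h)).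
Proof.
have d0 : (0 < gcdn k Q)%N by rewrite gcdn_gt0 Q0 orbT.
have dQ : (Q %/ gcdn k Q * gcdn k Q = Q)%N by rewrite divnK // dvdn_gcdr.
have dk : (k %/ gcdn k Q * gcdn k Q = k)%N by rewrite divnK // dvdn_gcdl.
have Qd0 : (0 < Q %/ gcdn k Q)%N by rewrite divn_gt0 // dvdn_leq // dvdn_gcdr.
have lt (h : 'I_Q) : (h %/ (Q %/ gcdn k Q) < gcdn k Q)%N.
  by rewrite ltn_divLR // mulnC dQ.
exists (fun h => Ordinal (lt h)) => h1 h2 [] e1 e2.
apply/val_inj => /=; rewrite (divn_eq h1 (Q %/ gcdn k Q)) (divn_eq h2 (Q %/ gcdn k Q)) e2.
congr (_ + _)%N.
have co : coprime (Q %/ gcdn k Q) (k %/ gcdn k Q).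
  by rewrite /coprime -(eqn_pmul2r d0) muln_gcdl dQ dk mul1n gcdnC.
wlog le12 : h1 h2 e1 {e2} / (h1 <= h2)%N.
  by move=> H; have [/H->//|/ltnW/H->//] := leqP h1 h2.
apply/eqP; rewrite eq_sym eqn_mod_dvd // -(Gauss_dvdr _ co) -(dvdn_pmul2r d0) dQ.
by rewrite mulnAC dk mulnBr -eqn_mod_dvd ?leq_mul2l ?le12 ?orbT // e1.
Qed.

Lemma sum_weyl_term (k Q : nat) : (0 < Q)%N ->
  \sum_(0 <= h < Q) weyl_term Q (k * h) <= (gcdn k Q)%:R * (5 * Q%:R * harm Q).
Proof.
move=> Q0; have [g ginj] := mulmod_fiber k Q0.
rewrite big_mkord.
apply: le_trans (_ : \sum_(h < Q) weyl_term Q (Ordinal (ltn_pmod (k * h) Q0)) <= _).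
  by apply: ler_sum => h _ /=; rewrite weyl_term_mod.
apply: le_trans (sum_fiber_le (f := fun j : 'I_Q => weyl_term Q j) ginj _) _.
  by move=> j; exact: weyl_term_ge0.
rewrite ler_wpM2l // -(big_mkord xpredT (fun j => weyl_term Q j)) (big_ltn Q0).
rewrite {1}/weyl_term dvdn0.
have -> : \sum_(1 <= i < Q) weyl_term Q i = 2 * \sum_(1 <= r < Q) idist R Q r.
  rewrite mulr_sumr !big_nat; apply: eq_bigr => r /andP[r1 rQ].
  by rewrite /weyl_term gtnNdvd.
have := sum_idist Q; have := harm_ge1 Q0; have : 0 <= Q%:R :> R by [].
by nra.
Qed.

(** Differencing leaves geometric sums of ratio [ee (k h/(2a))], one for each shift [h]. The
    diagonal gives at most [2a] and the shifts, counted with their conjugates, [2 * 5 * 2a] times a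
    gcd and a harmonic sum; hence [22]. *)
Lemma weyl_bound (a k s t : nat) : (0 < a)%N -> (t <= 2 * a)%N ->
  cabs (\sum_(s <= b < t) @ee R ((k * b ^ 2)%:R / (4 * a)%:R)) ^+ 2 <=
  22 * a%:R * (gcdn k (2 * a))%:R * harm (2 * a).
Proof.
move=> a0 t2a; have Q0 : (0 < 2 * a)%N by rewrite muln_gt0.
have g0 : 1 <= (gcdn k (2 * a))%:R :> R by rewrite ler1n gcdn_gt0 Q0 orbT.
have H1 := harm_ge1 Q0.
have a1 : 1 <= a%:R :> R by rewrite ler1n.
have [ts|st] := leqP t s.
  rewrite big_geq // cabs0 expr0n /=.
  by rewrite !mulr_ge0 ?harm_ge0.
set L := (t - s)%N.
pose v n := @ee R ((k * (s + n) ^ 2)%:R / (4 * a)%:R).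
have -> : \sum_(s <= b < t) @ee R ((k * b ^ 2)%:R / (4 * a)%:R) = \sum_(0 <= n < L) v n.
  by rewrite -{1}[s]add0n big_addn; apply: eq_bigr => i _; rewrite /v addnC.
have cconj (z : R[i]) : cabs (z^*)%C = cabs z.
  by case: z => x y; rewrite /cabs /= sqrrN.
rewrite expr2 -{2}cconj -cabsM sum_mul_conj.
have vv n : v n * ((v n)^*)%C = 1 by rewrite -eeN_conj -eeD subrr ee0.
have a4 : (4 * a)%:R != 0 :> R by rewrite pnatr_eq0; lia.
have a2 : (2 * a)%:R != 0 :> R by rewrite pnatr_eq0; lia.
have T h : (0 < h)%N -> cabs (\sum_(0 <= c < L - h) v (c + h)%N * ((v c)^*)%C) <=
    weyl_term (2 * a) (k * h).
  move=> h0.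
  (* The difference of the squares of [s + c + h] and [s + c] is linear in [c], and the factor 2 in
     it turns the denominator [4a] into [2a]. *)
  have E c : v (c + h)%N * ((v c)^*)%C =
     @ee R ((k * h * (2 * s + h))%:R / (4 * a)%:R) * @ee R ((k * h)%:R / (2 * a)%:R) ^+ c.
    rewrite -eeN_conj -eeD -eeMn -eeD; congr (@ee R _).
    rewrite !natrM ?natrX ?natrM !natrD; field.
    by rewrite pnatr_eq0 -lt0n.
  rewrite (eq_bigr _ (fun c _ => E c)) -mulr_sumr cabsM cabs_ee mul1r /weyl_term.
  case: ifP => [/eqP|] kh; last by apply: geom_ee_bound => //; rewrite -/(dvdn _ _) kh.
  apply: le_trans (cabs_sum _ _ _) _.
  rewrite (eq_bigr (fun=> 1)) => [|i _]; last by rewrite -eeMn cabs_ee.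
  by rewrite sumr_const_nat subn0 ler_nat; rewrite /L; lia.
apply: le_trans (cabsD _ _) _.
rewrite (eq_bigr _ (fun n _ => vv n)) sumr_const_nat subn0.
have -> : cabs (1 *+ L) = L%:R :> R by rewrite /cabs normcMn Normc.normc1.
apply: le_trans (_ : (2 * a)%:R + \sum_(1 <= h < 2 * a) 2 * weyl_term (2 * a) (k * h) <= _).
  apply: lerD; first by rewrite ler_nat /L; lia.
  apply: le_trans (cabs_sum _ _ _) _.
  rewrite [leRHS](@big_cat_nat _ _ _ L 1 (2 * a)) /=; [|by rewrite /L; lia..].
  apply: ler_wpDr; first by apply: sumr_ge0 => h _; rewrite mulr_ge0 ?weyl_term_ge0.
  rewrite !big_nat; apply: ler_sum => h /andP[h0 _].
  apply: le_trans (cabsD _ _) _; rewrite cconj.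
  by have := T h h0; lra.
have S := sum_weyl_term k Q0.
rewrite (big_ltn Q0) in S; have w0 := weyl_term_ge0 (2 * a) (k * 0).
rewrite -mulr_sumr; rewrite !natrM in S *.
set W := \sum_(1 <= i < 2 * a) _ in S *.
set g := (gcdn _ _)%:R in g0 S *; set H := harm _ in H1 S *.
set A := a%:R in a1 S *.
have gH : 1 <= g * H by nra.
have : A <= A * (g * H) by nra.
by lra.
Qed.
End Sums.

(** * Pairs of quadratic congruences *)

Section PairError.
Variable R : realType.

(** The factor that summation by parts produces for the coefficients [f 0, ..., f (m - 1)]: the last
    value and the total variation. *)
Definition bv (f : nat -> R) (m : nat) : R :=
  `|f m.-1| + \sum_(0 <= b < m.-1) `|f b.+1 - f b|.

Lemma bv_ge0 f m : 0 <= bv f m.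
Proof. by rewrite addr_ge0 // sumr_ge0. Qed.

Definition gsum (a k : nat) (f : nat -> R) : R[i] :=
  \sum_(0 <= b < 2 * a) (f b)%:C%C * ee ((k * b ^ 2)%:R / (4 * a)%:R).

Definition ebound (a k : nat) : R :=
  Num.sqrt (22 * a%:R * (gcdn k (2 * a))%:R * harm R (2 * a)).

Lemma gsum_bound (a k : nat) f : (0 < a)%N ->
  cabs (gsum a k f) <= bv f (2 * a) * ebound a k.
Proof.
move=> a0; rewrite /gsum /bv.
have -> : (2 * a = (2 * a).-1.+1)%N by rewrite prednK // muln_gt0.
set j := (2 * a).-1; rewrite -[j.+1.-1]/j.
rewrite (eq_bigr (fun b => ee ((k * b ^ 2)%:R / (4 * a)%:R) * (f b)%:C%C)); last first.
  by move=> b _; rewrite mulrC.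
apply: le_trans (@abel_bound _ _ _ 0 j (ebound a k) (leq0n _) _) _.
  move=> m jm; have {}jm : (m <= 2 * a)%N by rewrite /j prednK ?muln_gt0 // in jm.
  rewrite -(ger0_norm (cabs_ge0 _)) -sqrtr_sqr /ebound ler_wsqrtr //.
  exact: weyl_bound.
rewrite mulrC cabs_real le_eqVlt; apply/orP; left; apply/eqP; congr ((_ + _) * _).
by apply: eq_bigr => b _; rewrite -rmorphB cabs_real.
Qed.

Lemma gsumB a k f g : gsum a k (fun b => f b - g b) = gsum a k f - gsum a k g.
Proof.
by rewrite /gsum -sumrB; apply: eq_bigr => b _; rewrite rmorphB mulrBl.
Qed.

(** * Pairs of frequencies with denominators [q] and [q'] *)

Section Frequencies.
Variables (q q' : nat).
Hypotheses (q0 : (0 < q)%N) (q'0 : (0 < q')%N).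
Let h := gcdn q q'.
Let q1 := (q %/ h)%N.
Let q1' := (q' %/ h)%N.
Let Lc := (h * q1 * q1')%N.

(** The numerator of [p.1/q + p.2/q'] over the common denominator [Lc], the least common multiple of
    [q] and [q']. *)
Definition freq (p : 'I_q * 'I_q') : nat := (p.1 * q1' + p.2 * q1)%N.

Let h0 : (0 < h)%N. Proof. by rewrite gcdn_gt0 q0. Qed.
Let qE : q = (h * q1)%N. Proof. by rewrite mulnC divnK // dvdn_gcdl. Qed.
Let q'E : q' = (h * q1')%N. Proof. by rewrite mulnC divnK // dvdn_gcdr. Qed.
Let q10 : (0 < q1)%N. Proof. by rewrite divn_gt0 // dvdn_leq // dvdn_gcdl. Qed.
Let q1'0 : (0 < q1')%N. Proof. by rewrite divn_gt0 // dvdn_leq // dvdn_gcdr. Qed.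
Let Lc0 : (0 < Lc)%N. Proof. by rewrite !muln_gt0 h0 q10. Qed.
Let co : coprime q1 q1'.
Proof. by rewrite /coprime -(eqn_pmul2l h0) muln_gcdr -qE -q'E muln1. Qed.

Let q1L : (q1 %| Lc)%N. Proof. by apply: dvdn_mulr; exact: dvdn_mull. Qed.

Let LcE : Lc = (q' * q1)%N. Proof. by rewrite q'E /Lc mulnAC. Qed.

(** Modulo [q1] only [p.1 * q1'] survives, and [q1'] is prime to [q1]; so [freq p] fixes [p.1]
    modulo [q1]. The quotient of [p.1] by [q1] has [h] values, and once [p.1] is known [p.2] is
    determined modulo [q']. *)
Lemma freq_fiber : exists g : 'I_q * 'I_q' -> 'I_h,
  injective (fun p => (Ordinal (ltn_pmod (freq p) Lc0), g p)).
Proof.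
have lt (p : 'I_q * 'I_q') : (p.1 %/ q1 < h)%N by rewrite ltn_divLR // -qE.
exists (fun p => Ordinal (lt p)) => -[k1 k1'] [k2 k2'] [] /= e1 e2.
have ek : k1 = k2.
  apply/val_inj => /=; rewrite (divn_eq k1 q1) (divn_eq k2 q1) e2; congr (_ + _)%N.
  have e3 : (k1 * q1' = k2 * q1' %[mod q1])%N.
    have := congr1 (modn^~ q1) e1; rewrite !(modn_dvdm _ q1L).
    by rewrite /freq /= ![(_ * q1)%N]mulnC !(addnC (_ * q1')%N) ![(q1 * _)%N]mulnC !modnMDl.
  wlog le12 : k1 k2 e3 {e1 e2} / (k1 <= k2)%N.
    by move=> H; have [/H->//|/ltnW/H->//] := leqP k1 k2.
  apply/eqP; rewrite eq_sym eqn_mod_dvd // -(Gauss_dvdl _ co) mulnBl.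
  by rewrite -eqn_mod_dvd ?leq_mul2r ?le12 ?orbT // e3.
subst k2; congr (_, _); apply/val_inj => /=.
have q'k (k : 'I_q') : (k %% q' = k)%N by rewrite modn_small.
rewrite -(q'k k1') -(q'k k2'); apply/eqP.
move/eqP: e1; rewrite /freq /= eqn_modDl.
rewrite LcE.
by rewrite -!muln_modl eqn_pmul2r.
Qed.

Lemma sum_freq (f : nat -> R) : (forall n, 0 <= f n) ->
  \sum_(p : 'I_q * 'I_q') f (freq p %% Lc)%N <= h%:R * \sum_(0 <= r < Lc) f r.
Proof.
move=> f0; have [g ginj] := freq_fiber; rewrite big_mkord.
exact: (sum_fiber_le (f := fun j : 'I_Lc => f j) ginj).
Qed.

(** The pairs of integral frequency are [p.1/q = j/h], [p.2/q' = -j/h] modulo 1, with [j] modulo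
    [h]. Their characters add up to the detector of [x = y] modulo [h]. *)
Lemma sum_freq0 (x y : nat) :
  \sum_(p : 'I_q * 'I_q' | (Lc %| freq p)%N)
     ee ((p.1 * x)%:R / q%:R) * ee ((p.2 * y)%:R / q'%:R) =
  (h * (x == y %[mod h]))%:R :> R[i].
Proof.
have lt1 (j : 'I_h) : (j * q1 < q)%N by rewrite qE ltn_pmul2r.
pose de (j : 'I_h) : 'I_q * 'I_q' :=
  (* Multiplication by [h.-1] stands for a change of sign: [j * q1' * h] is a multiple of [q']. *)
  (Ordinal (lt1 j), Ordinal (ltn_pmod (j * q1' * h.-1) q'0)).
have lt (p : 'I_q * 'I_q') : (p.1 %/ q1 < h)%N by rewrite ltn_divLR // -qE.
rewrite (reindex_onto de (fun p => Ordinal (lt p))) /=; last first.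
  move=> [k k'] /= dv.
  have q1k : (q1 %| k)%N.
    rewrite -(Gauss_dvdl _ co).
    have : (q1 %| freq (k, k'))%N by exact: dvdn_trans q1L dv.
    by rewrite /freq /= dvdn_addl // dvdn_mull.
  congr (_, _); apply/val_inj => /=; first by rewrite divnK.
  set j := (k %/ q1)%N.
  have kE : k = (j * q1)%N :> nat by rewrite divnK.
  have : (q' %| j * q1' + k')%N.
    rewrite -(@dvdn_pmul2r q1) //; move: dv; rewrite /freq /= kE.
    by rewrite LcE mulnDl mulnAC.
  move/dvdnP => [c hc].
  have -> : (j * q1' * h.-1)%N = (j * q1' * h - j * q1')%N by rewrite -subn1 mulnBr muln1.
  rewrite -[RHS](@modn_small _ q') //; apply/eqP.
  rewrite -(eqn_modDr (j * q1')) subnK ?leq_pmulr // addnC hc.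
  by rewrite modnMl -mulnA [(q1' * h)%N]mulnC -q'E modnMl.
have hR : h%:R != 0 :> R by rewrite pnatr_eq0 -lt0n.
have q1R : q1%:R != 0 :> R by rewrite pnatr_eq0 -lt0n.
have q1'R : q1'%:R != 0 :> R by rewrite pnatr_eq0 -lt0n.
have -> : (x == y %[mod h]) = (h %| x + h.-1 * y)%N.
  by rewrite /dvdn -(eqn_modDr (h.-1 * y) x y) -mulSn prednK // modnMr.
rewrite -(ee_orthogonality R (x + h.-1 * y) h0) big_mkord.
apply: eq_big => [j|j _].
  rewrite /freq /=; apply/andP; split; last first.
    by apply/eqP/val_inj => /=; rewrite mulnK.
  rewrite LcE [(q' * q1)%N]mulnC.
  rewrite -mulnA [(q1 * q1')%N]mulnC mulnA [(_ %% _ * q1)%N]mulnC [(_ * q1)%N]mulnC -mulnDr.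
  rewrite dvdn_pmul2l // /dvdn modnDmr -{1}[(j * q1')%N]muln1 -mulnDr add1n prednK //.
  by rewrite -mulnA [(q1' * h)%N]mulnC -q'E modnMl.
rewrite /= -[ee ((_ %% q' * y)%:R / _)]ee_modn // modnMml ee_modn //.
rewrite -eeD -eeMn; congr ee; rewrite qE q'E !natrM !natrD !natrM.
by field; rewrite hR q1R q1'R.
Qed.

(** The gcd is at most the sum of the divisors [e] common to [r] and [d]. For each [e] the factor
    [e] is paid for by the sparsity of its multiples [r], so every divisor of [d] costs the same.
    The reflection of [r] into [Lc - r] preserves the gcd because [d] divides [Lc]. *)
Lemma sum_gcd_idist (d : nat) : (d %| Lc)%N ->
  \sum_(1 <= r < Lc) idist R Lc r * (gcdn r d)%:R <= 2 * Lc%:R * (tau d)%:R * harm R Lc.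
Proof.
move=> dL; have d0 : (0 < d)%N by exact: dvdn_gt0 dL.
have h1 : \sum_(1 <= r < Lc) (Lc%:R / r%:R) * (gcdn r d)%:R <=
    Lc%:R * (tau d)%:R * harm R Lc.
  apply: le_trans (_ : \sum_(1 <= r < Lc) \sum_(e <- divisors d | (e %| r)%N)
      (Lc%:R / r%:R) * e%:R <= _).
    rewrite !big_nat; apply: ler_sum => r /andP[r1 _].
    rewrite (big_rem (gcdn r d)) -?dvdn_divisors ?dvdn_gcdr //= dvdn_gcdl.
    by rewrite lerDl sumr_ge0 // => i _; rewrite mulr_ge0 // divr_ge0.
  rewrite (exchange_big_dep xpredT) //=.
  have Hd e : e \in divisors d -> \sum_(1 <= r < Lc | (e %| r)%N) Lc%:R / r%:R * e%:R <=
      Lc%:R * harm R Lc.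
    rewrite -dvdn_divisors // => ed; have e0 := dvdn_gt0 d0 ed.
    apply: le_trans (_ : \sum_(1 <= r < Lc.+1 | (e %| r)%N) Lc%:R / r%:R * e%:R <= _).
      rewrite [leRHS]big_mkcond big_nat_recr //= -big_mkcond lerDl.
      by case: ifP => // _; rewrite mulr_ge0 // divr_ge0.
    rewrite sum_multiples //.
    apply: le_trans (_ : \sum_(1 <= s < (Lc %/ e).+1) Lc%:R * s%:R^-1 <= _).
      rewrite !big_nat; apply: ler_sum => s /andP[s1 _].
      rewrite natrM invfM -!mulrA mulVf ?mulr1 // pnatr_eq0 -lt0n //.
    by rewrite -mulr_sumr ler_wpM2l // harm_le // leq_div.
  rewrite big_seq; apply: le_trans (ler_sum _ (fun e he => Hd e he)) _.
  rewrite -big_seq big_const_seq count_predT iter_addr addr0.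
  by rewrite -[X in X <= _]mulr_natr /tau mulrAC.
apply: le_trans (_ : \sum_(1 <= r < Lc) (Lc%:R / r%:R) * (gcdn r d)%:R +
   \sum_(1 <= r < Lc) (Lc%:R / (Lc - r)%:R) * (gcdn r d)%:R <= _).
  rewrite -big_split /= !big_nat; apply: ler_sum => r /andP[r1 rL].
  by rewrite /idist modn_small // mulrDl.
rewrite [X in _ + X]big_nat_rev /=.
rewrite [X in _ + X](_ : _ = \sum_(1 <= r < Lc) (Lc%:R / r%:R) * (gcdn r d)%:R); first by lra.
rewrite !big_nat; apply: eq_bigr => r /andP[r1 rL]; rewrite add1n subSS.
have -> : (Lc - (Lc - r) = r)%N by lia.
congr (_ * _%:R); apply/eqP; rewrite eqn_dvd !dvdn_gcd !dvdn_gcdr !andbT.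
have rL' : (r <= Lc)%N by exact: ltnW.
have gL x : (gcdn x d %| Lc)%N by exact: dvdn_trans (dvdn_gcdr _ _) dL.
by apply/andP; split; [rewrite -(dvdn_addr _ (dvdn_gcdl _ _)) subnK|apply: dvdn_sub => //; exact: dvdn_gcdl].
Qed.

End Frequencies.

Definition lcmq (q q' : nat) : nat := (gcdn q q' * (q %/ gcdn q q') * (q' %/ gcdn q q'))%N.

(** * The error for one pair of moduli *)

Section Pair.
Variables (a a' l N : nat) (w w' : nat -> nat -> R) (m m' : R).
Hypotheses (a0 : (0 < a)%N) (a'0 : (0 < a')%N).
Let q := (4 * a)%N.
Let q' := (4 * a')%N.
Let h := gcdn q q'.
Let Lc := lcmq q q'.
Hypotheses (hw : forall n, (1 <= n <= N)%N -> bv (w n) (2 * a) <= m)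
  (hdw : \sum_(1 <= n < N) bv (fun b => w n.+1 b - w n b) (2 * a) <= m)
  (hw' : forall n, (1 <= n <= N)%N -> bv (w' n) (2 * a') <= m')
  (hdw' : \sum_(1 <= n < N) bv (fun b => w' n.+1 b - w' n b) (2 * a') <= m').

Let q0 : (0 < q)%N. Proof. by rewrite muln_gt0. Qed.
Let q'0 : (0 < q')%N. Proof. by rewrite muln_gt0. Qed.
Let h0 : (0 < h)%N. Proof. by rewrite gcdn_gt0 q0. Qed.
Let qE : q = (h * (q %/ h))%N. Proof. by rewrite mulnC divnK // dvdn_gcdl. Qed.
Let q'E : q' = (h * (q' %/ h))%N. Proof. by rewrite mulnC divnK // dvdn_gcdr. Qed.
Let d0 : (0 < q %/ h)%N. Proof. by rewrite divn_gt0 // dvdn_leq // dvdn_gcdl. Qed.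
Let d'0 : (0 < q' %/ h)%N. Proof. by rewrite divn_gt0 // dvdn_leq // dvdn_gcdr. Qed.
Let Lc0 : (0 < Lc)%N. Proof. by rewrite !muln_gt0 h0 d0. Qed.

(** The contribution of one pair of characters, arranged so that in [n] it is a geometric
    progression with slowly varying coefficients. *)
Definition pterm (p : 'I_q * 'I_q') : R[i] :=
  ee ((p.2 * l)%:R / q'%:R) * \sum_(1 <= n < N.+1) ee ((freq p)%:R / Lc%:R) ^+ n *
    (gsum a p.1 (w n) * gsum a' p.2 (w' n)).

Lemma pterm_expand p : pterm p = \sum_(1 <= n < N.+1) \sum_(0 <= b < 2 * a) \sum_(0 <= b' < 2 * a')
  (w n b * w' n b')%:C%C * (ee ((p.1 * (n + b ^ 2))%:R / q%:R) *
     ee ((p.2 * (n + l + b' ^ 2))%:R / q'%:R)).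
Proof.
have hR : h%:R != 0 :> R by rewrite pnatr_eq0 -lt0n.
have qR : q%:R != 0 :> R by rewrite pnatr_eq0 -lt0n.
have q'R : q'%:R != 0 :> R by rewrite pnatr_eq0 -lt0n.
have LR : Lc%:R != 0 :> R by rewrite pnatr_eq0 -lt0n.
rewrite /pterm mulr_sumr; apply: eq_bigr => n _.
rewrite /gsum big_distrlr /= !mulr_sumr; apply: eq_bigr => b _.
rewrite !mulr_sumr; apply: eq_bigr => b' _.
have -> : ee ((freq p)%:R / Lc%:R) ^+ n =
    ee ((p.1 * n)%:R / q%:R) * ee ((p.2 * n)%:R / q'%:R) :> R[i].
  rewrite -eeMn -eeD; congr ee; rewrite /freq -/h.
  have dR : (q %/ h)%:R != 0 :> R by rewrite pnatr_eq0 -lt0n.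
  have d'R : (q' %/ h)%:R != 0 :> R by rewrite pnatr_eq0 -lt0n.
  have qRE : q%:R = h%:R * (q %/ h)%:R :> R by rewrite -natrM -qE.
  have q'RE : q'%:R = h%:R * (q' %/ h)%:R :> R by rewrite -natrM -q'E.
  rewrite qRE q'RE /Lc /lcmq -/h !natrD !natrM.
  by field; rewrite hR dR d'R.
have -> : ee ((p.1 * (n + b ^ 2))%:R / q%:R) =
    ee ((p.1 * n)%:R / q%:R) * ee ((p.1 * b ^ 2)%:R / q%:R) :> R[i].
  by rewrite -eeD mulnDr natrD mulrDl.
have -> : ee ((p.2 * (n + l + b' ^ 2))%:R / q'%:R) = ee ((p.2 * l)%:R / q'%:R) *
    ee ((p.2 * n)%:R / q'%:R) * ee ((p.2 * b' ^ 2)%:R / q'%:R) :> R[i].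
  by rewrite -!eeD !mulnDr !natrD !mulrDl [X in ee (X + _)]addrC.
rewrite rmorphM /=; ring.
Qed.

Let wsum (F : nat -> nat -> R) : R :=
  \sum_(1 <= n < N.+1) \sum_(0 <= b < 2 * a) \sum_(0 <= b' < 2 * a')
    F (n + b ^ 2)%N (n + l + b' ^ 2)%N * (w n b * w' n b').

Lemma sum_pterm (P : pred ('I_q * 'I_q')) (F : nat -> nat -> R) :
  (forall x y, \sum_(p | P p) ee ((p.1 * x)%:R / q%:R) * ee ((p.2 * y)%:R / q'%:R) =
     (F x y)%:C%C) ->
  \sum_(p | P p) pterm p = (wsum F)%:C%C.
Proof.
move=> HF; rewrite (eq_bigr _ (fun p _ => pterm_expand p)) exchange_big /= rmorph_sum.
apply: eq_bigr => n _; rewrite exchange_big /= rmorph_sum; apply: eq_bigr => b _.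
rewrite exchange_big /= rmorph_sum; apply: eq_bigr => b' _.
by rewrite -mulr_sumr HF -rmorphM mulrC.
Qed.

Lemma sum_freq_all (x y : nat) :
  \sum_(p : 'I_q * 'I_q') ee ((p.1 * x)%:R / q%:R) * ee ((p.2 * y)%:R / q'%:R) =
  ((q * q')%:R * ((q %| x)%N && (q' %| y)%N)%:R)%:C%C :> R[i].
Proof.
rewrite -(pair_big xpredT xpredT (fun i j => ee ((nat_of_ord i * x)%:R / q%:R)
   * ee ((nat_of_ord j * y)%:R / q'%:R))) /= -big_distrlr /=.
have E (Q z : nat) : (0 < Q)%N ->
    \sum_(i < Q) ee ((i * z)%:R / Q%:R) = (Q * (Q %| z))%:R :> R[i].
  move=> Q0; rewrite -ee_orthogonality // big_mkord; apply: eq_bigr => i _.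
  by rewrite mulnC natrM mulrAC eeMn.
rewrite !E //; rewrite -natrM -[in RHS]natrM rmorph_nat; congr _%:R.
by case: (q %| x)%N (q' %| y)%N => -[]; rewrite ?muln1 ?muln0 ?mul0n.
Qed.

(** Compares the two divisibilities with the one congruence modulo [h] that they imply between [b]
    and [b'], taken with density [h/(q q')]; the subtracted term is what the integral frequencies
    contribute. *)
Definition pair_diff : R := \sum_(1 <= n < N.+1) \sum_(0 <= b < 2 * a) \sum_(0 <= b' < 2 * a')
    (((q %| n + b ^ 2) && (q' %| n + l + b' ^ 2))%N%:R
      - h%:R / (q * q')%:R * (b ^ 2 == l + b' ^ 2 %[mod h])%:R) * (w n b * w' n b').

(** All pairs of characters together detect both divisibilities, and by [sum_freq0] those of
    integral frequency detect the congruence modulo [h]. *)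
Lemma pair_diffE : ((q * q')%:R * pair_diff)%:C%C =
  \sum_(p : 'I_q * 'I_q' | ~~ (Lc %| freq p)%N) pterm p.
Proof.
have qq : (q * q')%:R != 0 :> R by rewrite pnatr_eq0 -lt0n muln_gt0 q0.
have S1 := sum_pterm (P := xpredT) sum_freq_all.
have S2 := sum_pterm (P := fun p => (Lc %| freq p)%N)
  (F := fun x y => (h * (x == y %[mod h]))%:R) _.
have {}S2 := S2 (fun x y => etrans (sum_freq0 q0 q'0 x y) (esym (rmorph_nat _ _))).
apply: (addrI (\sum_(p : 'I_q * 'I_q' | (Lc %| freq p)%N) pterm p)).
transitivity (\sum_p pterm p); last by rewrite (bigID (fun p : 'I_q * 'I_q' => (Lc %| freq p)%N)).
rewrite S1 S2 -rmorphD; congr _%:C%C.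
rewrite /wsum /pair_diff mulr_sumr -big_split; apply: eq_bigr => n _ /=.
rewrite mulr_sumr -big_split; apply: eq_bigr => b _ /=.
rewrite mulr_sumr -big_split; apply: eq_bigr => b' _ /=.
rewrite -addnA eqn_modDl natrM.
set x := (_ && _)%:R; set y := (_ == _)%:R; set u := _ * w' _ _.
by move: (q * q')%:R x y u h%:R qq => Q x y u H qq; field.
Qed.

(** Summation by parts in [n]. The product of the two quadratic sums has last value at most
    [m e m' e'] and, by the product rule, variation at most twice that; with the 2 of the geometric
    sum this makes 6. *)
Lemma pterm_bound p : ~~ (Lc %| freq p)%N ->
  cabs (pterm p) <= 6 * m * m' * ebound a p.1 * ebound a' p.2 * idist R Lc (freq p).
Proof.
move=> Lf; rewrite /pterm cabsM cabs_ee mul1r.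
have e0 : 0 <= ebound a p.1 by exact: sqrtr_ge0.
have e'0 : 0 <= ebound a' p.2 by exact: sqrtr_ge0.
have i0 := idist_ge0 R Lc (freq p).
have m0 : 0 <= m by apply: le_trans hdw; apply: sumr_ge0 => n _; exact: bv_ge0.
have m'0 : 0 <= m' by apply: le_trans hdw'; apply: sumr_ge0 => n _; exact: bv_ge0.
have [N0|N0] := posnP N; first by rewrite big_geq ?N0 // cabs0 !mulr_ge0.
apply: le_trans (@abel_bound _ (fun n => ee ((freq p)%:R / Lc%:R) ^+ n)
  (fun n => gsum a p.1 (w n) * gsum a' p.2 (w' n)) _ _ (2 * idist R Lc (freq p)) N0 _) _.
  by move=> k _; apply: geom_ee_bound.
set e := ebound a p.1 in e0 *; set e' := ebound a' p.2 in e'0 *.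
have G n : (1 <= n <= N)%N -> cabs (gsum a p.1 (w n)) <= m * e.
  by move=> /hw h1; apply: le_trans (gsum_bound _ _ a0) _; rewrite ler_wpM2r.
have G' n : (1 <= n <= N)%N -> cabs (gsum a' p.2 (w' n)) <= m' * e'.
  by move=> /hw' h1; apply: le_trans (gsum_bound _ _ a'0) _; rewrite ler_wpM2r.
have S : \sum_(1 <= n < N) cabs (gsum a p.1 (w n.+1) * gsum a' p.2 (w' n.+1) -
    gsum a p.1 (w n) * gsum a' p.2 (w' n)) <= 2 * (m * e * (m' * e')).
  apply: le_trans (_ : \sum_(1 <= n < N) ((m * e) * e' * bv (fun b => w' n.+1 b - w' n b) (2 * a')
     + (m' * e') * e * bv (fun b => w n.+1 b - w n b) (2 * a)) <= _).
    rewrite !big_nat; apply: ler_sum => n /andP[n1 nN].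
    have -> : gsum a p.1 (w n.+1) * gsum a' p.2 (w' n.+1) - gsum a p.1 (w n) * gsum a' p.2 (w' n) =
      gsum a p.1 (w n.+1) * gsum a' p.2 (fun b => w' n.+1 b - w' n b) +
      gsum a p.1 (fun b => w n.+1 b - w n b) * gsum a' p.2 (w' n) by rewrite !gsumB; ring.
    apply: le_trans (cabsD _ _) _; rewrite !cabsM; apply: lerD.
      rewrite -[leRHS]mulrA [e' * _]mulrC; apply: ler_pM; rewrite ?cabs_ge0 ?gsum_bound ?G //.
    set B := bv _ _; have -> : m' * e' * e * B = (B * e) * (m' * e') by ring.
    by apply: ler_pM; rewrite ?cabs_ge0 ?gsum_bound ?G' // n1 ltnW.
  rewrite big_split /= -!mulr_sumr.
  have := ler_wpM2l (mulr_ge0 (mulr_ge0 m0 e0) e'0) hdw'.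
  have := ler_wpM2l (mulr_ge0 (mulr_ge0 m'0 e'0) e0) hdw.
  by lra.
have cN : cabs (gsum a p.1 (w N) * gsum a' p.2 (w' N)) <= m * e * (m' * e').
  by rewrite cabsM; apply: ler_pM; rewrite ?cabs_ge0 ?G ?G' // N0 leqnn.
apply: le_trans (_ : 2 * idist R Lc (freq p) * (3 * (m * e * (m' * e'))) <= _); last by lra.
by rewrite ler_wpM2l ?mulr_ge0 //; move: cN S; lra.
Qed.

(** Expresses the bound through [freq p] alone, so that [sum_freq] can be applied. Since [freq p] is
    [p.1] times a unit modulo [q/h], their gcds with [q/h] agree, and passing from [q/h] to [q]
    costs a factor [h]. Both gcds are then replaced by their sum, which dissolves the square root of
    the product. *)
Lemma ebound_prod (p : 'I_q * 'I_q') : ebound a p.1 * ebound a' p.2 <=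
  22 * Num.sqrt (a * a')%:R * harm R Lc * h%:R *
    (gcdn (freq p) (q %/ h) + gcdn (freq p) (q' %/ h))%:R.
Proof.
have cop : coprime (q %/ h) (q' %/ h).
  by rewrite /coprime -(eqn_pmul2l h0) muln_gcdr -qE -q'E muln1.
have g1 : (gcdn p.1 (2 * a) <= h * gcdn (freq p) (q %/ h))%N.
  have -> : gcdn (freq p) (q %/ h) = gcdn p.1 (q %/ h).
    by rewrite /freq gcdnC addnC gcdnMDl Gauss_gcdl // gcdnC.
  apply: dvdn_leq; first by rewrite muln_gt0 h0 gcdn_gt0 d0 orbT.
  rewrite muln_gcdr -qE dvdn_gcd; apply/andP; split; first by apply: dvdn_mull; exact: dvdn_gcdl.
  by apply: dvdn_trans (dvdn_gcdr _ _) _; apply/dvdnP; exists 2%N; rewrite /q; lia.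
have g2 : (gcdn p.2 (2 * a') <= h * gcdn (freq p) (q' %/ h))%N.
  have -> : gcdn (freq p) (q' %/ h) = gcdn p.2 (q' %/ h).
    by rewrite /freq gcdnC gcdnMDl Gauss_gcdl 1?coprime_sym // gcdnC.
  apply: dvdn_leq; first by rewrite muln_gt0 h0 gcdn_gt0 d'0 orbT.
  rewrite muln_gcdr -q'E dvdn_gcd; apply/andP; split; first by apply: dvdn_mull; exact: dvdn_gcdl.
  by apply: dvdn_trans (dvdn_gcdr _ _) _; apply/dvdnP; exists 2%N; rewrite /q'; lia.
have qL : (q <= Lc)%N by rewrite {1}qE /Lc /lcmq -/h leq_pmulr.
have q'L : (q' <= Lc)%N by rewrite {1}q'E /Lc /lcmq -/h mulnAC leq_pmulr.
have H1 : harm R (2 * a) <= harm R Lc.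
  by apply: harm_le; apply: leq_trans qL; rewrite /q; lia.
have H2 : harm R (2 * a') <= harm R Lc.
  by apply: harm_le; apply: leq_trans q'L; rewrite /q'; lia.
have h1 := harm_ge0 R (2 * a); have h2 := harm_ge0 R (2 * a').
rewrite /ebound -sqrtrM; last by rewrite !mulr_ge0.
set g := gcdn (freq p) _ in g1 *; set g' := gcdn (freq p) _ in g2 *.
set c := 22 * harm R Lc * h%:R * (g + g')%:R.
have c0 : 0 <= c by rewrite !mulr_ge0 // harm_ge0.
have -> : 22 * Num.sqrt (a * a')%:R * harm R Lc * h%:R * (g + g')%:R =
   Num.sqrt ((a * a')%:R * c ^+ 2).
  by rewrite sqrtrM // sqrtr_sqr ger0_norm // /c; ring.
apply: ler_wsqrtr.
have G1 : (gcdn p.1 (2 * a))%:R <= h%:R * (g + g')%:R :> R.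
  by rewrite -natrM ler_nat (leq_trans g1) // leq_mul2l leq_addr orbT.
have G2 : (gcdn p.2 (2 * a'))%:R <= h%:R * (g + g')%:R :> R.
  by rewrite -natrM ler_nat (leq_trans g2) // leq_mul2l leq_addl orbT.
set x := (gcdn _ _)%:R in G1 *; set y := (gcdn _ _)%:R in G2 *.
have -> : 22 * a%:R * x * harm R (2 * a) * (22 * a'%:R * y * harm R (2 * a')) =
  (a * a')%:R * (22 ^+ 2 * ((x * y) * (harm R (2 * a) * harm R (2 * a')))).
  by rewrite natrM; ring.
rewrite ler_wpM2l // (_ : c ^+ 2 = 22 ^+ 2 * ((h%:R * (g + g')%:R * (h%:R * (g + g')%:R)) *
   (harm R Lc * harm R Lc))); last by rewrite /c; ring.
rewrite ler_wpM2l ?exprn_ge0 //; apply: ler_pM; rewrite ?mulr_ge0 //; apply: ler_pM => //.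
Qed.

(** The constant is [6 * 22 * 2], from [pterm_bound], [ebound_prod] and [sum_gcd_idist]. As
    [q q' = h Lc], the division by [q q'] cancels the [h] of [sum_freq] and the [Lc] of
    [sum_gcd_idist]. *)
Theorem pair_error : `|pair_diff| <= 264 * m * m' * Num.sqrt (a * a')%:R * h%:R *
   (tau (q %/ h) + tau (q' %/ h))%:R * harm R Lc ^+ 2.
Proof.
have m0 : 0 <= m by apply: le_trans hdw; apply: sumr_ge0 => n _; exact: bv_ge0.
have m'0 : 0 <= m' by apply: le_trans hdw'; apply: sumr_ge0 => n _; exact: bv_ge0.
have H0 := harm_ge0 R Lc.
have qq0 : 0 < (q * q')%:R :> R by rewrite ltr0n muln_gt0 q0.
rewrite -(ler_pM2l qq0) -[X in X * `|_|](ger0_norm (ltW qq0)) -normrM -cabs_real pair_diffE.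
apply: le_trans (cabs_sum _ _ _) _.
set K := 132 * m * m' * Num.sqrt (a * a')%:R * harm R Lc * h%:R.
have K0 : 0 <= K by rewrite !mulr_ge0 // sqrtr_ge0.
(* Multiples of [Lc] are set to 0 because the integral frequencies are not part of the sum. *)
pose Phi r := if (Lc %| r)%N then 0 else
  K * (idist R Lc r * (gcdn r (q %/ h))%:R + idist R Lc r * (gcdn r (q' %/ h))%:R).
have Phi0 r : 0 <= Phi r.
  by rewrite /Phi; case: ifP => // _; rewrite mulr_ge0 // addr_ge0 // mulr_ge0 // idist_ge0.
apply: le_trans (_ : \sum_(p : 'I_q * 'I_q') Phi (freq p %% Lc)%N <= _).
  rewrite big_mkcond; apply: ler_sum => p _; case: ifPn => [Lf|_]; last exact: Phi0.
  apply: le_trans (pterm_bound Lf) _; rewrite /Phi /dvdn modn_mod -/(dvdn _ _) (negPf Lf).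
  rewrite /idist modn_mod -/(idist R Lc (freq p)).
  have dL : (q %/ h %| Lc)%N by apply: dvdn_mulr; exact: dvdn_mull.
  have d'L : (q' %/ h %| Lc)%N by exact: dvdn_mull.
  rewrite -[gcdn (freq p %% _) (q %/ h)]gcdn_modl (modn_dvdm _ dL) gcdn_modl.
  rewrite -[gcdn (freq p %% _) (q' %/ h)]gcdn_modl (modn_dvdm _ d'L) gcdn_modl.
  have E := ebound_prod p; rewrite natrD in E.
  have i0 := idist_ge0 R Lc (freq p).
  have := ler_wpM2l (mulr_ge0 (mulr_ge0 (mulr_ge0 (ler0n R 6) m0) m'0) i0) E.
  by rewrite /K; lra.
apply: le_trans (sum_freq q0 q'0 Phi0) _.
rewrite -/h -[(h * _ * _)%N]/Lc (big_ltn Lc0) {1}/Phi dvdn0 add0r.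
have -> : \sum_(1 <= r < Lc) Phi r = K * (\sum_(1 <= r < Lc) idist R Lc r * (gcdn r (q %/ h))%:R +
   \sum_(1 <= r < Lc) idist R Lc r * (gcdn r (q' %/ h))%:R).
  rewrite -big_split /= mulr_sumr !big_nat; apply: eq_bigr => r /andP[r1 rL].
  by rewrite /Phi gtnNdvd.
have dL : (q %/ h %| Lc)%N by apply: dvdn_mulr; exact: dvdn_mull.
have d'L : (q' %/ h %| Lc)%N by exact: dvdn_mull.
have S1 : \sum_(1 <= r < Lc) idist R Lc r * (gcdn r (q %/ h))%:R <=
  2 * Lc%:R * (tau (q %/ h))%:R * harm R Lc := sum_gcd_idist q0 q'0 dL.
have S2 : \sum_(1 <= r < Lc) idist R Lc r * (gcdn r (q' %/ h))%:R <=
  2 * Lc%:R * (tau (q' %/ h))%:R * harm R Lc := sum_gcd_idist q0 q'0 d'L.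
have hK : 0 <= h%:R * K by rewrite mulr_ge0.
have := ler_wpM2l hK (lerD S1 S2).
have -> : (q * q')%:R = h%:R * Lc%:R :> R.
  have e : (q * q' = (h * (q %/ h)) * (h * (q' %/ h)))%N by rewrite -qE -q'E.
  by rewrite -natrM e /Lc /lcmq -/h -!mulnA [(q %/ h * (h * _))%N]mulnCA.
by rewrite natrD /K; lra.
Qed.

End Pair.
End PairError.

(** * Averages over residue classes *)

(** Residues modulo [2 g] suffice, since [(b + 2 g)^2 = b^2] modulo [4 g]. *)
Definition sqcount (l g : nat) : nat :=
  (\sum_(0 <= b < 2 * g) \sum_(0 <= b' < 2 * g) (b ^ 2 == l + b' ^ 2 %[mod 4 * g]))%N.

Section Residues.
Variable R : realType.

Lemma dist_le_variation (f : nat -> R) (u v : nat) : (u <= v)%N ->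
  `|f v - f u| <= \sum_(u <= b < v) `|f b.+1 - f b|.
Proof. by move=> uv; rewrite -telescope_sumr //; exact: ler_norm_sum. Qed.

Lemma sum_blocks (V : nmodType) (k m : nat) (F : nat -> V) :
  \sum_(0 <= b < k * m) F b = \sum_(0 <= r < m) \sum_(0 <= i < k) F (i * m + r)%N.
Proof.
rewrite big_nat_mul exchange_big_nat /=; apply: eq_bigr => i _.
by rewrite -{1}[(i * m)%N]add0n big_addn mulSn addnK; apply: eq_bigr => r _; rewrite addnC.
Qed.

Definition block_sum (g a : nat) (f : nat -> R) (r : nat) : R :=
  \sum_(0 <= i < a %/ g) f (i * (2 * g) + r)%N.

(** The [i]-th terms of the two sums lie in the same block of length [2 g]. The blocks are disjoint,
    so the differences add up to at most the total variation. *)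
Lemma block_sum_variation (g a : nat) (f : nat -> R) (r s : nat) :
  (g %| a)%N -> (0 < a)%N -> (r < 2 * g)%N -> (s < 2 * g)%N ->
  `|block_sum g a f r - block_sum g a f s| <= bv f (2 * a).
Proof.
move=> ga a0 r2g s2g.
wlog rs : r s r2g s2g / (s <= r)%N.
  by move=> H; have [/(H _ _ s2g r2g)|/ltnW/(H _ _ r2g s2g)//] := leqP r s; rewrite distrC.
rewrite /block_sum -sumrB; apply: le_trans (ler_norm_sum _ _ _) _.
pose D b := if (b < (2 * a).-1)%N then `|f b.+1 - f b| else 0.
have D0 b : 0 <= D b by rewrite /D; case: ifP.
have aE : (a %/ g * (2 * g) = 2 * a)%N by rewrite mulnCA divnK.
apply: le_trans (_ : \sum_(0 <= b < a %/ g * (2 * g)) D b <= _); last first.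
  rewrite aE -[X in \sum_(0 <= b < X) _](@prednK (2 * a)) ?muln_gt0 // big_nat_recr //=.
  rewrite {2}/D ltnn addr0 /bv.
  apply: le_trans (_ : \sum_(0 <= b < (2 * a).-1) `|f b.+1 - f b| <= _); last by rewrite lerDr.
  by rewrite !big_nat; apply: ler_sum => b /andP[_ ba]; rewrite /D ba.
rewrite big_nat_mul !big_nat; apply: ler_sum => i /andP[_ ia].
apply: le_trans (dist_le_variation _ (_ : (i * (2 * g) + s <= i * (2 * g) + r)%N)) _.
  by rewrite leq_add2l.
have b1 : (i * (2 * g) + r < i.+1 * (2 * g))%N by rewrite mulSn addnC ltn_add2r.
have b2 : (i.+1 * (2 * g) <= 2 * a)%N by rewrite -aE leq_mul2r ia orbT.
rewrite [leRHS](@big_cat_nat _ _ _ (i * (2 * g) + s)) ?leq_addr //=; last by lia.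
apply: ler_wpDl; first exact: sumr_ge0.
rewrite [leRHS](@big_cat_nat _ _ _ (i * (2 * g) + r)) ?leq_add2l //=; last by lia.
apply: ler_wpDr; first exact: sumr_ge0.
rewrite !big_nat; apply: ler_sum => b /andP[_ br].
by rewrite /D ifT // -ltnS prednK ?muln_gt0 //; lia.
Qed.

Lemma block_sum_mean (g a : nat) (f : nat -> R) (r : nat) :
  (g %| a)%N -> (0 < a)%N -> (r < 2 * g)%N ->
  `|block_sum g a f r - (\sum_(0 <= b < 2 * a) f b) / (2 * g)%:R| <= bv f (2 * a).
Proof.
move=> ga a0 r2g; have g0 : (0 < g)%N by exact: dvdn_gt0 ga.
have G0 : 0 < (2 * g)%:R :> R by rewrite ltr0n muln_gt0.
have -> : (2 * a = a %/ g * (2 * g))%N by rewrite mulnCA divnK.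
rewrite sum_blocks.
have -> : block_sum g a f r - (\sum_(0 <= s < 2 * g) block_sum g a f s) / (2 * g)%:R =
   (\sum_(0 <= s < 2 * g) (block_sum g a f r - block_sum g a f s)) / (2 * g)%:R.
  rewrite sumrB sumr_const_nat subn0 -mulr_natr.
  by field; rewrite pnatr_eq0 -lt0n.
rewrite normrM [`|_^-1|]gtr0_norm ?invr_gt0 // ler_pdivrMr //.
apply: le_trans (ler_norm_sum _ _ _) _.
apply: le_trans (_ : \sum_(0 <= s < 2 * g) bv f (2 * a) <= _).
  rewrite !big_nat; apply: ler_sum => s /andP[_ sg]; exact: block_sum_variation.
by rewrite sumr_const_nat subn0 mulr_natr mulnCA divnK.
Qed.

(** Each block sum [x] is replaced by its mean [X]; the three errors are those of [x x' - X X' = (x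
    - X) X' + (x - X)(x' - X') + X (x' - X')]. *)
Lemma residue_average (a a' l g : nat) (f f' : nat -> R) :
  (g %| a)%N -> (g %| a')%N -> (0 < a)%N -> (0 < a')%N ->
  (forall b, 0 <= f b) -> (forall b, 0 <= f' b) ->
  `|\sum_(0 <= b < 2 * a) \sum_(0 <= b' < 2 * a')
      (b ^ 2 == l + b' ^ 2 %[mod 4 * g])%:R * (f b * f' b')
    - (sqcount l g)%:R * ((\sum_(0 <= b < 2 * a) f b) / (2 * g)%:R
      * ((\sum_(0 <= b < 2 * a') f' b) / (2 * g)%:R))|
  <= (sqcount l g)%:R * (bv f (2 * a) * ((\sum_(0 <= b < 2 * a') f' b) / (2 * g)%:R)
     + bv f (2 * a) * bv f' (2 * a')
     + (\sum_(0 <= b < 2 * a) f b) / (2 * g)%:R * bv f' (2 * a')).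
Proof.
move=> ga ga' a0 a'0 f0 f'0; have g0 : (0 < g)%N by exact: dvdn_gt0 ga.
set X := (\sum_(0 <= b < 2 * a) f b) / _; set X' := (\sum_(0 <= b < 2 * a') f' b) / _.
have X0 : 0 <= X by rewrite divr_ge0 // sumr_ge0.
have X'0 : 0 <= X' by rewrite divr_ge0 // sumr_ge0.
have sqm i b : ((i * (2 * g) + b) ^ 2 = b ^ 2 %[mod 4 * g])%N.
  have -> : ((i * (2 * g) + b) ^ 2 = (i * i * g + i * b) * (4 * g) + b ^ 2)%N by lia.
  by rewrite modnMDl.
pose ind r r' : R := (r ^ 2 == l + r' ^ 2 %[mod 4 * g])%:R.
have -> : \sum_(0 <= b < 2 * a) \sum_(0 <= b' < 2 * a')
      (b ^ 2 == l + b' ^ 2 %[mod 4 * g])%:R * (f b * f' b') =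
   \sum_(0 <= r < 2 * g) \sum_(0 <= r' < 2 * g) ind r r' * (block_sum g a f r * block_sum g a' f' r').
  have aE : (2 * a = a %/ g * (2 * g))%N by rewrite mulnCA divnK.
  have a'E : (2 * a' = a' %/ g * (2 * g))%N by rewrite mulnCA divnK.
  rewrite {1}aE sum_blocks; apply: eq_bigr => r _.
  rewrite exchange_big /= {1}a'E sum_blocks; apply: eq_bigr => r' _.
  rewrite /block_sum big_distrlr /= mulr_sumr exchange_big /=; apply: eq_bigr => i _.
  rewrite mulr_sumr; apply: eq_bigr => i' _.
  by rewrite sqm /ind -(modnDmr l) sqm modnDmr.
have -> : (sqcount l g)%:R = \sum_(0 <= r < 2 * g) \sum_(0 <= r' < 2 * g) ind r r'.
  by rewrite /sqcount natr_sum; apply: eq_bigr => r _; rewrite natr_sum.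
rewrite !mulr_suml -sumrB; apply: le_trans (ler_norm_sum _ _ _) _.
rewrite !big_nat; apply: ler_sum => r /andP[_ rg].
rewrite !mulr_suml -sumrB; apply: le_trans (ler_norm_sum _ _ _) _.
rewrite !big_nat; apply: ler_sum => r' /andP[_ r'g].
rewrite -mulrBr normrM [`|ind _ _|]ger0_norm ?ler0n // ler_wpM2l ?ler0n //.
have := block_sum_mean f ga a0 rg; have := block_sum_mean f' ga' a'0 r'g.
rewrite -/X -/X'; set x := block_sum g a f r; set x' := block_sum g a' f' r'.
move=> h' h.
have -> : x * x' - X * X' = (x - X) * X' + (x - X) * (x' - X') + X * (x' - X') by ring.
apply: le_trans (ler_normD _ _) _; apply: lerD; last first.
  by rewrite normrM [`|X|]ger0_norm // ler_wpM2l.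
apply: le_trans (ler_normD _ _) _; rewrite (normrM _ X') (normrM _ (x' - X')) (ger0_norm X'0); apply: lerD.
  by rewrite ler_wpM2r.
by apply: ler_pM.
Qed.

End Residues.

(** * The weights *)

Section Weights.
Variable R : realType.

Definition phi (a u : nat) : R := u%:R / (4 * a ^ 2 + u)%:R.

(* For Selling parameters [A = 2a - b], [B], [C = b] of [n] one has
   [n - b (2a - b) = 2a B], so this is [B / (A + B + C)]; when [n <= b (2a - b)] the
   truncated subtraction makes it [0]. *)
Definition wt (a n b : nat) : R := phi a (n - b * (2 * a - b)).

Section Fixed.
Variable a : nat.
Hypothesis a0 : (0 < a)%N.

Let A : R := (4 * a ^ 2)%:R.
Let A_gt0 : 0 < A. Proof. by rewrite ltr0n muln_gt0 expn_gt0 a0. Qed.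

Lemma phiE u : phi a u = 1 - A / (A + u%:R).
Proof.
have h : A + u%:R != 0 by rewrite gt_eqF // ltr_wpDr.
by rewrite /phi natrD -/A -[X in _ = X - _](divff h) -mulrBl [A + _]addrC addrK.
Qed.

Lemma phi_ge0 u : 0 <= phi a u.
Proof. by rewrite divr_ge0. Qed.

Lemma phi_le1 u : phi a u <= 1.
Proof. by rewrite phiE gerBl divr_ge0 ?addr_ge0 // ltW. Qed.

Lemma phi_le u : phi a u <= u%:R / A.
Proof.
rewrite /phi ler_wpM2l // natrD -/A lef_pV2 ?posrE // ?lerDl //.
by rewrite ltr_wpDr.
Qed.

Lemma phi0 : phi a 0 = 0.
Proof. by rewrite /phi mul0r. Qed.

Lemma phi_homo : {homo phi a : u v / (u <= v)%N >-> u <= v}.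
Proof.
move=> u v uv; rewrite !phiE lerD2l lerN2 ler_wpM2l ?(ltW A_gt0) //.
by rewrite lef_pV2 ?posrE ?ltr_wpDr // lerD2l ler_nat.
Qed.

Definition dphi (u : nat) : R := phi a u.+1 - phi a u.

Lemma dphi_ge0 u : 0 <= dphi u.
Proof. by rewrite subr_ge0 phi_homo. Qed.

Lemma dphiE u : dphi u = A / ((A + u%:R) * (A + u.+1%:R)).
Proof.
have h v : A + v%:R != 0 by rewrite gt_eqF // ltr_wpDr.
rewrite /dphi !phiE; have := h u; have := h u.+1; rewrite -natr1.
move: (A) (u%:R : R) => B x h2 h1.
by field; rewrite h1 h2.
Qed.

Lemma dphi_anti : {homo dphi : u v / (u <= v)%N >-> v <= u}.
Proof.
move=> u v uv; rewrite !dphiE ler_wpM2l ?(ltW A_gt0) //.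
have p w : 0 < A + w%:R by rewrite ltr_wpDr.
rewrite lef_pV2 ?posrE ?mulr_gt0 //.
by apply: ler_pM; rewrite ?(ltW (p _)) // lerD2l ler_nat.
Qed.

Lemma dphi0_le : dphi 0 <= A^-1.
Proof. by rewrite /dphi phi0 subr0; apply: le_trans (phi_le 1) _; rewrite mul1r. Qed.

Let v b := (b * (2 * a - b))%N.

(** [v b = b (2a - b)] climbs from 0 to [a^2] at [b = a] and comes down again, and [G] measures the
    variation of [F]; each half costs at most the rise of [G]. *)
Lemma unimodal_variation (F G : nat -> R) :
  (forall s t, (s <= t)%N -> `|F t - F s| <= G t - G s) ->
  \sum_(0 <= b < (2 * a).-1) `|F (v b.+1) - F (v b)| <= 2 * (G (a ^ 2)%N - G 0%N).
Proof.
move=> FG.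
have Ghomo s t : (s <= t)%N -> G s <= G t.
  by move=> st; rewrite -subr_ge0; apply: le_trans (FG _ _ st).
rewrite (@big_cat_nat _ _ _ a) //=; last by lia.
have va : v a = (a ^ 2)%N by rewrite /v; lia.
have S1 : \sum_(0 <= b < a) `|F (v b.+1) - F (v b)| <= G (a ^ 2)%N - G 0%N.
  rewrite -va -[X in _ - G X]/(v 0) -(telescope_sumr (G \o v) (leq0n a)).
  rewrite !big_nat; apply: ler_sum => b /andP[_ ba]; apply: (FG (v b) (v b.+1)); rewrite /v; nia.
have S2 : \sum_(a <= b < (2 * a).-1) `|F (v b.+1) - F (v b)| <= G (a ^ 2)%N - G 0%N.
  apply: le_trans (_ : \sum_(a <= b < (2 * a).-1) (- G (v b.+1) - - G (v b)) <= _).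
    rewrite !big_nat; apply: ler_sum => b /andP[ab b2]; rewrite distrC opprK [leRHS]addrC.
    by apply: (FG (v b.+1) (v b)); rewrite /v; nia.
  rewrite (telescope_sumr (fun b => - G (v b))); last by lia.
  by rewrite opprK va addrC lerD2l lerN2 Ghomo.
by lra.
Qed.

Lemma bv_wt (n : nat) : bv (wt a n) (2 * a) <= 3 * phi a n.
Proof.
rewrite /bv.
have e : `|wt a n (2 * a).-1| <= phi a n.
  by rewrite ger0_norm ?phi_ge0 // /wt phi_homo // leq_subr.
have := @unimodal_variation (fun t => phi a (n - t)) (fun t => - phi a (n - t)) _.
rewrite subn0 /= => H.
have /H : forall s t, (s <= t)%N -> `|phi a (n - t) - phi a (n - s)| <= - phi a (n - t) - - phi a (n - s).
  move=> s t st; rewrite opprK [leRHS]addrC distrC ger0_norm // subr_ge0 phi_homo //; lia.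
by have := phi_ge0 (n - a ^ 2); rewrite /wt -/v; lra.
Qed.

(** As a function of [t = v b], the increment in [n] is [dphi (n - t)], which grows to [dphi 0] at
    [t = n] and then drops to 0. The drop is what doubles [dphi 0], and it is not reached when
    [a^2 <= n]. *)
Lemma bv_wt_diff (n : nat) : bv (fun b => wt a n.+1 b - wt a n b) (2 * a) <=
  3 * (if (a ^ 2 <= n)%N then dphi (n - a ^ 2) else 2 * dphi 0).
Proof.
pose F t := phi a (n.+1 - t) - phi a (n - t).
pose G t := if (t <= n)%N then dphi (n - t) else 2 * dphi 0.
have Flow t : (t <= n)%N -> F t = dphi (n - t) by move=> tn; rewrite /F subSn.
have Fhigh t : (n < t)%N -> F t = 0.
  by move=> nt; rewrite /F (eqP (ltnW nt : n - t == 0)%N) (eqP (nt : n.+1 - t == 0)%N) subrr.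
have d0 := dphi_ge0 0.
have dle u : dphi u <= dphi 0 by exact: dphi_anti.
have FG s t : (s <= t)%N -> `|F t - F s| <= G t - G s.
  move=> st; rewrite /G; have [tn|nt] := leqP t n.
    rewrite (leq_trans st tn) !Flow ?(leq_trans st tn) // ger0_norm // subr_ge0.
    by apply: dphi_anti; lia.
  rewrite (Fhigh t) // sub0r normrN; have [sn|ns] := leqP s n.
    by rewrite Flow // ger0_norm ?dphi_ge0 //; have := dle (n - s)%N; lra.
  by rewrite Fhigh // normr0 subrr.
have Ga : G (a ^ 2)%N = if (a ^ 2 <= n)%N then dphi (n - a ^ 2) else 2 * dphi 0 by [].
rewrite -Ga.
have Gh s t : (s <= t)%N -> G s <= G t.
  by move=> st; rewrite -subr_ge0; apply: le_trans (FG _ _ st).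
have F0 t : 0 <= F t by rewrite subr_ge0 phi_homo // leq_sub2r.
have FleG t : F t <= G t.
  rewrite /G; case: leqP => h; first by rewrite Flow.
  by rewrite Fhigh // mulr_ge0.
have G00 : 0 <= G 0%N by rewrite /G leq0n dphi_ge0.
have e : `|F (v (2 * a).-1)| <= G (a ^ 2)%N.
  rewrite ger0_norm //; apply: le_trans (FleG _) _; apply: Gh; rewrite /v; nia.
have := unimodal_variation FG; rewrite /bv.
by move: e; rewrite /F; lra.
Qed.

(* An upper bound for the weights [wt a n b] with [n <= M]. *)
Definition mw (M : nat) : R := Num.min 1 (M%:R / (a ^ 2)%:R).

Let a2 : 0 < (a ^ 2)%:R :> R. Proof. by rewrite ltr0n expn_gt0 a0. Qed.

Lemma phi_mw (M : nat) : phi a M <= mw M.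
Proof.
rewrite le_min phi_le1; apply: le_trans (phi_le M) _.
by rewrite ler_wpM2l // lef_pV2 ?posrE // ler_nat; lia.
Qed.

Lemma mw_ge0 M : 0 <= mw M.
Proof. by rewrite le_min ler01 divr_ge0. Qed.

Lemma mw_homo : {homo mw : M N / (M <= N)%N >-> M <= N}.
Proof.
move=> M N MN; rewrite /mw le_min !ge_min lexx /=; apply/orP; right.
by rewrite ler_wpM2r ?invr_ge0 // ler_nat.
Qed.

Lemma bv_wt_mw (M n : nat) : (n <= M)%N -> bv (wt a n) (2 * a) <= 5 * mw M.
Proof.
move=> nM; apply: le_trans (bv_wt n) _.
by have := phi_mw n; have := mw_homo nM; have := mw_ge0 M; lra.
Qed.

(** For [n < a^2] each increment costs [O(dphi 0)], which is [O(1/a^2)]; from [a^2] on the costs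
    telescope to a value of [phi], at most 1. This is where the minimum in [mw] comes from. *)
Lemma sum_bv_wt_diff (M : nat) :
  \sum_(0 <= n < M) bv (fun b => wt a n.+1 b - wt a n b) (2 * a) <= 5 * mw M.
Proof.
have A4 : A = 4 * (a ^ 2)%:R by rewrite /A natrM.
have d0 : (a ^ 2)%:R * dphi 0 <= 4^-1.
  apply: le_trans (ler_wpM2l (ltW a2) dphi0_le) _.
  by rewrite A4 invfM mulrCA mulfV ?mulr1 // gt_eqF.
have dge := dphi_ge0 0.
have key : \sum_(0 <= n < M) (if (a ^ 2 <= n)%N then dphi (n - a ^ 2) else 2 * dphi 0) <= 3 / 2 * mw M.
  have low N : (N <= a ^ 2)%N ->
     \sum_(0 <= n < N) (if (a ^ 2 <= n)%N then dphi (n - a ^ 2) else 2 * dphi 0) = 2 * N%:R * dphi 0.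
    move=> Na; rewrite big_nat (eq_bigr (fun=> 2 * dphi 0)); last first.
      by move=> n /andP[_ nN]; rewrite leqNgt (leq_trans nN Na).
    by rewrite -big_nat sumr_const_nat subn0 -mulr_natr; ring.
  have [Ma|aM] := leqP M (a ^ 2).
    rewrite low // (_ : mw M = M%:R / (a ^ 2)%:R); last first.
      by apply/min_idPr; rewrite ler_pdivrMr // mul1r ler_nat.
    have y0 : 0 <= M%:R / (a ^ 2)%:R :> R by rewrite divr_ge0.
    have yE : M%:R = (M%:R / (a ^ 2)%:R) * (a ^ 2)%:R :> R by rewrite divfK // gt_eqF.
    move: (_ / _) y0 yE => y y0 ->.
    by have := ler_wpM2l y0 d0; lra.
  rewrite (@big_cat_nat _ _ _ (a ^ 2)) //=; last exact: ltnW.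
  rewrite low // (_ : mw M = 1); last first.
    by apply/min_idPl; rewrite ler_pdivlMr // mul1r ler_nat ltnW.
  have -> : \sum_(a ^ 2 <= n < M) (if (a ^ 2 <= n)%N then dphi (n - a ^ 2) else 2 * dphi 0)
     = phi a (M - a ^ 2) - phi a 0.
    rewrite -(telescope_sumr _ (leq0n _)) -{1}[(a ^ 2)%N]add0n big_addn.
    by apply: eq_bigr => n _; rewrite leq_addl addnK.
  rewrite phi0; have := phi_le1 (M - a ^ 2); lra.
apply: le_trans (ler_sum _ (fun n _ => bv_wt_diff n)) _.
by rewrite -mulr_sumr; have := mw_ge0 M; lra.
Qed.

Lemma wt_ge0 n b : 0 <= wt a n b.
Proof. exact: phi_ge0. Qed.

Lemma wt_le_mw (M n b : nat) : (n <= M)%N -> wt a n b <= mw M.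
Proof.
move=> nM; apply: le_trans (mw_homo nM); apply: le_trans (phi_mw n).
by apply: phi_homo; exact: leq_subr.
Qed.

End Fixed.
End Weights.

(** * Sums of the weights *)

Section RealSums.
Variable R : realType.

(** The comparison of the integral of a decreasing [f] with its rectangles, phrased with the
    primitive [F] so that no integral appears. *)
Lemma mvt_bounds (F f : R -> R) (x y : R) : x <= y ->
  (forall z, x <= z <= y -> is_derive z 1 F (f z)) ->
  (forall z, x <= z <= y -> f y <= f z <= f x) ->
  (y - x) * f y <= F y - F x <= (y - x) * f x.
Proof.
move=> xy dF mono.
have dF' z : z \in `]x, y[ -> is_derive z 1 F (f z).
  by rewrite in_itv /= => /andP[xz zy]; apply: dF; rewrite !ltW.
have cF : {within `[x, y], continuous F}%classic.
  apply: derivable_within_continuous => z; rewrite in_itv /= => xzy.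
  by have ? := dF z xzy; exact: ex_derive.
have [z] := MVT_segment xy dF' cF.
rewrite in_itv /= => xzy ->; have /andP[h1 h2] := mono z xzy.
have yx : 0 <= y - x by rewrite subr_ge0.
by rewrite [f z * _]mulrC; apply/andP; split; rewrite ler_wpM2l.
Qed.

(** Its integral over the positive half-line is [pi sqrt c]; this is the origin of [pi] in the main
    term. *)
Definition lnterm (c x : R) : R := ln (1 + c / x ^+ 2).

Lemma lntermE (c x : R) : 0 < c -> 0 < x -> lnterm c x = ln (x ^+ 2 + c) - 2 * ln x.
Proof.
move=> c0 x0; have x2 : 0 < x ^+ 2 by rewrite exprn_gt0.
have -> : 2 * ln x = ln (x ^+ 2) by rewrite lnXn // mulr_natl.
rewrite -ln_div ?posrE ?addr_gt0 // /lnterm; congr ln.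
by rewrite mulrDl divff // gt_eqF.
Qed.

Lemma lnterm_anti (c x y : R) : 0 < c -> 0 < x -> x <= y -> lnterm c y <= lnterm c x.
Proof.
move=> c0 x0 xy; have y0 : 0 < y by exact: lt_le_trans xy.
rewrite /lnterm ler_ln ?posrE ?ltr_wpDr // ?divr_ge0 ?(ltW c0) ?sqr_ge0 //.
rewrite lerD2l ler_wpM2l ?(ltW c0) // lef_pV2 ?posrE ?exprn_gt0 //.
by apply: lerXn2r; rewrite ?nnegrE ?(ltW x0) ?(ltW y0).
Qed.

Lemma lnterm_ge0 (c x : R) : 0 <= c -> 0 <= lnterm c x.
Proof. by move=> c0; apply: ln_ge0; rewrite lerDl divr_ge0 ?sqr_ge0. Qed.

Lemma is_derive_lnprim (c z : R) : 0 < c -> 0 < z ->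
  is_derive z 1 (fun x => x * (ln (x ^+ 2 + c) - 2 * ln x) + 2 * Num.sqrt c * atan (x / Num.sqrt c))
   (lnterm c z).
Proof.
move=> c0 z0; have s0 : 0 < Num.sqrt c by rewrite sqrtr_gt0.
have d1 : is_derive z 1 (fun x : R => x ^+ 2 + c) (2 * z).
  by apply: is_derive_eq; rewrite /GRing.scale /=; ring.
have d2 : is_derive z 1 (fun x : R => ln (x ^+ 2 + c)) ((z ^+ 2 + c)^-1 * (2 * z)).
  have h : 0 < z ^+ 2 + c by rewrite addr_gt0 // exprn_gt0.
  exact: (@is_derive1_comp R (@ln R) (fun x : R => x ^+ 2 + c) z _ _ (is_derive1_ln h) d1).
have d3 : is_derive z 1 (fun x : R => atan (x / Num.sqrt c)) ((1 + (z / Num.sqrt c) ^+ 2)^-1 * (Num.sqrt c)^-1).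
  have d : is_derive z 1 (fun x : R => x / Num.sqrt c) (Num.sqrt c)^-1.
    by apply: is_derive_eq; rewrite /GRing.scale /=; ring.
  exact: (@is_derive1_comp R (@atan R) (fun x : R => x / Num.sqrt c) z _ _ (is_derive1_atan _) d).
have d4 := is_derive1_ln z0.
apply: is_derive_eq; rewrite lntermE // /GRing.scale /=.
have : c = Num.sqrt c ^+ 2 by rewrite sqr_sqrtr // ltW.
move: (ln _) (ln z) (Num.sqrt c) s0 => u v s s0 ->.
have zs : z ^+ 2 + s ^+ 2 != 0 by rewrite gt_eqF // addr_gt0 ?exprn_gt0.
by field; rewrite [s ^+ 2 + _]addrC zs !gt_eqF.
Qed.

Lemma atan_bounds (x : R) : 0 <= x -> 0 <= atan x <= x.
Proof.
move=> x0.
have ca : {within `[0, x], continuous (@atan R)}%classic.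
  by apply: continuous_subspaceT => y; exact: continuous_atan.
have [z] := MVT_segment x0 (fun y _ => is_derive1_atan y) ca.
rewrite in_itv /= atan0 !subr0 => /andP[z0 _] ->.
have h : 1 <= 1 + z ^+ 2 by rewrite lerDl sqr_ge0.
by rewrite mulr_ge0 ?invr_ge0 ?(le_trans ler01 h) //= ler_piMl // invf_le1 // (lt_le_trans ltr01 h).
Qed.

Lemma pihalf_sub_atan (x : R) : 0 < x -> pi / 2 - atan x <= x^-1.
Proof.
move=> x0.
have a0 : 0 < atan x by rewrite -atan0 lt_atan.
have a1 := atan_ltpi2 x.
have xi : 0 <= x^-1 by rewrite invr_ge0 ltW.
suff -> : pi / 2 - atan x = atan x^-1 by have /andP[] := atan_bounds xi.
have p0 : 0 < pi :> R by exact: pi_gt0.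
rewrite -[LHS]tanK; last by rewrite in_itv /=; apply/andP; split; lra.
by congr atan; rewrite /tan -opprB sinN cosN sinBpihalf cosBpihalf opprK -[in RHS](atanK x) /tan invf_div.
Qed.

(** Comparison with the primitive [F], which tends to [pi sqrt c]. The assumption [c <= M - 1] keeps
    the truncation error bounded: [x ln(1 + c/x^2) <= c/x] and the missing part of the arctangent is
    at most [sqrt c/x]. The logarithm comes from the term [t = 1]. *)
Lemma sum_lnterm (c : R) (M : nat) : 0 < c -> (2 <= M)%N -> c <= M.-1%:R ->
  `|\sum_(1 <= t < M) lnterm c t%:R - pi * Num.sqrt c| <= 4 + ln (1 + c).
Proof.
move=> c0 M2 cM.
pose F := fun x => x * (ln (x ^+ 2 + c) - 2 * ln x) + 2 * Num.sqrt c * atan (x / Num.sqrt c).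
have s0 : 0 < Num.sqrt c by rewrite sqrtr_gt0.
have step (t : nat) : (1 <= t)%N -> lnterm c t.+1%:R <= F t.+1%:R - F t%:R <= lnterm c t%:R.
  move=> t1; have t0 : 0 < t%:R :> R by rewrite ltr0n.
  have := @mvt_bounds F (lnterm c) t%:R t.+1%:R _ _ _.
  rewrite -natr1 addrAC subrr add0r !mul1r.
  apply; first by rewrite lerDl.
    by move=> z /andP[tz _]; apply: is_derive_lnprim => //; exact: lt_le_trans tz.
  move=> z /andP[tz zt]; have z0 := lt_le_trans t0 tz.
  by rewrite !lnterm_anti.
have FE x : 0 < x -> F x = x * lnterm c x + 2 * Num.sqrt c * atan (x / Num.sqrt c).
  by move=> x0; rewrite /F lntermE.
have M0 : (1 <= M)%N by exact: ltnW.
have up : \sum_(1 <= t < M) lnterm c t%:R <= lnterm c 1 + (F M.-1%:R - F 1).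
  rewrite (big_ltn M2) lerD2l.
  rewrite -[X in _ - F X]/(1%:R) -(telescope_sumr (fun t => F t%:R)); last by lia.
  rewrite big_add1 !big_nat; apply: ler_sum => t /andP[t1 _].
  by have /andP[] := step t t1.
have lo : F M%:R - F 1 <= \sum_(1 <= t < M) lnterm c t%:R.
  rewrite -[X in _ - F X]/(1%:R) -(telescope_sumr (fun t => F t%:R) M0).
  rewrite !big_nat; apply: ler_sum => t /andP[t1 _].
  by have /andP[] := step t t1.
have l1 : lnterm c 1 = ln (1 + c) by rewrite /lnterm expr1n divr1.
have F1 : 0 <= F 1 <= ln (1 + c) + 2.
  rewrite FE // mul1r l1.
  have : 0 <= atan (1 / Num.sqrt c) <= 1 / Num.sqrt c.
    by apply: atan_bounds; rewrite divr_ge0 // ltW.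
  move=> /andP[h1 h2]; rewrite addr_ge0 ?mulr_ge0 ?(ltW s0) ?ln_ge0 ?lerDl ?(ltW c0) //=.
  rewrite lerD2l; have := ler_wpM2l (ltW s0) h2.
  by rewrite [_ * (1 / _)]mulrC divfK ?gt_eqF //; lra.
have ss : Num.sqrt c * Num.sqrt c = c by rewrite -expr2 sqr_sqrtr // ltW.
have m0 : 0 < M.-1%:R :> R by rewrite ltr0n; lia.
have MR : 0 < M%:R :> R by rewrite ltr0n.
have mM : M.-1%:R <= M%:R :> R by rewrite ler_nat leq_pred.
have FM : pi * Num.sqrt c - 2 <= F M%:R.
  rewrite FE //; have := pihalf_sub_atan (divr_gt0 MR s0).
  rewrite invf_div => h; have l0 := mulr_ge0 (ltW MR) (lnterm_ge0 M%:R (ltW c0)).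
  have := ler_wpM2l (ltW s0) h; rewrite mulrA ss mulrBr.
  have : c / M%:R <= 1 by rewrite ler_pdivrMr // mul1r; lra.
  by lra.
have FM1 : F M.-1%:R <= pi * Num.sqrt c + 1.
  rewrite FE //; have := atan_ltpi2 (M.-1%:R / Num.sqrt c).
  have : M.-1%:R * lnterm c M.-1%:R <= 1.
    apply: le_trans (ler_wpM2l (ltW m0) (le_ln1Dx _)) _.
      by apply: lt_le_trans (divr_ge0 (ltW c0) (sqr_ge0 _)); rewrite oppr_lt0 ltr01.
    by rewrite expr2 invfM mulrCA mulVKf ?gt_eqF // ler_pdivrMr // mul1r.
  by move=> h1 /ltW h2; have := ler_wpM2l (ltW s0) h2; lra.
rewrite ler_norml; apply/andP; split; move: F1 => /andP[]; lra.
Qed.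

(* [qfun c] is the derivative of [qprim c]; it is the total weight in [a] on a line
   [b = a + t] with [c = n + t^2]. *)
Definition qprim (c x : R) : R := ln x / 2 - ln (c + 3 * x ^+ 2) / 3.
Definition qfun (c x : R) : R := (c - x ^+ 2) / (2 * x * (c + 3 * x ^+ 2)).
(** Beyond [sqrt c] the weight is 0 whereas [qfun] turns negative; accordingly [qprimcap] freezes
    the primitive there. *)
Definition qcap (c x : R) : R := if x ^+ 2 <= c then qfun c x else 0.
Definition qprimcap (c x : R) : R := qprim c (Num.min x (Num.sqrt c)).

Lemma is_derive_qprim (c z : R) : 0 < c -> 0 < z -> is_derive z 1 (qprim c) (qfun c z).
Proof.
move=> c0 z0; rewrite /qprim.
have h : 0 < c + 3 * z ^+ 2 by rewrite ltr_wpDr // mulr_ge0 // sqr_ge0.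
have d1 : is_derive z 1 (fun x : R => c + 3 * x ^+ 2) (6 * z).
  by apply: is_derive_eq; rewrite /GRing.scale /=; ring.
have d2 : is_derive z 1 (fun x : R => ln (c + 3 * x ^+ 2)) ((c + 3 * z ^+ 2)^-1 * (6 * z)).
  exact: (@is_derive1_comp R (@ln R) (fun x : R => c + 3 * x ^+ 2) z _ _ (is_derive1_ln h) d1).
have d3 := is_derive1_ln z0.
apply: is_derive_eq; rewrite /GRing.scale /qfun /=.
by field; rewrite !gt_eqF.
Qed.

Lemma qfun_anti (c x y : R) : 0 < x -> x <= y -> y ^+ 2 <= c -> qfun c y <= qfun c x.
Proof.
move=> x0 xy yc; have y0 := lt_le_trans x0 xy.
have xxyy : x ^+ 2 <= y ^+ 2 by apply: lerXn2r; rewrite ?nnegrE ?(ltW x0) ?(ltW y0).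
have xc := le_trans xxyy yc.
have c0 : 0 < c by rewrite (lt_le_trans _ xc) // exprn_gt0.
have p z : 0 < z -> 0 < 2 * z * (c + 3 * z ^+ 2).
  by move=> z0; rewrite !mulr_gt0 // ltr_wpDr // mulr_ge0 // sqr_ge0.
apply: ler_pM; rewrite ?subr_ge0 ?invr_ge0 ?(ltW (p _ _)) // ?lerD2l ?lerN2 //.
rewrite lef_pV2 ?posrE ?p //; apply: ler_pM; [lra| |lra|lra].
by rewrite addr_ge0 ?mulr_ge0 ?sqr_ge0 // ltW.
Qed.

Lemma qfun_ge0 (c x : R) : 0 < x -> x ^+ 2 <= c -> 0 <= qfun c x.
Proof.
move=> x0 xc; have c0 := le_trans (sqr_ge0 x) xc.
by rewrite divr_ge0 ?subr_ge0 // !mulr_ge0 ?addr_ge0 ?mulr_ge0 ?sqr_ge0 // ltW.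
Qed.

Lemma qcap_ge0 (c x : R) : 0 < x -> 0 <= qcap c x.
Proof. by move=> x0; rewrite /qcap; case: ifP => // xc; exact: qfun_ge0. Qed.

Lemma qcap_le (c x : R) : 0 < c -> 0 < x -> qcap c x <= (2 * x)^-1.
Proof.
move=> c0 x0; rewrite /qcap; case: ifP => xc; last by rewrite invr_ge0 mulr_ge0 // ltW.
have h : 0 < c + 3 * x ^+ 2 by rewrite ltr_wpDr // mulr_ge0 // sqr_ge0.
rewrite /qfun invfM mulrCA ler_piMr ?invr_ge0 ?mulr_ge0 ?(ltW x0) //.
by rewrite ler_pdivrMr // mul1r; have := sqr_ge0 x; lra.
Qed.

Lemma qcap_step (c x y : R) : 0 < c -> 0 < x -> x <= y ->
  (y - x) * qcap c y <= qprimcap c y - qprimcap c x <= (y - x) * qcap c x.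
Proof.
move=> c0 x0 xy; have y0 := lt_le_trans x0 xy.
have s0 : 0 < Num.sqrt c by rewrite sqrtr_gt0.
have ss : Num.sqrt c ^+ 2 = c by rewrite sqr_sqrtr // ltW.
have le_s z : 0 < z -> (z ^+ 2 <= c) = (z <= Num.sqrt c).
  by move=> z0; rewrite -{1}ss ler_pXn2r // nnegrE ltW.
have step u v : 0 < u -> u <= v -> v <= Num.sqrt c ->
    (v - u) * qfun c v <= qprim c v - qprim c u <= (v - u) * qfun c u.
  move=> u0 uv vs; apply: mvt_bounds => // z /andP[uz zv]; have z0 := lt_le_trans u0 uz.
    exact: is_derive_qprim.
  by rewrite !qfun_anti ?le_s // ?(le_trans zv) // (lt_le_trans z0).
rewrite /qcap !le_s // /qprimcap.
have [ys|sy] := leP y (Num.sqrt c).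
  by rewrite (le_trans xy ys) min_l ?(le_trans xy ys) //; exact: step.
have [xs|sx] := leP x (Num.sqrt c); last by rewrite !mulr0 subrr lexx.
have /andP[h1 h2] := step x _ x0 xs (lexx _).
have q0 : qfun c (Num.sqrt c) = 0 by rewrite /qfun ss subrr mul0r.
rewrite mulr0; rewrite q0 mulr0 in h1; rewrite h1 /=; apply: le_trans h2 _.
by rewrite ler_wpM2r ?qfun_ge0 ?le_s // lerD2r ltW.
Qed.

(** The total weight on the line at distance [t], written with [lnterm] so that [sum_lnterm]
    applies. Summed over [t] it gives about [pi sqrt n (-1/12 + (1/3)(1/2))], that is
    [pi sqrt n/12]. *)
Lemma qprim_total (n t : R) : 0 < n -> 0 < t ->
  qprim (n + t ^+ 2) (Num.sqrt (n + t ^+ 2)) - qprim (n + t ^+ 2) t =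
  - (lnterm n t) / 12 + lnterm (n / 4) t / 3.
Proof.
move=> n0 t0; have t2 : 0 < t ^+ 2 by rewrite exprn_gt0.
set c := n + t ^+ 2; have c0 : 0 < c by rewrite addr_gt0.
have ss : Num.sqrt c ^+ 2 = c by rewrite sqr_sqrtr // ltW.
have s0 : 0 < Num.sqrt c by rewrite sqrtr_gt0.
rewrite /qprim ss !lntermE ?divr_gt0 //.
have e1 : ln c = 2 * ln (Num.sqrt c) by rewrite -{1}ss lnXn // mulr_natl.
have e2 : ln (c + 3 * c) = ln 4 + ln c by rewrite -lnM ?posrE //; congr ln; ring.
have e3 : ln (c + 3 * t ^+ 2) = ln 4 + ln (t ^+ 2 + n / 4).
  by rewrite -lnM ?posrE ?addr_gt0 ?divr_gt0 //; congr ln; rewrite /c; field.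
have e4 : ln (t ^+ 2 + n) = ln c by rewrite /c addrC.
by rewrite e2 e3 e4 e1; field.
Qed.

(** A Riemann sum of step [D] for a decreasing [q] with primitive [K], eventually equal to [Kinf].
    The error is at most one term of the sum, hence at most [q t]. *)
Lemma sum_multiples_step (K q : nat -> R) (Kinf B : R) (t D M : nat) :
  (0 < t)%N -> (0 < D)%N -> (t <= M)%N ->
  (forall x y, (t <= x)%N -> (x <= y)%N ->
     (y - x)%:R * q y <= K y - K x <= (y - x)%:R * q x) ->
  (forall x, (t <= x)%N -> 0 <= q x) ->
  (forall x, (M <= x)%N -> K x = Kinf) -> q t <= B ->
  `|\sum_(1 <= a < M.+1 | (D %| a)%N) (if (t < a)%N then q a else 0) - (Kinf - K t) / D%:R| <= B.
Proof.
move=> t0 D0 tM step q0 KM qB.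
have DR : 0 < D%:R :> R by rewrite ltr0n.
rewrite sum_multiples //; set S := (M %/ D)%N; pose s0 := (t %/ D)%N.
have s0S : (s0 <= S)%N by exact: leq_div2r.
have ts0 : (t < s0.+1 * D)%N by rewrite ltn_ceil.
have s0t : (s0 * D <= t)%N by exact: leq_trunc_div.
have MS : (M < S.+1 * D)%N by rewrite ltn_ceil.
rewrite (@big_cat_nat _ _ _ s0.+1) //=.
rewrite big_nat big1 ?add0r; last first.
  move=> s /andP[_ ss0]; rewrite ltnNge ifN // negbK.
  by apply: leq_trans s0t; rewrite leq_mul2r -ltnS ss0 orbT.
set T := \sum_(_ <= _ < _) _.
have TE : T = \sum_(s0.+1 <= s < S.+1) q (s * D)%N.
  rewrite /T !big_nat; apply: eq_bigr => s /andP[ss _].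
  by rewrite (leq_trans ts0) // leq_mul2r ss orbT.
have sD s : (s.+1 * D - s * D)%:R = D%:R :> R by rewrite -mulnBl subSnn mul1n.
have Kt : 0 <= K (s0.+1 * D)%N - K t <= D%:R * B.
  have /andP[h1 h2] := step t _ (leqnn t) (ltnW ts0).
  rewrite (le_trans _ h1) ?mulr_ge0 ?q0 ?(ltnW ts0) //=; apply: le_trans h2 _.
  by apply: ler_pM; rewrite ?q0 ?ler_nat //; lia.
have lo : Kinf - K (s0.+1 * D)%N <= D%:R * T.
  rewrite -(KM (S.+1 * D)%N) ?(ltnW MS) // TE mulr_sumr.
  rewrite -(telescope_sumr (fun s => K (s * D)%N)) // !big_nat.
  apply: ler_sum => s /andP[ss _].
  have ts : (t <= s * D)%N by apply: leq_trans (ltnW ts0) _; rewrite leq_mul2r ss orbT.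
  by have /andP[_] := step _ (s.+1 * D)%N ts (leq_mul (leqnSn s) (leqnn D)); rewrite sD.
have q1B : q (s0.+1 * D)%N <= B.
  apply: le_trans qB; have /andP[h1 h2] := step t _ (leqnn t) (ltnW ts0).
  by have := le_trans h1 h2; rewrite ler_pM2l // ltr0n subn_gt0.
have B0 : 0 <= B by apply: le_trans (q0 t _) qB.
have up : D%:R * T <= D%:R * B + (Kinf - K (s0.+1 * D)%N).
  have [sS|Ss] := ltnP s0 S; last first.
    rewrite TE big_geq // mulr0 -(KM (s0.+1 * D)%N) ?subrr ?addr0 ?mulr_ge0 //.
    by apply: leq_trans (ltnW MS) _; rewrite leq_mul2r ltnS Ss orbT.
  rewrite TE big_ltn // mulrDr; apply: lerD; first by rewrite ler_pM2l.
  apply: le_trans (_ : K (S * D)%N - K (s0.+1 * D)%N <= _); last first.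
    rewrite lerD2r -(KM (S.+1 * D)%N) ?(ltnW MS) // -subr_ge0.
    have tS : (t <= S * D)%N by apply: leq_trans (ltnW ts0) _; rewrite leq_mul2r sS orbT.
    have /andP[h1 _] := step _ (S.+1 * D)%N tS (leq_mul (leqnSn S) (leqnn D)).
    by apply: le_trans h1; rewrite mulr_ge0 // q0 // (leq_trans tS) // leq_mul2r leqnSn orbT.
  rewrite mulr_sumr -(telescope_sumr (fun s => K (s * D)%N)) // big_add1 /= !big_nat.
  apply: ler_sum => s /andP[ss _].
  have ts : (t <= s * D)%N by apply: leq_trans (ltnW ts0) _; rewrite leq_mul2r ss orbT.
  by have /andP[] := step _ (s.+1 * D)%N ts (leq_mul (leqnSn s) (leqnn D)); rewrite sD.
rewrite -(ler_pM2l DR) -[X in X * `|_|](gtr0_norm DR) -normrM mulrBr mulrCA divff ?gt_eqF // mulr1.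
by rewrite ler_norml; apply/andP; case/andP: Kt => k1 k2; split; lra.
Qed.

End RealSums.

Section MeanWeights.
Variable R : realType.

Definition Psi (a n : nat) : R := (\sum_(0 <= b < 2 * a) wt R a n b) / (2 * a)%:R.

Definition PD (M D n : nat) : R := \sum_(1 <= a < M.+1 | (D %| a)%N) Psi a n.

Lemma Psi_ge0 a n : 0 <= Psi a n.
Proof. by rewrite divr_ge0 // sumr_ge0 // => b _; rewrite divr_ge0. Qed.

Lemma PD_ge0 M D n : 0 <= PD M D n.
Proof. by apply: sumr_ge0 => a _; exact: Psi_ge0. Qed.

(** The weight is symmetric about [b = a]: with [b = a - t] or [b = a + t],
    [b (2a - b) = a^2 - t^2]. The columns [b = 0] and [b = a] have no partner. *)
Lemma sum_wt_sym (a n : nat) : (0 < a)%N -> \sum_(0 <= b < 2 * a) wt R a n b =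
  wt R a n 0 + wt R a n a + 2 * \sum_(1 <= t < a) phi R a (n - (a ^ 2 - t ^ 2)).
Proof.
move=> a0; rewrite (@big_cat_nat _ _ _ a) //=; last by lia.
rewrite (big_ltn a0) [X in _ + X](big_ltn (_ : (a < 2 * a)%N)); last by lia.
have -> : \sum_(1 <= b < a) wt R a n b = \sum_(1 <= t < a) phi R a (n - (a ^ 2 - t ^ 2)).
  rewrite big_nat_rev /= !big_nat; apply: eq_bigr => t /andP[t1 ta].
  by rewrite /wt; congr (phi _ _ (_ - _)); nia.
have -> : \sum_(a.+1 <= b < 2 * a) wt R a n b = \sum_(1 <= t < a) phi R a (n - (a ^ 2 - t ^ 2)).
  rewrite -[a.+1]add1n big_addn (_ : (2 * a - a = a)%N); last by lia.
  rewrite !big_nat; apply: eq_bigr => t /andP[t1 ta].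
  by rewrite /wt; congr (phi _ _ (_ - _)); nia.
by ring.
Qed.

(** With [c = n + t^2] the denominator is [4 a^2 + (c - a^2) = c + 3 a^2]. For [a^2 > c] both sides
    are 0, the left one by truncated subtraction. *)
Lemma phi_qcap (a n t : nat) : (0 < a)%N -> (t < a)%N ->
  phi R a (n - (a ^ 2 - t ^ 2)) / (2 * a)%:R = qcap (n%:R + t%:R ^+ 2) (a%:R : R).
Proof.
move=> a0 ta; rewrite /qcap.
have aR : 0 < a%:R :> R by rewrite ltr0n.
rewrite -!natrX -natrD ler_nat; case: leqP => h; last first.
  by rewrite /phi (_ : (n - (a ^ 2 - t ^ 2) = 0)%N) ?mul0r //; nia.
rewrite /phi (_ : (n - (a ^ 2 - t ^ 2) = n + t ^ 2 - a ^ 2)%N); last by nia.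
rewrite (_ : (4 * a ^ 2 + (n + t ^ 2 - a ^ 2) = n + t ^ 2 + 3 * a ^ 2)%N); last by lia.
rewrite /qfun natrB // -!natrX -[LHS]mulrA -invfM; congr (_ * _^-1).
by rewrite -!natrM -natrD -natrM mulnC.
Qed.

(** The order of summation is exchanged: first over the multiples [a > t] of [D] on a line, then
    over [t]. The two lines at distance [t] double [pi/12] to [pi/6]; each line and each unpaired
    column costs a term of a harmonic sum. *)
Lemma PD_asymptotic (M D n : nat) : (0 < n)%N -> (0 < D)%N -> (n < M)%N ->
  `|PD M D n - pi / 6 * Num.sqrt n%:R / D%:R| <= 8 * harm R M.
Proof.
move=> n0 D0 nM.
have M0 : (0 < M)%N by exact: leq_trans nM.
have M2 : (2 <= M)%N by exact: leq_trans nM.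
have nR : 0 < n%:R :> R by rewrite ltr0n.
have DR : 0 < D%:R :> R by rewrite ltr0n.
have D1 : 1 <= D%:R :> R by rewrite ler1n.
have H1 := harm_ge1 R M0.
pose F t a : R := if (t < a)%N then qcap (n%:R + t%:R ^+ 2) a%:R else 0.
pose Eb a : R := (wt R a n 0 + wt R a n a) / (2 * a)%:R.
have Eb1 a : (0 < a)%N -> 0 <= Eb a <= a%:R^-1.
  move=> a0; have h1 := wt_ge0 R a n 0; have h2 := wt_ge0 R a n a.
  have k1 : wt R a n 0 <= 1 by exact: phi_le1.
  have k2 : wt R a n a <= 1 by exact: phi_le1.
  rewrite /Eb divr_ge0 ?addr_ge0 //= natrM invfM mulrA ler_piMl ?invr_ge0 //.
  by rewrite ler_pdivrMr //; lra.
have PE : PD M D n = \sum_(1 <= a < M.+1 | (D %| a)%N) Eb a +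
    2 * \sum_(1 <= t < M) \sum_(1 <= a < M.+1 | (D %| a)%N) F t a.
  rewrite exchange_big /= mulr_sumr -big_split /= /PD [LHS]big_nat_cond [RHS]big_nat_cond.
  apply: eq_bigr => a /andP[/andP[a1 aM] _].
  rewrite /Psi sum_wt_sym // mulrDl; congr (_ + _).
  rewrite -mulrA mulr_suml; congr (2 * _); rewrite [RHS](@big_cat_nat _ _ _ a 1 M) //=.
  rewrite [X in _ = _ + X]big_nat [X in _ = _ + X]big1 ?addr0; last first.
    by move=> t /andP[ta _]; rewrite /F ltnNge ta.
  rewrite !big_nat; apply: eq_bigr => t /andP[t1 ta].
  by rewrite /F ta phi_qcap.
have EbS : 0 <= \sum_(1 <= a < M.+1 | (D %| a)%N) Eb a <= harm R M.
  rewrite big_nat_cond sumr_ge0 => [|a /andP[/andP[a1 _] _]]; last by case/andP: (Eb1 a a1).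
  rewrite /harm [leRHS]big_nat big_mkcond [leRHS]big_mkcond /=; apply: ler_sum => a _.
  case: (boolP (1 <= a < M.+1)%N) => //= /andP[a1 _].
  by case: ifP => _; [case/andP: (Eb1 a a1)|rewrite invr_ge0].
have S t : (1 <= t < M)%N ->
    `|\sum_(1 <= a < M.+1 | (D %| a)%N) F t a -
      (- (lnterm n%:R t%:R) / 12 + lnterm (n%:R / 4) t%:R / 3) / D%:R| <= 2^-1 * t%:R^-1.
  move=> /andP[t1 tM]; have tR : 0 < t%:R :> R by rewrite ltr0n.
  set c := n%:R + t%:R ^+ 2 : R; have c0 : 0 < c by rewrite addr_gt0 // exprn_gt0.
  (* The line carries no weight beyond [a = sqrt c], so the range [a <= M] loses nothing. *)
  have sM : Num.sqrt c <= M%:R.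
    have -> : M%:R = Num.sqrt (M%:R ^+ 2) :> R by rewrite sqrtr_sqr ger0_norm.
    by apply: ler_wsqrtr; rewrite /c -!natrX -natrD ler_nat; nia.
  have -> : - (lnterm n%:R t%:R) / 12 + lnterm (n%:R / 4) t%:R / 3 =
     qprim c (Num.sqrt c) - qprimcap c t%:R.
    rewrite -qprim_total // -/c /qprimcap min_l //.
    rewrite -[leLHS]ger0_norm ?(ltW tR) // -sqrtr_sqr ler_wsqrtr // /c lerDr ltW //.
  apply: (@sum_multiples_step R (fun x => qprimcap c x%:R) (fun a => qcap c a%:R) _ _ t D M) => //.
  - exact: ltnW.
  - move=> x y tx xy; rewrite natrB //; apply: qcap_step => //; last by rewrite ler_nat.
    by rewrite ltr0n; exact: leq_trans tx.
  - by move=> x tx; apply: qcap_ge0; rewrite ltr0n; exact: leq_trans tx.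
  - by move=> x Mx; rewrite /qprimcap min_r // (le_trans sM) // ler_nat.
  - by rewrite -invfM; exact: qcap_le.
have n4 : 0 < n%:R / 4 :> R by rewrite divr_gt0.
have nM1 : n%:R <= M.-1%:R :> R by rewrite ler_nat; lia.
have L1 := sum_lnterm nR M2 nM1.
have n4M : n%:R / 4 <= M.-1%:R :> R by apply: le_trans nM1; lra.
have L2 := sum_lnterm n4 M2 n4M.
have lnH (c : R) : 0 < c -> c <= n%:R -> ln (1 + c) <= harm R M.
  move=> c0 cn; apply: le_trans (_ : ln (n.+1%:R) <= _).
    by rewrite ler_ln ?posrE ?ltr0n ?addr_gt0 // -natr1 addrC lerD2r.
  apply: le_trans (harm_le R (ltnW nM)).
  rewrite -[leLHS]subr0 -(ln1 R) -[X in _ - ln X]/(1%:R).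
  rewrite -(telescope_sumr (fun k => ln k%:R)) // /harm !big_nat; apply: ler_sum => k /andP[k1 _].
  have k0 : 0 < k%:R :> R by rewrite ltr0n.
  rewrite -ln_div ?posrE ?ltr0n // -natr1 mulrDl divff ?gt_eqF // mul1r le_ln1Dx //.
  by rewrite (lt_trans _ (_ : 0 < k%:R^-1)) ?invr_gt0 // oppr_lt0 ltr01.
have h1 := lnH _ nR (lexx _); have h2 := lnH _ n4 (_ : n%:R / 4 <= n%:R).
have {}h2 : ln (1 + n%:R / 4) <= harm R M by apply: h2; lra.
pose T := \sum_(1 <= t < M) \sum_(1 <= a < M.+1 | (D %| a)%N) F t a.
pose U := \sum_(1 <= t < M) lnterm n%:R (t%:R : R).
pose V := \sum_(1 <= t < M) lnterm (n%:R / 4) (t%:R : R).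
have TE : `|T - (- U / 12 + V / 3) / D%:R| <= 2^-1 * harm R M.
  have -> : T - (- U / 12 + V / 3) / D%:R = \sum_(1 <= t < M)
     (\sum_(1 <= a < M.+1 | (D %| a)%N) F t a -
      (- (lnterm n%:R t%:R) / 12 + lnterm (n%:R / 4) t%:R / 3) / D%:R).
    by rewrite sumrB -mulr_suml big_split /= -!mulr_suml sumrN.
  apply: le_trans (ler_norm_sum _ _ _) _.
  apply: le_trans (_ : \sum_(1 <= t < M) 2^-1 * (t%:R^-1 : R) <= _).
    by rewrite !big_nat; apply: ler_sum => t tM; exact: S.
  rewrite -mulr_sumr ler_wpM2l // -(@prednK M) //.
  exact: (harm_le R (leqnSn _)).
have s4 : Num.sqrt (n%:R / 4) = Num.sqrt n%:R / 2 :> R.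
  rewrite sqrtrM // sqrtrV // (_ : 4 = 2 ^+ 2 :> R); last by ring.
  by rewrite sqrtr_sqr ger0_norm.
rewrite -/U in L1; rewrite -/V s4 in L2.
have UV : `|(- U / 12 + V / 3) - pi / 12 * Num.sqrt n%:R| <= 5 / 12 * (4 + harm R M).
  move: L1 L2; rewrite !ler_norml => /andP[a1 a2] /andP[b1 b2]; apply/andP; split; lra.
have UVD : `|(- U / 12 + V / 3) / D%:R - pi / 12 * Num.sqrt n%:R / D%:R| <= 5 / 12 * (4 + harm R M).
  rewrite -mulrBl normrM [`|_^-1|]gtr0_norm ?invr_gt0 //; apply: le_trans UV.
  by rewrite ler_piMr // invf_le1.
have e : pi / 6 * Num.sqrt n%:R / D%:R = 2 * (pi / 12 * Num.sqrt n%:R / D%:R) :> R.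
  by field; rewrite gt_eqF.
rewrite PE -/T e; case/andP: EbS.
move: TE UVD; rewrite !ler_norml => /andP[a1 a2] /andP[b1 b2] c1 c2.
by apply/andP; split; lra.
Qed.

End MeanWeights.

(** * Solutions of quadratic congruences *)

Definition mu (n : nat) : int :=
  if all (fun p => logn p n == 1%N) (primes n) then (-1) ^+ size (primes n) else 0.

Lemma norm_mu n : `|mu n| <= 1.
Proof. by rewrite /mu; case: ifP => _; rewrite ?normr0 // normrX normrN1 expr1n. Qed.

Lemma mu_primeM (p s : nat) : prime p -> (0 < s)%N -> ~~ (p %| s)%N -> mu (p * s) = - mu s.
Proof.
move=> pp s0 ps; have p0 := prime_gt0 pp.
have perm : perm_eq (primes (p * s)) (p :: primes s).
  apply: uniq_perm; rewrite ?primes_uniq //= ?primes_uniq ?andbT.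
    by rewrite mem_primes pp s0.
  by move=> r; rewrite inE primesM // primes_prime // inE.
rewrite /mu (perm_all _ perm) (perm_size perm) /=.
have lp : logn p (p * s) = 1%N by rewrite lognM // logn_prime // eqxx logn_coprime // prime_coprime.
rewrite lp eqxx /=; have -> : all (fun p1 => logn p1 (p * s) == 1%N) (primes s) =
   all (fun p1 => logn p1 s == 1%N) (primes s).
  apply: eq_in_all => r; rewrite mem_primes => /and3P[rp _ rs].
  have rp' : r != p by apply: contraNneq ps => <-.
  by rewrite lognM // (@logn_coprime r p) // prime_coprime // dvdn_prime2.
by case: ifP => _; rewrite ?oppr0 // exprS mulN1r.
Qed.

Lemma mu_prime_dvd (p s : nat) : prime p -> (0 < s)%N -> (p %| s)%N -> mu (p * s) = 0.
Proof.
move=> pp s0 ps; have p0 := prime_gt0 pp; rewrite /mu.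
case: ifP => // /allP /(_ p); rewrite mem_primes pp muln_gt0 p0 s0 dvdn_mulr //= => /(_ isT).
rewrite lognM // logn_prime // eqxx add1n eqSS => /eqP h.
have : (0 < logn p s)%N by rewrite logn_gt0 mem_primes pp s0 ps.
by rewrite h.
Qed.

(** Let [p] be the least prime factor of [n]. A divisor [d] prime to [p] cancels against [p d], and
    the divisors with [p^2] contribute 0. *)
Lemma sum_mu (n : nat) : (0 < n)%N -> \sum_(1 <= d < n.+1 | (d %| n)%N) mu d = (n == 1%N)%:R.
Proof.
case: n => // -[|n] _; first by rewrite big_mkcond big_nat1.
set N := n.+2; have N0 : (0 < N)%N by [].
have pp : prime (pdiv N) by exact: pdiv_prime.
have pN : (pdiv N %| N)%N by exact: pdiv_dvd.
set p := pdiv N in pp pN.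
rewrite (bigID (fun d => (p %| d)%N)) /=.
have -> : \sum_(1 <= d < N.+1 | (d %| N)%N && (p %| d)%N) mu d =
    - \sum_(1 <= d < N.+1 | (d %| N)%N && ~~ (p %| d)%N) mu d.
  rewrite (eq_bigl (fun d => (p %| d)%N && (d %| N)%N)); last by move=> d; rewrite andbC.
  rewrite big_mkcondr /= sum_multiples ?prime_gt0 //.
  have pN' : (N %/ p * p = N)%N by rewrite divnK.
  rewrite -sumrN [RHS](@big_cat_nat _ _ _ (N %/ p).+1) //=; last by rewrite ltnS leq_div.
  rewrite [X in _ + X]big_nat_cond [X in _ + X]big1 ?addr0; last first.
    move=> d /andP[/andP[d1 d2] /andP[dN pd]].
    have : (p * d %| N)%N by rewrite Gauss_dvd ?pN // prime_coprime.
    move=> /(dvdn_leq N0); rewrite mulnC -leq_divRL ?prime_gt0 // => h.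
    by move: d1; rewrite ltnNge h.
  rewrite [RHS]big_mkcond !big_nat; apply: eq_bigr => s /andP[s1 s2].
  have [ps|ps] := boolP (p %| s)%N; rewrite ?andbF ?andbT /=.
    by rewrite [(s * p)%N]mulnC mu_prime_dvd // if_same.
  rewrite [(s * p)%N]mulnC mu_primeM // Gauss_dvd ?prime_coprime // pN /=.
  by case: ifP; rewrite ?oppr0.
by rewrite addNr.
Qed.

(** This is Ramanujan's sum [c_D(l)], in its divisor form. *)
Definition dlam (l D : nat) : int :=
  \sum_(1 <= e < D.+1 | (e %| D)%N && (e %| l)%N) e%:Z * mu (D %/ e).

Lemma sum_dlam (l G : nat) : (0 < G)%N ->
  \sum_(1 <= D < G.+1 | (D %| G)%N) dlam l D = (G * (G %| l))%N%:Z.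
Proof.
move=> G0.
transitivity (\sum_(1 <= e < G.+1 | (e %| l)%N) e%:Z *
    \sum_(1 <= D < G.+1 | (e %| D)%N) (if (D %| G)%N then mu (D %/ e) else 0)).
  transitivity (\sum_(1 <= D < G.+1 | (D %| G)%N) \sum_(1 <= e < G.+1 | (e %| l)%N)
      (if (e %| D)%N then e%:Z * mu (D %/ e) else 0)).
    rewrite big_nat_cond [RHS]big_nat_cond; apply: eq_bigr => D /andP[/andP[D1 DG] _].
    rewrite /dlam -big_mkcondr /= [RHS](@big_cat_nat _ _ _ D.+1) //=.
    rewrite [X in _ + X]big_nat_cond [X in _ + X]big1 ?addr0; last first.
      by move=> e /andP[/andP[De _] /andP[_ eD]]; have := dvdn_leq D1 eD; rewrite leqNgt De.
    by apply: eq_bigl => e; rewrite andbC.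
  rewrite exchange_big /=; apply: eq_bigr => e _; rewrite mulr_sumr.
  rewrite [LHS]big_mkcond [RHS]big_mkcond; apply: eq_bigr => D _.
  by case: (D %| G)%N; case: (e %| D)%N; rewrite ?mulr0.
have E e : (1 <= e < G.+1)%N ->
  \sum_(1 <= D < G.+1 | (e %| D)%N) (if (D %| G)%N then mu (D %/ e) else 0) = (e == G)%:R.
  move=> /andP[e1 eG]; rewrite sum_multiples //.
  have [eG'|neG] := boolP (e %| G)%N; last first.
    rewrite big1 => [|k _]; first by case: eqP => // eE; rewrite eE dvdnn in neG.
    by case: ifP => // /(dvdn_trans (dvdn_mull k (dvdnn e))) h; rewrite h in neG.
  have Ge0 : (0 < G %/ e)%N by rewrite divn_gt0.
  rewrite -big_mkcond /=.
  transitivity (\sum_(1 <= k < (G %/ e).+1 | (k %| G %/ e)%N) mu k).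
    apply: eq_big => k; first by rewrite -[in RHS](@dvdn_pmul2r e) // divnK.
    by rewrite mulnK.
  rewrite sum_mu //; congr (_%:R); congr (nat_of_bool _).
  by rewrite -(eqn_pmul2r e1) divnK // mul1n eq_sym.
rewrite big_nat_cond (eq_bigr (fun e => e%:Z * (e == G)%:R)); last by move=> e /andP[h _]; rewrite E.
rewrite -big_nat_cond big_mkcond big_nat_recr //= eqxx mulr1.
rewrite big_nat big1 ?add0r => [|e /andP[_ eG]]; first by case: ifP; rewrite ?muln1 ?muln0.
by case: ifP => // _; rewrite (ltn_eqF eG) mulr0.
Qed.

Section Congruences.
Variable R : realType.

Lemma sum_nat_mod (V : nmodType) (q : nat) (F : nat -> V) : F 0%N = F q ->
  \sum_(0 <= s < q) F s = \sum_(1 <= s < q.+1) F s.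
Proof.
case: q => [|q] Fq; first by rewrite !big_geq.
by rewrite big_ltn // [RHS]big_nat_recr //= Fq addrC.
Qed.

Lemma count_multiples (D q : nat) : (0 < D)%N -> (D %| q)%N ->
  \sum_(0 <= s < q) (D %| s)%N%:R = (q %/ D)%:R :> R.
Proof.
move=> D0 Dq; rewrite sum_nat_mod ?dvdn0 ?Dq //.
rewrite (eq_bigr (fun s => if (D %| s)%N then 1 else 0)); last by move=> s _; case: ifP.
by rewrite -big_mkcond sum_multiples // sumr_const_nat subn1.
Qed.

(** The fibres of multiplication by [s] have at most [d = gcd(s, q)] points and are empty off the
    multiples of [d]. This bounds every count from above, and since both sides of the bound have
    total [q], equality holds everywhere. *)
Lemma linear_congruence_count (s l q : nat) : (0 < q)%N ->
  \sum_(0 <= t < q) (s * t == l %[mod q])%:R = (gcdn s q * (gcdn s q %| l))%:R :> R.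
Proof.
move=> q0; set d := gcdn s q.
have d0 : (0 < d)%N by rewrite gcdn_gt0 q0 orbT.
have dq : (d %| q)%N by exact: dvdn_gcdr.
pose c (r : 'I_q) : R := \sum_(t < q) (Ordinal (ltn_pmod (s * t) q0) == r)%:R.
have [g ginj] := mulmod_fiber s q0.
have c_le r : c r <= d%:R * (d %| r)%N%:R.
  have [dr|ndr] := boolP (d %| r)%N; last first.
    rewrite mulr0 /c big1 // => t _; case: eqP => // tr; exfalso.
    have /negP := ndr; apply; rewrite -tr /= -(dvdn_addr _ (dvdn_mull (s * t %/ q) dq)) -divn_eq.
    by rewrite dvdn_mulr // dvdn_gcdl.
  apply: le_trans (sum_fiber_le (f := fun j : 'I_q => (j == r)%:R : R) ginj _) _ => //.
  rewrite mulr1 ler_piMr // (bigD1 r) //= eqxx big1 ?addr0 // => j jr.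
  by rewrite (negPf jr).
have tot : \sum_(r < q) (d%:R * (d %| r)%N%:R - c r) = 0.
  rewrite sumrB -mulr_sumr -(big_mkord xpredT (fun r : nat => (d %| r)%N%:R)) count_multiples //.
  rewrite -natrM mulnC divnK // /c exchange_big /=.
  rewrite (eq_bigr (fun=> 1)) ?sumr_const ?card_ord ?subrr // => t _.
  by rewrite (bigD1 (Ordinal (ltn_pmod (s * t) q0))) //= eqxx big1 ?addr0 // => j; rewrite eq_sym => /negPf ->.
have cE r : c r = d%:R * (d %| r)%N%:R.
  have pos (i : 'I_q) : xpredT i -> 0 <= d%:R * (d %| i)%N%:R - c i by rewrite subr_ge0.
  have /(_ r isT)/eqP := psumr_eq0P pos tot.
  by rewrite subr_eq0 => /eqP.
rewrite big_mkord; transitivity (c (Ordinal (ltn_pmod l q0))).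
  by apply: eq_bigr => t _; rewrite -val_eqE.
rewrite cE natrM /=; congr (_ * (nat_of_bool _)%:R).
by rewrite /dvdn modn_dvdm.
Qed.

Lemma product_congruence_count (l q : nat) : (0 < q)%N ->
  \sum_(0 <= s < q) \sum_(0 <= t < q) (s * t == l %[mod q])%:R =
  q%:R * \sum_(1 <= D < q.+1 | (D %| q)%N) (dlam l D)%:~R / D%:R :> R.
Proof.
move=> q0.
transitivity (\sum_(0 <= s < q) \sum_(1 <= D < q.+1 | (D %| q)%N)
   ((dlam l D)%:~R * (D %| s)%N%:R : R)).
  apply: eq_bigr => s _; rewrite linear_congruence_count //.
  have d0 : (0 < gcdn s q)%N by rewrite gcdn_gt0 q0 orbT.
  transitivity (((gcdn s q * (gcdn s q %| l))%N%:Z)%:~R : R); first by [].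
  rewrite -sum_dlam // rmorph_sum /=.
  rewrite [RHS](@big_cat_nat _ _ _ (gcdn s q).+1) //=; last by rewrite ltnS dvdn_leq // dvdn_gcdr.
  rewrite [X in _ = _ + X]big_nat_cond [X in _ = _ + X]big1 ?addr0; last first.
    move=> D /andP[/andP[Dg _] Dq]; case: (boolP (D %| s)%N) => [Ds|]; last by rewrite mulr0.
    have : (D %| gcdn s q)%N by rewrite dvdn_gcd Ds.
    by move/(dvdn_leq d0); rewrite leqNgt Dg.
  rewrite big_mkcond [RHS]big_mkcond; apply: eq_bigr => D _; rewrite dvdn_gcd andbC.
  by case: (D %| q)%N; case: (D %| s)%N; rewrite ?mulr1 ?mulr0.
rewrite exchange_big /= mulr_sumr big_nat_cond [RHS]big_nat_cond.
apply: eq_bigr => D /andP[/andP[D1 _] Dq]; rewrite -mulr_sumr count_multiples // mulrCA.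
by congr (_ * _); rewrite -{2}(divnK Dq) natrM mulfK // pnatr_eq0 -lt0n.
Qed.

End Congruences.

(** * Differences of two squares modulo [4 g] *)

Section SquareDifferences.
Variable R : realType.

Lemma sum_periodic (V : zmodType) (m c : nat) (F : nat -> V) :
  (forall b, F (b + m)%N = F b) -> \sum_(0 <= b < m) F (b + c)%N = \sum_(0 <= b < m) F b.
Proof.
move=> per; elim: c => [|c IH]; first by apply: eq_bigr => b _; rewrite addn0.
rewrite -[RHS]IH; apply/eqP; rewrite -subr_eq0 -sumrB.
rewrite (eq_bigr (fun b => F (b.+1 + c)%N - F (b + c)%N)); last by move=> b _; rewrite addnS addSn.
by rewrite (telescope_sumr (fun b => F (b + c)%N)) // add0n addnC per subrr.
Qed.

Lemma sum_double_period (V : zmodType) (m : nat) (F : nat -> V) :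
  (forall b, F (b + m)%N = F b) -> \sum_(0 <= b < 2 * m) F b = (\sum_(0 <= b < m) F b) *+ 2.
Proof.
move=> per; rewrite mul2n -addnn (@big_cat_nat _ _ _ m) //= ?leq_addr //.
rewrite -{2}[m]add0n big_addn addnK mulr2n; congr (_ + _).
by apply: eq_bigr => b _; rewrite per.
Qed.

(** Put [s = c - b] in [c^2 - b^2 = s (s + 2 b)]. Here [s] runs modulo [4 g], twice the period [2 g]
    of [c], whence the factor 2. *)
Lemma sqcount_double (l g : nat) :
  2 * (sqcount l g)%:R = \sum_(0 <= s < 4 * g) \sum_(0 <= b < 2 * g)
    (s * (s + 2 * b) == l %[mod 4 * g])%:R :> R.
Proof.
rewrite [RHS]exchange_big /= /sqcount natr_sum.
under eq_bigr do rewrite natr_sum.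
rewrite exchange_big mulr_sumr /=; apply: eq_bigr => b _.
pose F c : R := (c ^ 2 == l + b ^ 2 %[mod 4 * g])%:R.
have per c : F (c + 2 * g)%N = F c.
  rewrite /F (_ : ((c + 2 * g) ^ 2 = (c + g) * (4 * g) + c ^ 2)%N); last by lia.
  by rewrite modnMDl.
have per4 c : F (c + 4 * g)%N = F c.
  by rewrite (_ : (c + 4 * g = c + 2 * g + 2 * g)%N) ?per //; lia.
rewrite mulr_natl -(sum_double_period per) mulnA -(sum_periodic b per4).
apply: eq_bigr => s _; rewrite /F (_ : ((s + b) ^ 2 = s * (s + 2 * b) + b ^ 2)%N); last by lia.
by rewrite eqn_modDr.
Qed.

Lemma sum_even_odd (V : nmodType) (m : nat) (F : nat -> V) :
  \sum_(0 <= t < m * 2) F t = \sum_(0 <= j < m) F (j * 2)%N + \sum_(0 <= j < m) F (j * 2 + 1)%N.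
Proof.
by rewrite sum_blocks big_nat_recl // big_nat1 /=; congr (_ + _); apply: eq_bigr => j _; rewrite addn0.
Qed.

Lemma odd_eq_mod (x y g : nat) : x = y %[mod 4 * g] -> odd x = odd y.
Proof.
have e : odd (4 * g) = false by rewrite oddM.
by move=> h; rewrite -(odd_mod x e) h odd_mod.
Qed.

(** For odd [l] a solution has [s] odd, and then [t = s + 2 b] runs once over the odd residues
    modulo [4 g]. Even [t] solve nothing and can be added freely. *)
Lemma sqcount_odd (l g : nat) : odd l -> (0 < g)%N ->
  (sqcount l g)%:R = 2 * g%:R * \sum_(1 <= D < (4 * g).+1 | (D %| 4 * g)%N)
     (dlam l D)%:~R / D%:R :> R.
Proof.
move=> ol g0; have := sqcount_double l g.
have -> : \sum_(0 <= s < 4 * g) \sum_(0 <= b < 2 * g) (s * (s + 2 * b) == l %[mod 4 * g])%:R =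
  \sum_(0 <= s < 4 * g) \sum_(0 <= t < 4 * g) (s * t == l %[mod 4 * g])%:R :> R.
  apply: eq_bigr => s _.
  have [os|es] := boolP (odd s); last first.
    by rewrite !big1 // => t _; case: eqP => // /odd_eq_mod; rewrite oddM (negPf es) ol.
  rewrite (_ : (4 * g = 2 * g * 2)%N); last by lia.
  rewrite [RHS]sum_even_odd [X in _ = X + _]big1 ?add0r; last first.
    move=> i _; rewrite (_ : (2 * g * 2 = 4 * g)%N); last by lia.
    by case: eqP => // /odd_eq_mod; rewrite !oddM andbF andbF ol.
  rewrite -[RHS](@sum_periodic _ _ s./2); last first.
    move=> b; rewrite (_ : (s * ((b + 2 * g) * 2 + 1) = s * (2 * g * 2) + s * (b * 2 + 1))%N).
      by rewrite modnMDl.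
    by lia.
  apply: eq_bigr => b _; congr (nat_of_bool (_ == _ %[mod _]))%:R; congr (_ * _)%N.
  by have := odd_double_half s; rewrite os; lia.
rewrite product_congruence_count ?muln_gt0 // => h.
have : 2 * (sqcount l g)%:R = 2 * (2 * g%:R * \sum_(1 <= D < (4 * g).+1 | (D %| 4 * g)%N)
     (dlam l D)%:~R / D%:R) :> R by rewrite h natrM; ring.
by apply: mulfI; rewrite pnatr_eq0.
Qed.

(** For even [l] a solution has [s = 2 s'], so [s (s + 2 b) = 4 s' (s' + b)], and [t = s' + b] is
    free modulo [2 g]. *)
Lemma sqcount_even (l g : nat) : ~~ odd l -> (0 < g)%N ->
  2 * (sqcount l g)%:R = \sum_(0 <= s < 2 * g) \sum_(0 <= t < 2 * g)
     (4 * (s * t) == l %[mod 4 * g])%:R :> R.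
Proof.
move=> el g0; rewrite sqcount_double (_ : (4 * g = 2 * g * 2)%N); last by lia.
rewrite sum_even_odd [X in _ + X]big1 ?addr0; last first.
  move=> s _; rewrite big1 // => b _; rewrite (_ : (2 * g * 2 = 4 * g)%N); last by lia.
  by case: eqP => // /odd_eq_mod; rewrite !(oddM, oddD) (negPf el) /= !andbF.
apply: eq_bigr => s _.
rewrite -[RHS](@sum_periodic _ _ s); last first.
  move=> b; rewrite (_ : (4 * (s * (b + 2 * g)) = 2 * s * (2 * g * 2) + 4 * (s * b))%N).
    by rewrite modnMDl.
  by lia.
apply: eq_bigr => b _; congr (nat_of_bool (_ == _ %[mod _]))%:R.
by lia.
Qed.

Lemma sqcount_2mod4 (l g : nat) : ~~ odd l -> ~~ (4 %| l)%N -> (0 < g)%N -> sqcount l g = 0%N.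
Proof.
move=> el l4 g0; apply/eqP; rewrite -(pnatr_eq0 R) -(mulrI_eq0 _ (mulfI (_ : 2 != 0))) ?pnatr_eq0 //.
rewrite sqcount_even // big1 // => s _; rewrite big1 // => t _.
case: eqP => // /eqP h; exfalso; have /negP := l4; apply.
have := congr1 (dvdn 4) (eqP h).
have d4 : (4 %| 4 * g)%N by exact: dvdn_mulr.
rewrite -[in X in X = _]/(dvdn _ _).
by rewrite /dvdn !(modn_dvdm _ d4) modnMr eqxx => <-.
Qed.

Lemma sqcount_4dvd (m g : nat) : (0 < g)%N ->
  (sqcount (4 * m) g)%:R = 2 * g%:R * \sum_(1 <= D < g.+1 | (D %| g)%N)
     (dlam m D)%:~R / D%:R :> R.
Proof.
move=> g0; have : 2 * (sqcount (4 * m) g)%:R = 2 * (2 * g%:R * \sum_(1 <= D < g.+1 | (D %| g)%N)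
     (dlam m D)%:~R / D%:R) :> R; last by apply: mulfI; rewrite pnatr_eq0.
rewrite sqcount_even ?oddM //.
rewrite -[X in _ = 2 * X]mulrA -product_congruence_count //.
have per s : \sum_(0 <= t < 2 * g) (4 * (s * t) == 4 * m %[mod 4 * g])%:R =
    2 * \sum_(0 <= t < g) (s * t == m %[mod g])%:R :> R.
  rewrite mulr_natl -sum_double_period => [|b]; last by rewrite mulnDr addnC modnMDl.
  apply: eq_bigr => t _; rewrite -!muln_modr //; by rewrite eqn_pmul2l.
rewrite (eq_bigr _ (fun s _ => per s)) -mulr_sumr; congr (2 * _).
rewrite mulr_natl sum_double_period // => b.
by apply: eq_bigr => t _; rewrite mulnDl addnC [(g * t)%N]mulnC modnMDl.
Qed.

End SquareDifferences.

Lemma sum_divisors (V : nmodType) (n : nat) (F : nat -> V) : (0 < n)%N ->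
  \sum_(d <- divisors n) F d = \sum_(1 <= d < n.+1 | (d %| n)%N) F d.
Proof.
move=> n0; rewrite -[RHS]big_filter; apply: perm_big; apply: uniq_perm.
- exact: divisors_uniq.
- by rewrite filter_uniq // iota_uniq.
move=> d; rewrite mem_filter mem_index_iota -dvdn_divisors //.
case: (boolP (d %| n)%N) => //= dn; by rewrite ltnS (dvdn_leq n0 dn) (dvdn_gt0 n0 dn).
Qed.

(** For odd [l] only odd [e] occur, so doubling [D] inserts a factor 2 into the argument of [mu]: a
    sign change if [D/e] is odd, 0 if it is even. *)
Lemma dlam_double (l D : nat) : odd l -> (0 < D)%N ->
  dlam l (2 * D) = if odd D then - dlam l D else 0.
Proof.
move=> ol D0; rewrite /dlam (@big_cat_nat _ _ _ D.+1) //=; last by lia.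
have co e : (e %| l)%N -> coprime e 2.
  by move=> el; rewrite coprimen2; move: ol; rewrite -(divnK el) oddM => /andP[].
have dE e : ((e %| 2 * D) && (e %| l) = (e %| D) && (e %| l))%N.
  by have [el|_] := boolP (e %| l)%N; rewrite ?andbF // Gauss_dvdr ?co.
rewrite [X in _ + X]big_nat_cond [X in _ + X]big1 ?addr0; last first.
  move=> e /andP[/andP[De _]]; rewrite dE => /andP[eD _].
  by have := dvdn_leq D0 eD; rewrite leqNgt De.
transitivity (\sum_(1 <= e < D.+1 | (e %| D)%N && (e %| l)%N) (if odd D then - (e%:Z * mu (D %/ e)) else 0));
  last first.
  by case: (odd D); rewrite ?sumrN // big1.
rewrite big_nat_cond [RHS]big_nat_cond; apply: eq_big => e; first by rewrite dE.
move=> /andP[/andP[e1 _]]; rewrite dE => /andP[eD el].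
rewrite -muln_divA //.
have De0 : (0 < D %/ e)%N by rewrite divn_gt0 // dvdn_leq.
have oD : odd (D %/ e) = odd D.
  by rewrite -{2}(divnK eD) oddM; move: (co e el); rewrite coprimen2 => ->; rewrite andbT.
rewrite -oD; case: ifP => o.
  by rewrite mu_primeM // ?dvdn2 ?o // mulrN.
by rewrite mu_prime_dvd ?dvdn2 ?o ?mulr0.
Qed.

Section SingularSeries.
Variable R : realType.

Lemma tau_sum (n : nat) : (0 < n)%N -> (tau n)%:R = \sum_(1 <= d < n.+1 | (d %| n)%N) 1 :> R.
Proof. by move=> n0; rewrite -sum_divisors // big_const_seq count_predT iter_addr addr0. Qed.

(* The coefficients with [sqcount l g = 4 g * \sum_(D %| g) lam l D]: the
   substitution [st = b^2 - b'^2] makes [sqcount] a count of solutions of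
   [s t = l/4] modulo [g], or of [s t = l] modulo [4 g] when [l] is odd. *)
Definition lam (l D : nat) : R :=
  if odd l then (if odd D then (dlam l D)%:~R / D%:R / 4 else 0)
  else if (4 %| l)%N then (dlam (l %/ 4) D)%:~R / D%:R / 2 else 0.

Lemma norm_dlam (l D : nat) : (0 < D)%N -> `|(dlam l D)%:~R / D%:R| <= (tau D)%:R :> R.
Proof.
move=> D0; have DR : 0 < D%:R :> R by rewrite ltr0n.
rewrite normrM [`|_^-1|]gtr0_norm ?invr_gt0 // ler_pdivrMr //.
rewrite -intr_norm /dlam; apply: le_trans (_ : (\sum_(1 <= e < D.+1 | (e %| D)%N) D%:Z)%:~R <= _).
  rewrite ler_int; apply: le_trans (ler_norm_sum _ _ _) _.
  rewrite big_mkcondr big_nat_cond [leRHS]big_nat_cond; apply: ler_sum => e /andP[/andP[e1 eD] ed].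
  case: ifP => // _; rewrite normrM -[leRHS]mulr1; apply: ler_pM => //; last exact: norm_mu.
rewrite rmorph_sum /= tau_sum // mulr_suml; apply: ler_sum => e _; by rewrite mul1r.
Qed.

Lemma norm_lam (l D : nat) : (0 < D)%N -> `|lam l D| <= (tau D)%:R.
Proof.
move=> D0; have t0 : 0 <= (tau D)%:R :> R by [].
have h m : `|(dlam m D)%:~R / D%:R| <= (tau D)%:R :> R by exact: norm_dlam.
have k (c : R) m : 1 <= c -> `|(dlam m D)%:~R / D%:R / c| <= (tau D)%:R.
  move=> c1; rewrite normrM [`|c^-1|]ger0_norm ?invr_ge0 ?(le_trans ler01) //.
  apply: le_trans (h m); rewrite ler_piMr // invf_le1 //; exact: lt_le_trans c1.
rewrite /lam; case: ifP => _; case: ifP => _; rewrite ?normr0 ?k //; lra.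
Qed.

(** When [l] is odd, the sum over the divisors of [4 g] reduces to odd [D] dividing [g]: each
    contributes for [D] and, halved with opposite sign, for [2 D]. The resulting [1 - 1/2] explains
    the 4 in [lam]. *)
Lemma sqcountE (l g : nat) : (0 < g)%N -> (sqcount l g)%:R =
  4 * g%:R * \sum_(1 <= D < g.+1 | (D %| g)%N) lam l D.
Proof.
move=> g0; rewrite /lam; have [ol|el] := boolP (odd l); last first.
  have [l4|l4] := boolP (4 %| l)%N; last by rewrite sqcount_2mod4 // big1 ?mulr0.
  rewrite -{1}(divnK l4) mulnC sqcount_4dvd // -mulr_suml; by field.
rewrite sqcount_odd // (bigID (fun D => (2 %| D)%N)) /=.
have -> : \sum_(1 <= D < (4 * g).+1 | (D %| 4 * g)%N && (2 %| D)%N) (dlam l D)%:~R / D%:R =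
   - 2^-1 * \sum_(1 <= D < g.+1 | (D %| g)%N) (if odd D then (dlam l D)%:~R / D%:R else 0) :> R.
  rewrite (eq_bigl (fun d => (2 %| d)%N && (d %| 4 * g)%N)); last by move=> d; rewrite andbC.
  rewrite big_mkcondr sum_multiples // (_ : (4 * g %/ 2 = 2 * g)%N); last by rewrite -divn_mulAC ?mulKn //; lia.
  rewrite (@big_cat_nat _ _ _ g.+1) //=; last by lia.
  have key D : (0 < D)%N -> (if (D * 2 %| 4 * g)%N then (dlam l (D * 2))%:~R / (D * 2)%:R else 0) =
      if (D %| g)%N then - 2^-1 * (if odd D then (dlam l D)%:~R / D%:R else 0) else 0 :> R.
    move=> D0; rewrite [(D * 2)%N]mulnC dlam_double // (_ : (4 * g = 2 * (2 * g))%N); last by lia.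
    rewrite dvdn_pmul2l //; have [oD|eD] := boolP (odd D); last by rewrite mul0r mulr0; case: ifP; case: ifP.
    rewrite Gauss_dvdr ?coprimen2 //; case: ifP => // _.
    by rewrite rmorphN natrM /=; field; rewrite pnatr_eq0 -lt0n.
  rewrite [X in _ + X]big_nat [X in _ + X]big1 ?addr0; last first.
    move=> D /andP[gD _]; rewrite key ?(leq_trans _ gD) //; case: ifP => // Dg.
    by have := dvdn_leq g0 Dg; rewrite leqNgt gD.
  rewrite mulr_sumr [RHS]big_mkcond !big_nat; apply: eq_bigr => D /andP[D1 _]; exact: key.
have -> : \sum_(1 <= D < (4 * g).+1 | (D %| 4 * g)%N && ~~ (2 %| D)%N) (dlam l D)%:~R / D%:R =
   \sum_(1 <= D < g.+1 | (D %| g)%N) (if odd D then (dlam l D)%:~R / D%:R else 0) :> R.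
  have c D : ((D %| 4 * g) && ~~ (2 %| D) = (D %| g) && odd D)%N.
    rewrite dvdn2 negbK; have [oD|] := boolP (odd D); rewrite ?andbF // !andbT.
    by rewrite (_ : 4 = 2 ^ 2)%N // Gauss_dvdr // coprimeXr // coprimen2.
  rewrite (eq_bigl _ _ c) (@big_cat_nat _ _ _ g.+1) //=; last by lia.
  rewrite [X in _ + X]big_nat_cond [X in _ + X]big1 ?addr0; last first.
    move=> D /andP[/andP[gD _] /andP[Dg _]].
    by have := dvdn_leq g0 Dg; rewrite leqNgt gD.
  by rewrite big_mkcondr.
set T := \sum_(1 <= D < g.+1 | _) _.
have -> : \sum_(1 <= D < g.+1 | (D %| g)%N) (if odd D then (dlam l D)%:~R / D%:R / 4 else 0) = T / 4 :> R.
  by rewrite /T mulr_suml; apply: eq_bigr => D _; case: ifP => //; rewrite mul0r.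
by field.
Qed.

End SingularSeries.

(** * The singular series *)

Section Zeta.
Variable R : realType.

Lemma inv_sq_tail (J J' : nat) :
  \sum_(J.+1 <= j < J'.+1) (j%:R ^+ 2)^-1 <= 2 / J.+1%:R :> R.
Proof.
have [J'J|JJ'] := leqP J' J; first by rewrite big_geq // divr_ge0.
(* The induction carries the remainder [1/J'], since [1/(j + 1)^2 <= 1/j - 1/(j + 1)] telescopes. *)
suff : \sum_(J.+1 <= j < J'.+1) (j%:R ^+ 2)^-1 <= 2 / J.+1%:R - J'%:R^-1 :> R.
  by move/le_trans; apply; rewrite gerBl invr_ge0.
have J0 : 0 < J.+1%:R :> R by [].
elim: J' JJ' => // J' IH; rewrite ltnS leq_eqVlt => /orP[/eqP <-|JJ'].
  rewrite big_nat1 -exprVn; have : 0 <= J.+1%:R^-1 :> R by rewrite invr_ge0.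
  have : J.+1%:R^-1 <= 1 :> R by rewrite invf_le1 // ler1n.
  by move: (J.+1%:R^-1) => x; nra.
have J'0 : 0 < J'%:R :> R by rewrite ltr0n; exact: leq_ltn_trans JJ'.
suff H : (J'.+1%:R ^+ 2)^-1 <= J'%:R^-1 - J'.+1%:R^-1 :> R.
  rewrite big_nat_recr ?(leqW JJ') //=; apply: le_trans (lerD (IH JJ') H) _.
  by move: (2 / _) (J'%:R^-1) (J'.+1%:R^-1) => a b c; lra.
rewrite -natr1; move: (J'%:R : R) J'0 => x x0.
have x1 : 0 < x + 1 by lra.
have -> : x^-1 - (x + 1)^-1 = (x * (x + 1))^-1 by field; rewrite !gt_eqF.
by rewrite lef_pV2 ?posrE ?exprn_gt0 ?mulr_gt0 //; nra.
Qed.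

Definition zpart (J : nat) : R := \sum_(1 <= j < J.+1) (j%:R ^+ 3)^-1.

Lemma inv_cube_le_sq (j : nat) : (0 < j)%N -> (j%:R ^+ 3)^-1 <= (j%:R ^+ 2)^-1 :> R.
Proof.
move=> j0; rewrite lef_pV2 ?posrE ?exprn_gt0 ?ltr0n //.
by rewrite exprS ler_peMl ?sqr_ge0 // ler1n.
Qed.

Lemma zpart_tail (J J' : nat) : (J <= J')%N -> 0 <= zpart J' - zpart J <= 2 / J.+1%:R.
Proof.
move=> JJ'; rewrite /zpart (@big_cat_nat _ _ _ J.+1 1 J'.+1) //= addrAC subrr add0r.
apply/andP; split; first by apply: sumr_ge0 => j _; rewrite invr_ge0 exprn_ge0.
apply: le_trans (inv_sq_tail J J'); rewrite !big_nat; apply: ler_sum => j /andP[j1 _].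
by apply: inv_cube_le_sq; exact: leq_ltn_trans j1.
Qed.

Lemma zeta_tail (J : nat) : 0 <= zeta (3 : R) - zpart J <= 2 / J.+1%:R.
Proof.
have E : series (fun k : nat => k.+1%:R `^ (- 3)) = zpart :> (nat -> R).
  apply/funext => n; rewrite /series /= /zpart big_add1 /=.
  by apply: eq_bigr => k _; rewrite powR_invn.
rewrite /zeta E.
have nd : nondecreasing_seq zpart.
  by move=> i j ij; rewrite -subr_ge0; case/andP: (zpart_tail ij).
have ub n : zpart n <= zpart J + 2 / J.+1%:R.
  have [nJ|Jn] := leqP n J.
    by apply: le_trans (nd _ _ nJ) _; rewrite lerDl divr_ge0.
  by rewrite -lerBlDl; case/andP: (zpart_tail (ltnW Jn)).
have cv : cvgn zpart.
  by apply: nondecreasing_is_cvgn => //; exists (zpart J + 2 / J.+1%:R) => _ [n _ <-].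
apply/andP; split.
  by rewrite subr_ge0; exact: nondecreasing_cvgn_le.
rewrite lerBlDl; apply: limr_le => //; exact: nearW.
Qed.

Lemma zeta3_ge1 : 1 <= zeta (3 : R).
Proof.
have := zeta_tail 1; rewrite /zpart big_nat1 expr1n invr1 => /andP[h _]; lra.
Qed.

Definition Zmu (N : nat) : R := \sum_(1 <= k < N.+1) (mu k)%:~R / k%:R ^+ 3.
Definition Zodd (N : nat) : R := \sum_(1 <= k < N.+1 | odd k) (mu k)%:~R / k%:R ^+ 3.

Lemma norm_muR (k : nat) : `|(mu k)%:~R| <= 1 :> R.
Proof. by rewrite -intr_norm (ler_int _ _ 1) norm_mu. Qed.

Lemma ceil_div_bound (k N : nat) : (0 < k)%N -> (N %/ k).+1%:R^-1 <= k%:R / N.+1%:R :> R.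
Proof.
move=> k0; rewrite ler_pdivlMr // mulrC ler_pdivrMr // -natrM ler_nat mulnC.
exact: ltn_ceil.
Qed.

(** Grouping the products [k j <= N] by their value, [sum_mu] makes the sum of
    [mu(k)/k^3 * zpart (N/k)] exactly 1. Replacing [zpart (N/k)] by [zeta(3)] costs [2 k/(N + 1)],
    and the sum of [2/k^2] is at most 4. *)
Lemma Zmu_zeta (N : nat) : `|Zmu N - (zeta (3 : R))^-1| <= 4 / N.+1%:R.
Proof.
have z1 := zeta3_ge1; set z := zeta _ in z1 *; have z0 : 0 < z by lra.
suff H : `|Zmu N * z - 1| <= 4 / N.+1%:R.
  have -> : Zmu N - z^-1 = (Zmu N * z - 1) / z by field; rewrite gt_eqF.
  rewrite normrM [`|z^-1|]gtr0_norm ?invr_gt0 //; apply: le_trans H.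
  by rewrite ler_piMr // invf_le1.
have [->|N0] := posnP N; first by rewrite /Zmu big_geq // mul0r sub0r normrN normr1; lra.
have one : \sum_(1 <= k < N.+1) (mu k)%:~R / k%:R ^+ 3 * zpart (N %/ k) = 1.
  transitivity (\sum_(1 <= n < N.+1) \sum_(1 <= k < N.+1 | (k %| n)%N) (mu k)%:~R / (n%:R : R) ^+ 3).
    rewrite [RHS](exchange_big_dep xpredT) //= !big_nat; apply: eq_bigr => k /andP[k1 _].
    rewrite sum_multiples // /zpart mulr_sumr; apply: eq_bigr => j _.
    by rewrite natrM exprMn -mulrA -invfM [X in _ / X = _]mulrC.
  transitivity (\sum_(1 <= n < N.+1) ((n == 1%N)%:R / (n%:R : R) ^+ 3)).
    rewrite !big_nat; apply: eq_bigr => n /andP[n1 nN].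
    rewrite -mulr_suml -(rmorph_sum intr) /=; congr (_ / _).
    transitivity (((n == 1%N)%:R : int)%:~R : R); last by rewrite rmorph_nat.
    rewrite -sum_mu //; congr (_%:~R).
    rewrite (@big_cat_nat _ _ _ n.+1) //= [X in _ + X]big_nat_cond [X in _ + X]big1 ?addr0 //.
    move=> k /andP[/andP[nk _] kn]; have := dvdn_leq n1 kn; by rewrite leqNgt nk.
  rewrite big_ltn // eqxx expr1n divr1 big_nat big1 ?addr0 // => n /andP[n2 _].
  by rewrite gtn_eqF // mul0r.
rewrite -[X in `|_ - X|]one /Zmu mulr_suml -sumrB; apply: le_trans (ler_norm_sum _ _ _) _.
apply: le_trans (_ : \sum_(1 <= k < N.+1) (2 / N.+1%:R * (k%:R ^+ 2)^-1) <= _).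
  rewrite !big_nat; apply: ler_sum => k /andP[k1 _].
  have kR : 0 < k%:R :> R by rewrite ltr0n.
  have /andP[t0 t1] := zeta_tail (N %/ k); rewrite -/z in t0 t1.
  rewrite -mulrBr !normrM (ger0_norm t0) [`|_^-1|]ger0_norm ?invr_ge0 ?exprn_ge0 //.
  apply: le_trans (_ : 1 / k%:R ^+ 3 * (2 * (k%:R / N.+1%:R)) <= _).
    apply: ler_pM.
    - by rewrite mulr_ge0 ?normr_ge0 // invr_ge0 exprn_ge0.
    - exact: t0.
    - by rewrite ler_wpM2r ?norm_muR // invr_ge0 exprn_ge0.
    - by apply: le_trans t1 _; rewrite ler_wpM2l // ceil_div_bound.
  have nz : N.+1%:R != 0 :> R by [].
  rewrite le_eqVlt; apply/orP; left; apply/eqP.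
  by move: (N.+1%:R) nz => y nz; field; rewrite nz gt_eqF.
rewrite -mulr_sumr; apply: le_trans (ler_wpM2l _ (inv_sq_tail 0 N)) _.
  by rewrite divr_ge0.
by rewrite divr1 mulrAC (_ : 2 * 2 = 4 :> R) //; ring.
Qed.

(** An even [k = 2 j] contributes only for odd [j], and then [-mu(j)/(8 j^3)]. *)
Lemma Zodd_rec (N : nat) : Zmu N = Zodd N - Zodd (N %/ 2) / 8.
Proof.
rewrite /Zmu (bigID odd) /=; congr (_ + _).
rewrite (eq_bigl (fun k => (2 %| k)%N)); last by move=> k; rewrite dvdn2.
rewrite sum_multiples // /Zodd big_mkcond /= mulr_suml -sumrN [RHS]big_mkcond /=.
rewrite !big_nat; apply: eq_bigr => j /andP[j1 _].
rewrite mulnC; case: ifP => oj; last by rewrite mu_prime_dvd ?dvdn2 ?oj // mul0r.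
rewrite mu_primeM ?dvdn2 ?oj // rmorphN natrM /=.
by field; rewrite pnatr_eq0 -lt0n.
Qed.

(** The recursion restores the missing Euler factor at 2, [1/(1 - 1/8) = 8/7]. The constant 6 is
    stable under it because [4 + 6 * 2/8 <= 6]. *)
Lemma Zodd_zeta (N : nat) : `|Zodd N - 8 / 7 / zeta (3 : R)| <= 6 / N.+1%:R.
Proof.
have [k] := ubnP N; elim: k N => // k IH N; rewrite ltnS => Nk.
have z1 := zeta3_ge1; set z := zeta _ in z1 *; have z0 : 0 < z by lra.
have [->|N0] := posnP N.
  rewrite /Zodd big_geq // sub0r normrN.
  have zi : 0 <= z^-1 <= 1 by rewrite invr_ge0 invf_le1 // z1 ltW.
  by rewrite ger0_norm; case/andP: zi; lra.
have := IH (N %/ 2)%N (leq_trans (ltn_Pdiv _ N0) Nk) => /(_ isT).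
have := Zmu_zeta N; rewrite Zodd_rec -/z => h1 h2.
have -> : Zodd N - 8 / 7 / z = (Zodd N - Zodd (N %/ 2) / 8 - z^-1) + (Zodd (N %/ 2) - 8 / 7 / z) / 8.
  by field; rewrite gt_eqF.
apply: le_trans (ler_normD _ _) _; rewrite normrM [`|8^-1|]ger0_norm //.
have := ceil_div_bound N (isT : (0 < 2)%N).
have : 0 <= N.+1%:R^-1 :> R by rewrite invr_ge0.
move: h1 h2; move: (N.+1%:R^-1) ((N %/ 2).+1%:R^-1) => y y'.
by move: `|_| `|_| => u v; lra.
Qed.

(* [sigma_(-2)(m)] as a real number. *)
Definition s2 (m : nat) : R := \sum_(1 <= e < m.+1 | (e %| m)%N) (e%:R ^+ 2)^-1.

(* The value of the singular series [\sum_D lam l D / D^2]. *)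
Definition sing (l : nat) : R :=
  if odd l then 2 / 7 * s2 l / zeta (3 : R)
  else if (4 %| l)%N then s2 (l %/ 4) / 2 / zeta (3 : R) else 0.

(** Writing [D = k e] separates the divisor [e] of [m] from the Moebius sum over [k]. The condition
    on [P] transfers it from [D] to [k]; it holds for [odd] when [m] is odd. *)
Lemma sum_dlam_series (m M : nat) (P : pred nat) :
  (0 < m)%N -> (m <= M)%N -> (forall e k, (e %| m)%N -> P (k * e)%N = P k) ->
  \sum_(1 <= D < M.+1 | P D) (dlam m D)%:~R / D%:R / D%:R ^+ 2 =
  \sum_(1 <= e < m.+1 | (e %| m)%N) (e%:R ^+ 2)^-1 *
    \sum_(1 <= k < (M %/ e).+1 | P k) (mu k)%:~R / k%:R ^+ 3 :> R.
Proof.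
move=> m0 mM HP.
transitivity (\sum_(1 <= D < M.+1 | P D) \sum_(1 <= e < m.+1 | (e %| m)%N)
   (if (e %| D)%N then e%:R * (mu (D %/ e))%:~R / D%:R ^+ 3 else 0 : R)).
  rewrite big_nat_cond [RHS]big_nat_cond; apply: eq_bigr => D /andP[/andP[D1 _] _].
  rewrite -big_mkcondr /= /dlam rmorph_sum /= !mulr_suml.
  pose N := (maxn D m).+1.
  (* Both sums over common divisors of [D] and [m] are brought to one range; their bounds [D] and
     [m] are not comparable. *)
  have EN (X : nat -> R) B : (0 < B)%N -> (B.+1 <= N)%N ->
     (forall e, (e %| D)%N && (e %| m)%N -> (e <= B)%N) ->
     \sum_(1 <= e < B.+1 | (e %| D)%N && (e %| m)%N) X e =
     \sum_(1 <= e < N | (e %| D)%N && (e %| m)%N) X e.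
    move=> B0 BN h; rewrite [RHS](@big_cat_nat _ _ _ B.+1) //=.
    rewrite [X in _ = _ + X]big_nat_cond [X in _ = _ + X]big1 ?addr0 //.
    by move=> e /andP[/andP[Be _] /h]; rewrite leqNgt Be.
  rewrite EN ?ltnS ?leq_maxl //; last by move=> e /andP[/(dvdn_leq D1)].
  rewrite (eq_bigl (fun e => (e %| D)%N && (e %| m)%N) _ (fun e => andbC (e %| m)%N _)).
  rewrite [RHS]EN ?ltnS ?leq_maxr //; last by move=> e /andP[_ /(dvdn_leq m0)].
  apply: eq_bigr => e _; rewrite rmorphM /=; field; by rewrite pnatr_eq0 -lt0n.
rewrite exchange_big /= big_nat_cond [RHS]big_nat_cond; apply: eq_bigr => e /andP[/andP[e1 _] em].
rewrite -big_mkcondr /= (eq_bigl (fun i => (e %| i)%N && P i)); last by move=> i; rewrite andbC.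
rewrite big_mkcondr sum_multiples // mulr_sumr [RHS]big_mkcond !big_nat.
apply: eq_bigr => k /andP[k1 _]; rewrite HP //; case: ifP => // _.
by rewrite mulnK // natrM; field; rewrite !pnatr_eq0 -!lt0n k1.
Qed.

(** The inner sum at [e] stops at [M/e], with error [O(e/M)]. The weight [1/e^2] makes this [O(1/M)]
    for each divisor, hence the factor [tau l]. *)
Lemma singular_series (l M : nat) : (0 < l)%N -> (l <= M)%N ->
  `|\sum_(1 <= D < M.+1) lam R l D / D%:R ^+ 2 - sing l| <= 2 * (tau l)%:R / M.+1%:R.
Proof.
move=> l0 lM.
have key (m : nat) (P : pred nat) (z C : R) : (0 < m)%N -> (m <= M)%N -> 0 <= C ->
  (forall e k, (e %| m)%N -> P (k * e)%N = P k) ->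
  (forall N, `|\sum_(1 <= k < N.+1 | P k) (mu k)%:~R / k%:R ^+ 3 - z| <= C / N.+1%:R) ->
  `|\sum_(1 <= D < M.+1 | P D) (dlam m D)%:~R / D%:R / D%:R ^+ 2 - s2 m * z| <= C * (tau m)%:R / M.+1%:R.
  move=> m0 mM C0 HP Hz; rewrite sum_dlam_series // /s2 mulr_suml -sumrB.
  apply: le_trans (ler_norm_sum _ _ _) _; rewrite tau_sum // mulr_sumr mulr_suml.
  rewrite big_nat_cond [leRHS]big_nat_cond; apply: ler_sum => e /andP[/andP[e1 _] em].
  rewrite -mulrBr normrM [`|_^-1|]ger0_norm ?invr_ge0 ?sqr_ge0 //.
  have e0 : 0 < e%:R :> R by rewrite ltr0n.
  have e1R : 1 <= e%:R :> R by rewrite ler1n.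
  apply: le_trans (ler_wpM2l _ (Hz _)) _; first by rewrite invr_ge0 sqr_ge0.
  apply: le_trans (_ : (e%:R ^+ 2)^-1 * (C * (e%:R / M.+1%:R)) <= _).
    by rewrite ler_wpM2l ?invr_ge0 ?sqr_ge0 // ler_wpM2l // ceil_div_bound.
  rewrite mulr1 mulrCA; apply: ler_wpM2l => //.
  rewrite mulrA ler_piMl ?invr_ge0 // expr2 invfM -mulrA mulVf ?gt_eqF // mulr1.
  by rewrite invf_le1.
have ttau m : (0 < m)%N -> (m %| l)%N -> (tau m)%:R <= (tau l)%:R :> R.
  move=> m0 ml; rewrite ler_nat /tau; apply: uniq_leq_size; first exact: divisors_uniq.
  by move=> d; rewrite -!dvdn_divisors // => dm; exact: dvdn_trans ml.
have M0 : 0 <= M.+1%:R^-1 :> R by rewrite invr_ge0.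
rewrite /sing /lam; have [ol|el] := boolP (odd l).
  have := key l odd (8 / 7 / zeta (3 : R)) 6 l0 lM (ler0n _ _) _ Zodd_zeta.
  have HP e k : (e %| l)%N -> odd (k * e) = odd k.
    by move=> el; move: ol; rewrite -(divnK el) !oddM => /andP[_ ->]; rewrite andbT.
  move=> /(_ HP); set T := \sum_(1 <= D < _ | _) _.
  have -> : \sum_(1 <= D < M.+1) (if odd D then (dlam l D)%:~R / D%:R / 4 else 0) / D%:R ^+ 2 = T / 4 :> R.
    rewrite /T mulr_suml [RHS]big_mkcond; apply: eq_bigr => D _.
    by case: ifP => _; rewrite ?mul0r // mulrAC.
  have -> : T / 4 - 2 / 7 * s2 l / zeta (3 : R) = (T - s2 l * (8 / 7 / zeta (3 : R))) / 4.
    by field; rewrite gt_eqF // (lt_le_trans ltr01 zeta3_ge1).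
  rewrite normrM [`|4^-1|]ger0_norm // => h.
  have := mulr_ge0 (ler0n R (tau l)) M0.
  move: h; move: (M.+1%:R^-1) `|_| ((tau l)%:R : R) => y u t; lra.
have [l4|l4] := boolP (4 %| l)%N; last first.
  rewrite big1 ?subrr ?normr0 ?mulr_ge0 // => D _; by rewrite mul0r.
have m0 : (0 < l %/ 4)%N by rewrite divn_gt0 // dvdn_leq.
have mM : (l %/ 4 <= M)%N by exact: leq_trans (leq_div _ _) lM.
have := key (l %/ 4)%N xpredT (zeta (3 : R))^-1 4 m0 mM (ler0n _ _) (fun _ _ _ => erefl) Zmu_zeta.
set T := \sum_(1 <= D < _) _.
have -> : \sum_(1 <= D < M.+1) (dlam (l %/ 4) D)%:~R / D%:R / 2 / D%:R ^+ 2 = T / 2 :> R.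
  by rewrite /T mulr_suml; apply: eq_bigr => D _; rewrite mulrAC.
have -> : T / 2 - s2 (l %/ 4) / 2 / zeta (3 : R) = (T - s2 (l %/ 4) * (zeta (3 : R))^-1) / 2.
  by ring.
rewrite normrM [`|2^-1|]ger0_norm // => h.
have := ler_wpM2r M0 (ttau _ m0 (dvdn_div l4)).
have := mulr_ge0 (ler0n R (tau l)) M0.
by move: h; move: (M.+1%:R^-1) `|_| ((tau l)%:R : R) ((tau _)%:R : R) => y u t t'; lra.
Qed.

Lemma s2_bounds (m : nat) : 0 <= s2 m <= 2.
Proof.
apply/andP; split; first by apply: sumr_ge0 => e _; rewrite invr_ge0 exprn_ge0.
apply: le_trans (_ : \sum_(1 <= e < m.+1) (e%:R ^+ 2)^-1 <= _).
  rewrite /s2 big_mkcond; by apply: ler_sum => e _; case: ifP.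
by apply: le_trans (inv_sq_tail 0 m) _; rewrite divr1.
Qed.

Lemma sing_bounds (l : nat) : 0 <= sing l <= 1.
Proof.
have z1 := zeta3_ge1; rewrite /sing.
have [s0 s2'] := andP (s2_bounds l); have [t0 t2] := andP (s2_bounds (l %/ 4)).
have b (x : R) : 0 <= x <= 1 -> 0 <= x / zeta (3 : R) <= 1.
  move=> /andP[x0 x1]; have z0 : 0 < zeta (3 : R) by apply: lt_le_trans z1.
  apply/andP; split; first by rewrite divr_ge0 // ltW.
  by rewrite ler_pdivrMr // mul1r; exact: le_trans x1 z1.
case: ifP => _; first by apply: b; apply/andP; split; lra.
by case: ifP => _; [apply: b; apply/andP; split; lra|rewrite lexx ler01].
Qed.

End Zeta.

(** * Reduction of forms *)

Section Forms.
Implicit Types f g : bqf.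

(** From here on forms and substitutions are handled by their integer entries instead of
    matrices. *)
Definition qv f (x y : int) : int := qa f * x ^+ 2 + qb f * x * y + qc f * y ^+ 2.

Definition qsubst f (p q r s : int) : bqf :=
  BQF (qv f p r) (2 * qa f * p * q + qb f * (p * s + q * r) + 2 * qc f * r * s) (qv f q s).

Definition col2 (x y : int) : 'cV[int]_2 := \col_i (if i == ord0 then x else y).

Lemma col2K (v : 'cV[int]_2) : v = col2 (v ord0 ord0) (v ord_max ord0).
Proof.
apply/colP => i; rewrite !mxE; case: eqP => [->//|/eqP i0].
congr (v _ _); apply/val_inj => /=; case: i i0 => -[|[|//]] //.
Qed.

Lemma qf_eval_col2 f x y : qf_eval f (col2 x y) = qv f x y.
Proof. by rewrite /qf_eval !mxE. Qed.

Lemma mul_col2 (M : 'M[int]_2) x y : M *m col2 x y =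
  col2 (M ord0 ord0 * x + M ord0 ord_max * y) (M ord_max ord0 * x + M ord_max ord_max * y).
Proof.
rewrite [LHS]col2K; congr col2; rewrite !mxE big_ord_recl big_ord1 !mxE /=;
  by congr (_ + M _ _ * _); apply/val_inj.
Qed.

Lemma qv_qsubst f p q r s x y :
  qv (qsubst f p q r s) x y = qv f (p * x + q * y) (r * x + s * y).
Proof. rewrite /qv /qsubst /qv /=; ring. Qed.

Lemma bqf_ext f g : (forall x y, qv f x y = qv g x y) -> f = g.
Proof.
case: f g => a b c [a' b' c'] h.
have h1 := h 1 0; have h2 := h 0 1; have h3 := h 1 1.
rewrite /qv /= in h1 h2 h3; have ? : a = a' by lia. have ? : c = c' by lia.
have ? : b = b' by lia. by subst.
Qed.

Lemma det_mx2 (M : 'M[int]_2) :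
  \det M = M ord0 ord0 * M ord_max ord_max - M ord0 ord_max * M ord_max ord0.
Proof.
rewrite (expand_det_row M ord0) big_ord_recl big_ord1 /cofactor !det_mx11 !mxE /= !expr0 !expr1.
rewrite mul1r mulN1r mulrN; congr (_ * M _ _ - M _ _ * M _ _); exact/val_inj.
Qed.

Lemma sl2_equivP f g : sl2_equiv f g <->
  exists p q r s, p * s - q * r = 1 /\ g = qsubst f p q r s.
Proof.
split=> [[M [dM h]]|[p [q [r [s [d ->]]]]]].
  exists (M ord0 ord0), (M ord0 ord_max), (M ord_max ord0), (M ord_max ord_max).
  split; first by rewrite -det_mx2.
  apply: bqf_ext => x y; rewrite qv_qsubst -qf_eval_col2 -h mul_col2 qf_eval_col2.
  by congr qv; ring.
exists (\matrix_(i, j) (if i == ord0 then (if j == ord0 then p else q)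
   else (if j == ord0 then r else s))); split.
  by rewrite det_mx2 !mxE.
by move=> v; rewrite (col2K v) mul_col2 !qf_eval_col2 !mxE /= qv_qsubst.
Qed.

Lemma qsubst_comp f p q r s p' q' r' s' :
  qsubst (qsubst f p q r s) p' q' r' s' =
  qsubst f (p * p' + q * r') (p * q' + q * s') (r * p' + s * r') (r * q' + s * s').
Proof. by apply: bqf_ext => x y; rewrite !qv_qsubst; congr qv; ring. Qed.

Lemma qsubst_id f : qsubst f 1 0 0 1 = f.
Proof. by apply: bqf_ext => x y; rewrite qv_qsubst; congr qv; ring. Qed.

Lemma sl2_equiv_refl f : sl2_equiv f f.
Proof. by apply/sl2_equivP; exists 1, 0, 0, 1; rewrite qsubst_id; split. Qed.

Lemma sl2_equiv_trans f g h : sl2_equiv f g -> sl2_equiv g h -> sl2_equiv f h.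
Proof.
move=> /sl2_equivP[p [q [r [s [d ->]]]]] /sl2_equivP[p' [q' [r' [s' [d' ->]]]]].
apply/sl2_equivP; rewrite qsubst_comp; do 4 eexists; split; last by [].
by transitivity ((p * s - q * r) * (p' * s' - q' * r')); [ring|rewrite d d'].
Qed.

Lemma sl2_equiv_sym f g : sl2_equiv f g -> sl2_equiv g f.
Proof.
move=> /sl2_equivP[p [q [r [s [d ->]]]]]; apply/sl2_equivP.
exists s, (- q), (- r), p; split; first by rewrite -d; ring.
rewrite qsubst_comp -[LHS]qsubst_id; congr qsubst; rewrite -?d; ring.
Qed.

Lemma form_class_eq f g : sl2_equiv f g -> form_class f = form_class g.
Proof.
move=> fg; apply/seteqP; split => h /=; rewrite /form_class /=.
  exact: sl2_equiv_trans (sl2_equiv_sym fg).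
exact: sl2_equiv_trans.
Qed.

Lemma form_class_equiv f g : form_class f = form_class g -> sl2_equiv f g.
Proof.
move=> fg; have : form_class g g by exact: sl2_equiv_refl.
by rewrite -fg.
Qed.

Lemma disc_qsubst f p q r s : p * s - q * r = 1 -> disc (qsubst f p q r s) = disc f.
Proof.
move=> d; rewrite /disc /qsubst /qv /=.
by transitivity ((p * s - q * r) ^+ 2 * (qb f ^+ 2 - 4 * qa f * qc f)); [ring|rewrite d expr1n mul1r].
Qed.

Lemma posdefP f : posdef f <-> (forall x y, (x != 0) || (y != 0) -> 0 < qv f x y).
Proof.
split=> h => [x y xy|v v0].
  rewrite -qf_eval_col2; apply: h; apply: contraL xy => /eqP/colP e.
  by have := e ord0; have := e ord_max; rewrite !mxE /= => -> ->.
rewrite (col2K v) qf_eval_col2; apply: h; apply: contraNT v0.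
rewrite negb_or !negbK => /andP[/eqP e1 /eqP e2]; apply/eqP; rewrite (col2K v) e1 e2.
by apply/colP => i; rewrite !mxE if_same.
Qed.

Lemma posdef_equiv f g : sl2_equiv f g -> posdef f -> posdef g.
Proof.
move=> /sl2_equivP[p [q [r [s [d ->]]]]] /posdefP h; apply/posdefP => x y xy.
rewrite qv_qsubst; apply: h; apply: contraLR xy; rewrite !negb_or !negbK => /andP[/eqP e1 /eqP e2].
have hx : x = s * (p * x + q * y) - q * (r * x + s * y).
  by rewrite -[LHS]mul1r -d; ring.
have hy : y = p * (r * x + s * y) - r * (p * x + q * y).
  by rewrite -[LHS]mul1r -d; ring.
by apply/andP; split; apply/eqP; [rewrite hx|rewrite hy]; rewrite e1 e2 !mulr0 subrr.
Qed.

(** No sign convention is imposed when [|b| = a] or [a = c], so a class may contain several such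
    forms. Uniqueness is claimed only for the open region [sreduced], and the rest is counted as an
    error. *)
Definition reduced f : Prop := [/\ 0 < qa f, `|qb f| <= qa f & qa f <= qc f].

Lemma qv_lower f x y :
  (2 * qa f - `|qb f|) * x ^+ 2 + (2 * qc f - `|qb f|) * y ^+ 2 <= 2 * qv f x y.
Proof.
have h : - (`|qb f| * (x ^+ 2 + y ^+ 2)) <= 2 * (qb f * (x * y)).
  have h1 : 2 * `|x * y| <= x ^+ 2 + y ^+ 2.
    rewrite normrM -(real_normK (num_real x)) -(real_normK (num_real y)).
    by have := sqr_ge0 (`|x| - `|y|); rewrite !expr2; move: `|x| `|y| => u v; lia.
  have h2 : - (`|qb f| * `|x * y|) <= qb f * (x * y) by rewrite -normrM lerNl -normrN ler_norm.
  have h3 := ler_wpM2l (normr_ge0 (qb f)) h1; rewrite mulrCA in h3.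
  move: (`|qb f| * `|x * y|) (qb f * (x * y)) (`|qb f| * (x ^+ 2 + y ^+ 2)) h2 h3 => u v z.
  by lia.
by rewrite /qv; move: h; lia.
Qed.

Lemma sqr_ge1 (x : int) : x != 0 -> 1 <= x ^+ 2.
Proof. by move=> x0; have : 0 < x ^+ 2 by rewrite exprn_even_gt0. Qed.

Lemma reduced_qv_ge f x y : reduced f -> (x != 0) || (y != 0) -> qa f <= qv f x y.
Proof.
move=> [a0 ba ac] xy; have := qv_lower f x y.
have [x0|x0] := eqVneq x 0.
  move: xy; rewrite x0 eqxx /= => /sqr_ge1 y1 _.
  have -> : qv f 0 y = qc f * y ^+ 2 by rewrite /qv; ring.
  by move: (y ^+ 2) y1 => Y Y1; nia.
have [y0|y0] := eqVneq y 0.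
  rewrite y0 => _; have -> : qv f x 0 = qa f * x ^+ 2 by rewrite /qv; ring.
  by move: (x ^+ 2) (sqr_ge1 x0) => X X1; nia.
move: (x ^+ 2) (y ^+ 2) (sqr_ge1 x0) (sqr_ge1 y0) `|qb f| ba => X Y X1 Y1 B Ba.
by nia.
Qed.

Lemma reduced_posdef f : reduced f -> posdef f.
Proof.
by move=> rf; apply/posdefP => x y xy; apply: lt_le_trans (reduced_qv_ge rf xy); case: rf.
Qed.

Lemma equiv_shift f (k : int) :
  sl2_equiv f (BQF (qa f) (qb f + 2 * k * qa f) (qa f * k ^+ 2 + qb f * k + qc f)).
Proof.
apply/sl2_equivP; exists 1, k, 0, 1; split; first by ring.
by rewrite /qsubst /qv; congr BQF; ring.
Qed.

Lemma equiv_swap f : sl2_equiv f (BQF (qc f) (- qb f) (qa f)).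
Proof.
apply/sl2_equivP; exists 0, (- 1), 1, 0; split; first by ring.
by rewrite /qsubst /qv; congr BQF; ring.
Qed.

Lemma posdef_qa f : posdef f -> 0 < qa f.
Proof. by move=> /posdefP /(_ 1 0 isT); have -> : qv f 1 0 = qa f by rewrite /qv; ring. Qed.

(** Gauss reduction: a shift makes [|b| <= a], and if then [c < a], a swap lowers the leading
    coefficient. *)
Lemma exists_reduced f : posdef f -> exists2 g, sl2_equiv f g & reduced g.
Proof.
have [n] := ubnP `|qa f|%N; elim: n f => // n IH f; rewrite ltnS => fn pf.
have a0 := posdef_qa pf.
(* This [k] brings [b + 2 k a] into the interval from [-a] to [a]. *)
pose k := - ((qb f + qa f) %/ (2 * qa f))%Z.
have fg := equiv_shift f k; set g := BQF _ _ _ in fg.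
have pg := posdef_equiv fg pf.
have bg : `|qb g| <= qa g.
  have e := divz_eq (qb f + qa f) (2 * qa f).
  have m0 : 0 <= ((qb f + qa f) %% (2 * qa f))%Z by apply: modz_ge0; lia.
  have m1 : ((qb f + qa f) %% (2 * qa f))%Z < 2 * qa f by apply: ltz_pmod; lia.
  by rewrite /g /k /=; move: (_ %/ _)%Z (_ %% _)%Z e m0 m1 => u v e m0 m1; rewrite ler_norml; apply/andP; split; lia.
have [ac|ca] := lerP (qa g) (qc g).
  by exists g => //; split=> //; exact: posdef_qa pg.
have gs := equiv_swap g; have ps := posdef_equiv gs pg.
have c0 : 0 < qc g := posdef_qa ps.
have ga : qa g = qa f by [].
rewrite ga in ca.
have lt : (`|qa (BQF (qc g) (- qb g) (qa g))| < n)%N.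
  by change (`|qc g| < n)%N; move: (qc g) ca c0 => c ca c0; lia.
have [h gh rh] := IH _ lt ps.
exists h => //; exact: sl2_equiv_trans (sl2_equiv_trans fg gs) gh.
Qed.

Definition sreduced f : Prop := [/\ 0 < `|qb f|, `|qb f| < qa f & qa f < qc f].

(** For [sreduced f] the minimum [a] is attained only at the vectors [(1, 0)] and [(-1, 0)], which
    forces [r = 0] and [p = s]. Then [b] changes by a multiple of [2 a], impossible for [|b| < a]
    and [|b'| <= a] unless that multiple is 0. *)
Lemma sreduced_unique f g : sreduced f -> reduced g -> sl2_equiv f g -> f = g.
Proof.
move=> [b0 ba ac] [a'0 b'a' a'c'] fg; have gf := sl2_equiv_sym fg.
have /sl2_equivP[p' [q' [r' [s' [d' fE]]]]] := gf.
have /sl2_equivP[p [q [r [s [d gE]]]]] := fg.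
have aa' : qa g <= qa f.
  have -> : qa f = qv g p' r' by rewrite fE.
  have : (p' != 0) || (r' != 0).
    by apply/orP; have [e1|] := eqVneq p' 0; [right|left] => //; apply/eqP => e2; move: d'; rewrite e1 e2; lia.
  move=> pr.
  by apply: reduced_qv_ge.
have b1 : - qa f < qb f < qa f by rewrite -ltr_norml.
have a0 : 0 < qa f by lia.
have r0 : r = 0.
  apply/eqP/negPn/negP => rn0.
  have : qa f < qa g.
    have := qv_lower f p r; rewrite gE /=.
    have [p0|p0] := eqVneq p 0.
      rewrite p0; have -> : qv f 0 r = qc f * r ^+ 2 by rewrite /qv; ring.
      by move: (r ^+ 2) (sqr_ge1 rn0) => Y Y1 _; nia.
    move: (p ^+ 2) (r ^+ 2) (sqr_ge1 p0) (sqr_ge1 rn0) `|qb f| b0 ba => X Y X1 Y1 B B0 Ba.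
    by nia.
  by rewrite ltNge aa'.
have ga : qa g = qa f * p ^+ 2 by rewrite gE /= /qv r0; ring.
have ps : p * s = 1 by rewrite -d r0; ring.
have p0 : p != 0 by apply/eqP => p0; move: ps; rewrite p0 mul0r.
have p1 : p ^+ 2 = 1 by move: (p ^+ 2) (sqr_ge1 p0) ga aa' a0 => X X1 -> h a0; nia.
have sp : s = p by rewrite -[s]mul1r -p1 expr2 -mulrA ps mulr1.
have gaE : qa g = qa f by rewrite ga p1 mulr1.
have gbE : qb g = qb f + 2 * qa f * (p * q).
  have e : p * p = 1 by rewrite -expr2.
  rewrite gE /= r0 sp; transitivity (2 * qa f * (p * q) + qb f * (p * p)); first by ring.
  by rewrite e; ring.
have q0 : p * q = 0.
  move: b'a'; rewrite gaE gbE ler_norml => /andP[h1 h2]; case/andP: b1 => h3 h4.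
  by move: (p * q) h1 h2 => t h1 h2; nia.
have qq0 : q = 0 by move/eqP: q0; rewrite mulf_eq0 (negPf p0) => /eqP.
apply: bqf_ext => x y; rewrite gE qv_qsubst qq0 r0 sp /qv.
have e : p * p = 1 by rewrite -expr2.
transitivity (qa f * (p * p) * x ^+ 2 + qb f * (p * p) * x * y + qc f * (p * p) * y ^+ 2).
  by rewrite e !mulr1.
by ring.
Qed.

End Forms.

(** * Class numbers *)

(** Each element is determined by a label from a fixed list and a divisor of [n]. *)
Lemma card_le_divisors (T : finType) (A : pred T) (K : seq nat) (n : nat) (k f : T -> nat) :
  (0 < n)%N -> (forall x, A x -> (f x %| n)%N) -> (forall x, A x -> k x \in K) ->
  {in A &, forall x y, k x = k y -> f x = f y -> x = y} -> (#|A| <= size K * tau n)%N.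
Proof.
move=> n0 fd kK inj; rewrite cardE -(size_map (fun x => (k x, f x))) /tau.
rewrite -(size_allpairs (fun i d : nat => (i, d))); apply: uniq_leq_size.
  rewrite map_inj_in_uniq ?enum_uniq // => x y; rewrite !mem_enum => Ax Ay [e1 e2].
  exact: inj.
move=> p /mapP[x]; rewrite mem_enum => Ax ->; apply/allpairsP; exists (k x, f x).
by rewrite kK //= -dvdn_divisors // fd.
Qed.

Section Counting.
Variable n : nat.
Hypothesis n0 : (0 < n)%N.

(** A finite type suffices: in a reduced form [4 a c = n + b^2 <= n + a c], and Selling parameters
    satisfy [A B <= n] and its rotations, so all entries are at most [n]. *)
Definition qtriple := ('I_n.+1 * 'I_n.+1 * 'I_n.+1)%type.

Definition is_reduced (t : qtriple) : bool :=
  let: (a, b, c) := t in [&& 0 < a, b <= a, a <= c & 4 * a * c == n + b * b]%N.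

Definition is_strict (t : qtriple) : bool :=
  let: (a, b, c) := t in [&& 0 < b, b < a, a < c & 4 * a * c == n + b * b]%N.

(** The triple records [|b|]; the boolean is the sign of [b]. *)
Definition form_of (t : qtriple * bool) : bqf :=
  let: (a, b, c, s) := t in BQF a%:Z (if s then b%:Z else - b%:Z) c%:Z.

Lemma strict_reduced t : is_strict t -> is_reduced t.
Proof.
by case: t => [[a b] c] /and4P[b0 ba ac e]; apply/and4P; split => //; [lia|exact: ltnW|exact: ltnW].
Qed.

Lemma form_of_reduced (t : qtriple * bool) : is_reduced t.1 ->
  reduced (form_of t) /\ disc (form_of t) = - n%:Z.
Proof.
case: t => [[[a b] c] s] /= /and4P[a0 ba ac /eqP e]; rewrite /reduced /disc /=.
by split; [split|]; rewrite ?expr2; case: s; lia.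
Qed.

Lemma form_of_strict (t : qtriple * bool) : is_strict t.1 -> sreduced (form_of t).
Proof.
by case: t => [[[a b] c] s] /= /and4P[b0 ba ac /eqP e]; split; rewrite /=; case: s; lia.
Qed.

Lemma form_of_inj (t t' : qtriple * bool) : is_strict t.1 -> form_of t = form_of t' -> t = t'.
Proof.
case: t t' => [[[a b] c] s] [[[a' b'] c'] s'] /= /and4P[b0 ba ac _] [e1 e2 e3].
have ea : a = a' by apply/val_inj => /=; lia.
have ec : c = c' by apply/val_inj => /=; lia.
have es : s = s' by move: e2; case: (s) (s') => [] [] //; lia.
have eb : b = b' by apply/val_inj; move: e2; rewrite es /=; case: (s'); lia.
by rewrite ea eb ec es.
Qed.

Lemma exists_form_of (f : bqf) : posdef f -> disc f = - n%:Z ->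
  exists2 t, is_reduced t.1 & sl2_equiv f (form_of t).
Proof.
move=> pf df; have [g fg [a0 ba ac]] := exists_reduced pf.
have dg : disc g = - n%:Z.
  by rewrite -df; have /sl2_equivP[p [q [r [s [d ->]]]]] := fg; rewrite disc_qsubst.
case: g fg a0 ba ac dg => a b c fg /= a0 ba ac; rewrite /disc /= expr2 => dg.
have [a' aE] : exists a' : nat, a = a'%:Z by exists `|a|%N; lia.
have [c' cE] : exists c' : nat, c = c'%:Z by exists `|c|%N; lia.
pose b' := `|b|%N; subst a c.
have e : (4 * a' * c' = n + b' * b')%N by rewrite /b'; nia.
have b'a : (b' <= a')%N by rewrite /b'; lia.
have a'c : (a' <= c')%N by lia.
have c'n : (c' < n.+1)%N by nia.
have a'n : (a' < n.+1)%N by lia.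
have b'n : (b' < n.+1)%N by lia.
exists (Ordinal a'n, Ordinal b'n, Ordinal c'n, 0 <= b) => /=.
  by rewrite b'a a'c e eqxx andbT; lia.
have -> : (if 0 <= b then b'%:Z else - b'%:Z) = b by rewrite /b'; case: ifP; lia.
by [].
Qed.

(* The reduced triples where several forms may share a class or have weight [< 1];
   [n] then factors as a product, which bounds their number by the divisor
   function. *)
Definition boundary (t : qtriple * bool) : bool := is_reduced t.1 && ~~ is_strict t.1.

(** There are three cases and two signs: [n = 4 a c] if [b = 0], [n = a (4 c - a)] if [b = a], and
    [n = (2 a - b)(2 a + b)] if [a = c]. The divisor recorded by [f] determines the triple within
    each case. *)
Lemma card_boundary : (#|[pred t | boundary t]| <= 6 * tau n)%N.
Proof.
pose k (t : qtriple * bool) : nat := let: (a, b, c, s) := t in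
  ((if b == 0 :> nat then 0 else if b == a :> nat then 1 else 2) * 2 + s)%N.
pose f (t : qtriple * bool) : nat := let: (a, b, c, s) := t in
  (if b == 0 :> nat then a : nat else if b == a :> nat then a : nat else 2 * a - b)%N.
apply: (@card_le_divisors _ _ (iota 0 6) n k f) => //.
- case=> [[[a b] c] s] /andP[/= /and4P[a0 ba ac /eqP e]] ns.
  have h : (a %| n + b * b)%N by rewrite -e -mulnA dvdn_mull // dvdn_mulr.
  case: eqP => b0; first by move: h; rewrite b0 addn0.
  case: eqP => [ab|ab]; first by move: h; rewrite ab dvdn_addl // dvdn_mulr.
  have ca : c = a :> nat.
    by move: ns; rewrite /is_strict /= e eqxx andbT; lia.
  by apply/dvdnP; exists (2 * a + b)%N; move: e; rewrite ca; nia.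
- case=> [[[a b] c] s] _; rewrite mem_iota /=; case: s; case: ifP => _; first by [].
  + by case: ifP.
  + by [].
  + by case: ifP.
case=> [[[a b] c] s] [[[a' b'] c'] s'] /andP[/= /and4P[a0 ba ac /eqP e]] ns
  /andP[/= /and4P[a'0 ba' ac' /eqP e']] ns'.
have ca : b != 0%N :> nat -> b != a :> nat -> c = a :> nat.
  by move: ns; rewrite /is_strict /= e eqxx andbT; lia.
have ca' : b' != 0%N :> nat -> b' != a' :> nat -> c' = a' :> nat.
  by move: ns'; rewrite /is_strict /= e' eqxx andbT; lia.
move=> ek ef.
have es : s = s' by move: ek; case: (s) (s') => [] []; lia.
suff [e1 e2 e3] : [/\ a = a' :> nat, b = b' :> nat & c = c' :> nat].
  by congr (_, _, _, _); [apply/val_inj..|].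
move: ek ef; rewrite es; case: (nat_of_ord b =P 0%N) => b0;
  case: (nat_of_ord b' =P 0%N) => b'0; case: (nat_of_ord b =P a) => ba1;
  case: (nat_of_ord b' =P a') => ba1' ek ef; try by exfalso; lia.
- by split; [|lia|]; nia.
- by split; [|lia|]; nia.
have {}ca : c = a :> nat by apply: ca; apply/eqP.
have {}ca' : c' = a' :> nat by apply: ca'; apply/eqP.
have eb : b = b' :> nat.
  set d := (2 * a - b)%N in ef; have d0 : (0 < d)%N by lia.
  have h1 : (d * (d + 2 * b) = n)%N by move: e; rewrite ca /d; nia.
  have h2 : (d * (d + 2 * b') = n)%N by move: e'; rewrite ca' ef; nia.
  have : (d * (d + 2 * b) = d * (d + 2 * b'))%N by rewrite h1 h2.
  by move/eqP; rewrite eqn_pmul2l //; lia.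
by split; lia.
Qed.

End Counting.

Lemma big_bij_on (V : Type) (z : V) (op : Monoid.com_law z) (T U : finType) (P : pred T) (Q : pred U)
    (h : T -> U) (h' : U -> T) (F : U -> V) :
  (forall t, P t -> Q (h t) /\ h' (h t) = t) -> (forall u, Q u -> P (h' u) /\ h (h' u) = u) ->
  \big[op/z]_(t | P t) F (h t) = \big[op/z]_(u | Q u) F u.
Proof.
move=> H H'; rewrite [RHS](reindex_onto h h') => [|u /H'[]//].
apply: eq_bigl => t; apply/idP/idP => [/H[-> ->]|/andP[/H'[Pt _] /eqP <-]] //=.
Qed.

Lemma card_bij_on (T U : finType) (P : pred T) (Q : pred U) (h : T -> U) (h' : U -> T) :
  (forall t, P t -> Q (h t) /\ h' (h t) = t) -> (forall u, Q u -> P (h' u) /\ h (h' u) = u) ->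
  #|P| = #|Q|.
Proof. by move=> H H'; rewrite -!sum1_card -(big_bij_on _ _ H H'). Qed.

Section ClassNumber.
Variable R : realType.
Variable n : nat.
Hypothesis n0 : (0 < n)%N.

Lemma class_weight_bounds (C : set bqf) : 0 <= class_weight R C <= 1.
Proof.
rewrite /class_weight; case: ifP => _; first by apply/andP; split; lra.
by case: ifP => _; apply/andP; split; lra.
Qed.

Lemma class_weight_strict (t : qtriple n * bool) : is_strict t.1 ->
  class_weight R (form_class (form_of t)) = 1.
Proof.
move=> st; have sf := form_of_strict n0 st; have rt := strict_reduced n0 st.
have [rf df] := form_of_reduced n0 rt.
have pf := reduced_posdef rf.
rewrite /class_weight ifF; last first.
  apply/asboolPn => -[k fk]; have k0 := posdef_qa (posdef_equiv fk pf); rewrite /= in k0.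
  have rk : reduced (BQF k 0 k) by split => //=; rewrite normr0 ltW.
  have := sreduced_unique sf rk fk; case: sf => b0 _ _ e.
  by rewrite e /= normr0 ltxx in b0.
rewrite ifF //; apply/asboolPn => -[k fk].
have k0 := posdef_qa (posdef_equiv fk pf); rewrite /= in k0.
have rk : reduced (BQF k (- k) k) by split => //=; rewrite normrN ger0_norm // ltW.
have := sreduced_unique sf rk fk; case: sf => _ ba _ e.
by rewrite e /= normrN ger0_norm ?ltxx // ltW in ba.
Qed.

(** A strict triple and its sign are recovered from their class, whose weight is 1. The remaining
    classes come from boundary triples and make up [E]. *)
Lemma hurwitz_strict : exists2 E : R, 0 <= E <= (6 * tau n)%:R &
  hurwitz R n = (2 * #|[pred t : qtriple n | is_strict t]|)%:R + E.
Proof.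
pose cl (t : qtriple n * bool) := form_class (form_of t).
pose s1 := [seq cl t | t <- enum [pred t : qtriple n * bool | is_strict t.1]].
pose s2 := undup [seq cl t | t <- enum [pred t | boundary t]].
have mem1 C : C \in s1 -> exists2 t, is_strict t.1 & C = cl t.
  by move=> /mapP[t]; rewrite mem_enum inE => ht ->; exists t.
have mem2 C : C \in s2 -> exists2 t, boundary t & C = cl t.
  by rewrite mem_undup => /mapP[t]; rewrite mem_enum inE => ht ->; exists t.
have cl_inj t t' : is_strict t.1 -> is_reduced t'.1 -> cl t = cl t' -> t = t'.
  move=> st rt' /form_class_equiv eq; apply: (form_of_inj n0 st).
  apply: sreduced_unique eq; first exact: form_of_strict n0 _ st.
  by have [] := form_of_reduced n0 rt'.
have us : uniq (s1 ++ s2).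
  rewrite cat_uniq undup_uniq andbT; apply/andP; split.
    rewrite map_inj_in_uniq ?enum_uniq // => t t'; rewrite !mem_enum !inE => st st'.
    by apply: cl_inj => //; exact: strict_reduced n0 _ st'.
  apply/hasPn => C /mem2[t' /andP[rt' nst'] ->]; apply/negP => /mem1[t st e].
  by have tt' := cl_inj _ _ st rt' (esym e); rewrite -tt' st in nst'.
have cls : form_classes n = [set` s1 ++ s2]%classic.
  apply/seteqP; split => C /=.
    move=> [f [pf df] <-]; have [t rt ft] := exists_form_of n0 pf df.
    rewrite (form_class_eq ft) mem_cat.
    have [st|nst] := boolP (is_strict t.1); apply/orP; [left|right].
      by apply/mapP; exists t; rewrite ?mem_enum.
    by rewrite mem_undup; apply/mapP; exists t; rewrite ?mem_enum // inE /boundary rt.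
  rewrite mem_cat => /orP[/mem1[t st ->]|/mem2[t /andP[rt _] ->]].
    exists (form_of t) => //; have [rf df] := form_of_reduced n0 (strict_reduced n0 st).
    by split=> //; exact: reduced_posdef.
  by exists (form_of t) => //; have [rf df] := form_of_reduced n0 rt; split=> //; exact: reduced_posdef.
have -> : hurwitz R n = \sum_(C <- s1) class_weight R C + \sum_(C <- s2) class_weight R C.
  by rewrite /hurwitz cls -fsbig_seq // big_cat.
exists (\sum_(C <- s2) class_weight R C).
  rewrite sumr_ge0 => [|C _]; last by case/andP: (class_weight_bounds C).
  apply: le_trans (_ : \sum_(C <- s2) 1 <= _).
    by apply: ler_sum => C _; case/andP: (class_weight_bounds C).
  rewrite big_const_seq count_predT iter_addr addr0 ler_nat.
  apply: leq_trans (size_undup _) _; rewrite size_map -cardE; exact: card_boundary.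
congr (_ + _); rewrite (eq_big_seq (fun=> 1)) => [|C /mem1[t st ->]]; last exact: class_weight_strict.
rewrite big_const_seq count_predT iter_addr addr0 size_map -cardE; congr _%:R.
rewrite mulnC -card_bool -[#|{: bool}|]/(#|predT : pred bool|) -cardX; apply: eq_card => -[t s].
by rewrite !inE andbT.
Qed.

(** Equal parity makes [a = (A + C)/2] and [c = (B + C)/2] integers, and with [b = C] one has
    [4 a c - b^2 = A B + B C + C A]. *)
Definition is_selling (t : qtriple n) : bool :=
  let: (A, B, C) := t in [&& (0 < A)%N, (0 < B)%N, (0 < C)%N, odd A == odd B, odd B == odd C &
    (A * B + B * C + C * A == n)%N].

Definition swap12 (t : qtriple n) : qtriple n := let: (A, B, C) := t in (B, A, C).
Definition swap23 (t : qtriple n) : qtriple n := let: (A, B, C) := t in (A, C, B).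

Lemma swap12K : involutive swap12. Proof. by case=> [[A B] C]. Qed.
Lemma swap23K : involutive swap23. Proof. by case=> [[A B] C]. Qed.

Lemma is_selling_swap12 t : is_selling (swap12 t) = is_selling t.
Proof. case: t => [[A B] C] /=; apply/idP/idP; lia. Qed.

Lemma is_selling_swap23 t : is_selling (swap23 t) = is_selling t.
Proof. case: t => [[A B] C] /=; apply/idP/idP; lia. Qed.

Lemma sum_swap (s : qtriple n -> qtriple n) (F : qtriple n -> R) : involutive s ->
  (forall t, is_selling (s t) = is_selling t) ->
  \sum_(t | is_selling t) F (s t) = \sum_(t | is_selling t) F t.
Proof.
by move=> sK inv; rewrite [RHS](reindex_inj (inv_inj sK)); apply: eq_bigl => t; rewrite inv.
Qed.

Definition selling_weight (t : qtriple n) : R :=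
  let: (A, B, C) := t in (B : nat)%:R / (A + B + C)%:R.

(* The weights of [(A, B, C)], [(B, A, C)] and [(A, C, B)] sum to [1]. *)
Lemma sum_selling_weight :
  3 * \sum_(t | is_selling t) selling_weight t = #|[pred t | is_selling t]|%:R.
Proof.
pose W := selling_weight; pose U := fun t => W (swap12 t); pose V := fun t => W (swap23 t).
have -> : 3 * \sum_(t | is_selling t) W t =
   \sum_(t | is_selling t) W t + \sum_(t | is_selling t) U t + \sum_(t | is_selling t) V t.
  by rewrite (sum_swap _ swap12K is_selling_swap12) (sum_swap _ swap23K is_selling_swap23); ring.
rewrite -!big_split /= -sum1_card natr_sum; apply: eq_bigr => -[[A B] C] /and3P[A0 B0 _].
rewrite /U /V /W /=.
have h : (A + B + C)%:R != 0 :> R by rewrite pnatr_eq0; lia.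
rewrite (_ : (B + A + C = A + B + C)%N); last by lia.
rewrite (_ : (A + C + B = A + B + C)%N); last by lia.
rewrite -!mulrDl -!natrD (_ : (B + A + C = A + B + C)%N); last by lia.
by rewrite divff.
Qed.

Definition ordered (t : qtriple n) : bool := let: (A, B, C) := t in (C < A < B)%N.

(* [(A, B, C)] corresponds to the form with [a = (A + C)/2], [b = C],
   [c = (B + C)/2]. *)
Lemma card_ordered : #|[pred t | is_selling t && ordered t]| = #|[pred t : qtriple n | is_strict t]|.
Proof.
pose h (t : qtriple n) : qtriple n := let: (A, B, C) := t in
  (inord ((A + C)./2), C, inord ((B + C)./2)).
pose h' (t : qtriple n) : qtriple n := let: (a, b, c) := t in
  (inord (2 * a - b), inord (2 * c - b), b).
apply: (@card_bij_on _ _ _ _ h h').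
  case=> [[A B] C] /andP[/and5P[A0 B0 C0 AB /andP[BC /eqP e]] /andP[CA AB']].
  have An := ltn_ord A; have Bn := ltn_ord B; have Cn := ltn_ord C.
  rewrite /is_strict /h /h' /=; rewrite !inordK; [|lia..].
  split; last by congr (_, _, _); apply/val_inj => /=; rewrite inordK; lia.
  apply/and4P; split; [lia|lia|lia|].
  have hA : (((A + C)./2) * 2 = A + C)%N by lia.
  have hB : (((B + C)./2) * 2 = B + C)%N by lia.
  by move: ((A + C)./2) ((B + C)./2) hA hB => a c hA hB; apply/eqP; nia.
case=> [[a b] c] /and4P[b0 ba ac /eqP e].
have an := ltn_ord a; have bn := ltn_ord b; have cn := ltn_ord c.
have b1 : (2 * c - b < n.+1)%N by nia.
have b2 : (2 * a - b < n.+1)%N by lia.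
rewrite /is_selling /ordered /h /h' /=; rewrite !inordK //.
split; last by congr (_, _, _); apply/val_inj => /=; rewrite inordK; lia.
by apply/andP; split; [apply/and5P; split; [lia|lia|lia|lia|apply/andP; split; [lia|apply/eqP; nia]]|lia].
Qed.

(** Triples with distinct entries split into six orderings of equal size, exchanged by the two
    swaps. Two equal entries give [n = A (A + 2 C)] up to naming, so three positions and a divisor
    of [n] describe the rest. *)
Lemma card_selling : exists2 E, (E <= 3 * tau n)%N &
  #|[pred t | is_selling t]| = (6 * #|[pred t : qtriple n | is_strict t]| + E)%N.
Proof.
pose dis (t : qtriple n) : bool := let: (A, B, C) := t in
  [&& A != B :> nat, B != C :> nat & C != A :> nat].
exists #|[pred t | is_selling t && ~~ dis t]|.
  pose k (t : qtriple n) : nat := let: (A, B, C) := t in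
    if A == B :> nat then 0%N else if B == C :> nat then 1%N else 2%N.
  pose f (t : qtriple n) : nat := let: (A, B, C) := t in
    if A == B :> nat then A : nat else C : nat.
  apply: (@card_le_divisors _ _ (iota 0 3) n k f) => //.
  - case=> [[A B] C] /= /andP[/and5P[A0 B0 C0 AB /andP[BC /eqP e]] nd].
    case: eqP => AB'; first by apply/dvdnP; exists (A + 2 * C)%N; nia.
    have [BC'|CA'] : B = C :> nat \/ C = A :> nat by lia.
      by apply/dvdnP; exists (B + 2 * A)%N; nia.
    by apply/dvdnP; exists (C + 2 * B)%N; nia.
  - by case=> [[A B] C] _ /=; case: ifP => // _; case: ifP.
  case=> [[A B] C] [[A' B'] C'] /andP[/= /and5P[A0 B0 C0 AB /andP[BC /eqP e]] nd]
    /andP[/= /and5P[A'0 B'0 C'0 AB' /andP[BC' /eqP e']] nd'] ek ef.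
  suff [e1 e2 e3] : [/\ A = A' :> nat, B = B' :> nat & C = C' :> nat].
    by congr (_, _, _); apply/val_inj.
  have cancel x y y' : (0 < x)%N -> (x * (x + 2 * y) = n)%N -> (x * (x + 2 * y') = n)%N -> y = y'.
    move=> x0 h1 h2; have : (x * (x + 2 * y) == x * (x + 2 * y'))%N by rewrite h1 h2.
    by rewrite eqn_pmul2l // eqn_add2l eqn_pmul2l // => /eqP.
  move: (nat_of_ord A) (nat_of_ord B) (nat_of_ord C) (nat_of_ord A') (nat_of_ord B') (nat_of_ord C')
    A0 B0 C0 e nd A'0 B'0 C'0 e' nd' ek ef => {AB BC AB' BC' A B C A' B' C'} a b c a' b' c'.
  move=> a0 b0 c0 e nd a'0 b'0 c'0 e' nd'.
  have [c1|c1] := eqVneq a b; last have [c2|c2] := eqVneq b c;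
    (have [c1'|c1'] := eqVneq a' b'; last have [c2'|c2'] := eqVneq b' c') => //= _ ef.
  - subst b b' a'; have -> : c = c' by apply: (cancel a) => //; lia.
    by [].
  - subst c c' b'; have -> : a = a' by apply: (cancel b) => //; lia.
    by [].
  have c3 : c = a by apply/eqP; move: nd; rewrite c1 c2 /= negbK.
  have c3' : c' = a' by apply/eqP; move: nd'; rewrite c1' c2' /= negbK.
  subst c c' a'; have -> : b = b' by apply: (cancel a) => //; lia.
  by [].
rewrite -card_ordered.
pose X (P : pred (qtriple n)) := #|[pred t | is_selling t && P t]|.
have XE s (P : pred (qtriple n)) : involutive s -> (forall t, is_selling (s t) = is_selling t) ->
    X (P \o s) = X P.
  move=> sK inv; apply: (@card_bij_on _ _ _ _ s s) => t /= /andP[a b].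
    by rewrite inv sK a.
  by rewrite inv sK a.
have X1 := XE _ ordered swap12K is_selling_swap12.
have X2 := XE _ ordered swap23K is_selling_swap23.
have X3 := XE _ (ordered \o swap12) swap23K is_selling_swap23.
have X4 := XE _ (ordered \o swap23) swap12K is_selling_swap12.
have X5 := XE _ ((ordered \o swap12) \o swap23) swap12K is_selling_swap12.
have Xsum (P : pred (qtriple n)) : X P = (\sum_(t | is_selling t) P t)%N.
  rewrite /X -sum1_card big_mkcondr; apply: eq_bigr => t _ /=; by case: (P t).
have -> : #|[pred t | is_selling t]| = (X ordered + X (ordered \o swap12) + X (ordered \o swap23) +
   X ((ordered \o swap12) \o swap23) + X ((ordered \o swap23) \o swap12) +
   X (((ordered \o swap12) \o swap23) \o swap12) + X (predC dis))%N.
  rewrite !Xsum -!big_split /= -sum1_card; apply: eq_bigr => -[[A B] C] _ /=; lia.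
rewrite X5 X4 X3 X2 X1 -/(X ordered) -[#|[pred t | is_selling t & ~~ dis t]|]/(X (predC dis)).
by move: (X ordered) (X _) => x y; lia.
Qed.

Lemma hurwitz_selling :
  `|hurwitz R n - \sum_(t | is_selling t) selling_weight t| <= 6 * (tau n)%:R.
Proof.
have [E /andP[E0]] := hurwitz_strict; rewrite natrM => E6 ->.
have [E' E'3 cE] := card_selling; have := sum_selling_weight; rewrite cE.
have {}E'3 : (E')%:R <= 3 * (tau n)%:R :> R by rewrite -natrM ler_nat.
have E'0 : 0 <= E'%:R :> R by [].
rewrite natrD !natrM; move: (\sum_(t | _) _) => S e.
by rewrite ler_norml; apply/andP; split; lra.
Qed.

(** [(A, B, C)] corresponds to [a = (A + C)/2], [b = C], and [B] is recovered from
    [(n + b^2)/(4 a) = (B + C)/2]. Pairs with [b (2 a - b) >= n] correspond to no triple, but their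
    weight is 0. *)
Lemma sum_selling_pairs M : (n <= M)%N ->
  \sum_(t | is_selling t) selling_weight t =
  \sum_(1 <= a < M.+1) \sum_(1 <= b < 2 * a) (4 * a %| n + b ^ 2)%N%:R * wt R a n b.
Proof.
move=> nM.
pose P (p : 'I_M.+1 * 'I_(2 * M).+1) : bool := let: (a, b) := p in
  [&& (1 <= b)%N, (b < 2 * a)%N, (4 * a %| n + b ^ 2)%N & (b * (2 * a - b) < n)%N].
have -> : \sum_(1 <= a < M.+1) \sum_(1 <= b < 2 * a) (4 * a %| n + b ^ 2)%N%:R * wt R a n b =
    \sum_(p | P p) wt R p.1 n p.2.
  rewrite big_geq_mkord; under eq_bigr => a _.
    rewrite (@big_nat_widen _ _ _ 1 (2 * a) (2 * M).+1); last by have := ltn_ord a; lia.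
    rewrite big_geq_mkord.
    over.
  rewrite pair_big_dep /= big_mkcond [RHS]big_mkcond; apply: eq_bigr => -[a b] _ /=.
  case: (posnP a) => a0; first by rewrite a0 /= andbF.
  rewrite andbC; case: (0 < b)%N => //=; case: (b < 2 * a)%N => //=.
  case: (_ %| _)%N => /=; rewrite ?mul0r ?mul1r //; case: ltnP => // h.
  by rewrite /wt (eqP h) phi0.
pose h (t : qtriple n) : 'I_M.+1 * 'I_(2 * M).+1 := let: (A, B, C) := t in (inord ((A + C)./2), inord C).
pose h' (p : 'I_M.+1 * 'I_(2 * M).+1) : qtriple n := let: (a, b) := p in
  (inord (2 * a - b), inord (2 * ((n + b ^ 2) %/ (4 * a)) - b), inord b).
rewrite -(@big_bij_on _ _ _ _ _ is_selling P h h').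
- apply: eq_bigr => -[[A B] C] /and5P[A0 B0 C0 AB /andP[BC /eqP e]] /=.
  have An := ltn_ord A; have Bn := ltn_ord B; have Cn := ltn_ord C.
  have hA : (((A + C)./2) * 2 = A + C)%N by lia.
  have acn : (A + C <= n)%N by have := leq_pmulr (A + C) B0; lia.
  rewrite !inordK; [|lia..]; rewrite /wt.
  have -> : (n - C * (2 * (A + C)./2 - C) = ((A + C)./2 * 2) * B)%N.
    by rewrite hA (_ : (2 * (A + C)./2 - C = A)%N); lia.
  rewrite /phi (_ : (4 * (A + C)./2 ^ 2 + (A + C)./2 * 2 * B = ((A + C)./2 * 2) * (A + B + C))%N); last first.
    by rewrite (_ : (A + B + C = (A + C)./2 * 2 + B)%N); lia.
  rewrite !natrM -mulf_div divff ?mul1r //.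
  by rewrite -natrM pnatr_eq0; lia.
- case=> [[A B] C] /and5P[A0 B0 C0 AB /andP[BC /eqP e]] /=.
  have An := ltn_ord A; have Bn := ltn_ord B; have Cn := ltn_ord C.
  have hA : (((A + C)./2) * 2 = A + C)%N by lia.
  have hB : (((B + C)./2) * 2 = B + C)%N by lia.
  have acn : (A + C <= n)%N by have := leq_pmulr (A + C) B0; lia.
  rewrite !inordK; [|lia..].
  have E : (n + C ^ 2 = (B + C)./2 * (4 * (A + C)./2))%N.
    have : (((B + C)./2 * 2) * ((A + C)./2 * 2) = (B + C) * (A + C))%N by rewrite hA hB.
    by move: ((A + C)./2) ((B + C)./2) => a c; lia.
  rewrite E mulnK; last by lia.
  rewrite dvdn_mull //=; split; last first.
    by congr (_, _, _); apply/val_inj => /=; rewrite inordK; lia.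
  rewrite (_ : (2 * (A + C)./2 - C = A)%N); last by lia.
  have AB0 : (0 < A * B)%N by rewrite muln_gt0 A0.
  by apply/and3P; split; lia.
case=> a b /and4P[b1 b2 dv lt] /=.
have [k e] := dvdnP dv; rewrite e mulnK; last by lia.
have am := ltn_ord a; have bm := ltn_ord b.
have [c c0 ac] : exists2 c, (0 < c)%N & (2 * a = b + c)%N by exists (2 * a - b)%N; lia.
rewrite ac addKn in lt *.
have e' : (n + b * b = 2 * k * (b + c))%N by rewrite -ac; lia.
have kb : (b < 2 * k)%N by rewrite -(@ltn_pmul2r (b + c)); lia.
have b3 : (c <= n)%N by apply: leq_trans (ltnW lt); rewrite leq_pmull.
have b4 : (b <= n)%N by apply: leq_trans (ltnW lt); rewrite leq_pmulr.
have b5 : (2 * k - b <= n)%N.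
  by apply: leq_trans (_ : (2 * k - b) * (b + c) <= n)%N; [rewrite leq_pmulr; lia|rewrite mulnBl -e'; lia].
rewrite !inordK; [|lia..].
split; last by congr (_, _); apply/val_inj => /=; rewrite inordK; lia.
apply/and5P; split; [lia|lia|lia|lia|apply/andP; split; [lia|apply/eqP; nia]].
Qed.

Lemma hurwitz_ge0 : 0 <= hurwitz R n.
Proof. by have [E /andP[E0 _] ->] := hurwitz_strict; rewrite addr_ge0. Qed.

(** The value [b = 0] is added so that [b] runs over a full period [2 a]; the extra terms amount to
    at most [tau n]. *)
Definition wcount (M : nat) : R :=
  \sum_(1 <= a < M.+1) \sum_(0 <= b < 2 * a) (4 * a %| n + b ^ 2)%N%:R * wt R a n b.

Lemma wcount_ge0 M : 0 <= wcount M.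
Proof. by apply: sumr_ge0 => a _; apply: sumr_ge0 => b _; rewrite mulr_ge0 // phi_ge0. Qed.

Lemma hurwitz_wcount M : (n <= M)%N -> `|hurwitz R n - wcount M| <= 7 * (tau n)%:R.
Proof.
move=> nM; have := hurwitz_selling; rewrite (sum_selling_pairs nM).
set S := \sum_(1 <= a < _) _ => hS.
pose D := \sum_(1 <= a < M.+1) (4 * a %| n)%N%:R * wt R a n 0.
have -> : wcount M = D + S.
  rewrite -big_split /=; apply: eq_big_nat => a /andP[a1 _].
  by rewrite [LHS]big_ltn ?exp0n ?addn0 //; lia.
have D0 : 0 <= D by apply: sumr_ge0 => a _; rewrite mulr_ge0 // phi_ge0.
have Dt : D <= (tau n)%:R.
  rewrite tau_sum // big_mkcond [in leRHS]/=.
  rewrite /D (@big_cat_nat _ _ _ n.+1 1 M.+1) //= [X in _ + X]big_nat_cond [X in _ + X]big1 ?addr0.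
    apply: ler_sum_nat => a /andP[a1 _]; case: (boolP (4 * a %| n)%N) => [d|_]; last first.
      by rewrite mul0r; case: ifP.
    by rewrite (dvdn_trans _ d) ?dvdn_mull // mul1r phi_le1.
  move=> a /andP[/andP[an _] _]; rewrite (_ : (4 * a %| n)%N = false) ?mul0r //.
  by apply/negP => /dvdn_leq; lia.
by move: hS; rewrite !ler_norml => /andP[h1 h2]; apply/andP; split; lra.
Qed.

(** A strict triple has [b^2 < n], and [b] together with the divisor [a] of [n + b^2] determines
    [c]. *)
Lemma card_strict s : (n < s ^ 2)%N ->
  (#|[pred t : qtriple n | is_strict t]| <= \sum_(0 <= b < s) tau (n + b ^ 2))%N.
Proof.
move=> ns; pose k (t : qtriple n) : nat * nat := let: (a, b, c) := t in (b : nat, a : nat).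
have -> : \sum_(0 <= b < s) tau (n + b ^ 2) =
    size [seq (b, d) | b <- index_iota 0 s, d <- divisors (n + b ^ 2)].
  by rewrite size_allpairs_dep sumnE big_map.
rewrite cardE -(size_map k); apply: uniq_leq_size.
  rewrite map_inj_in_uniq ?enum_uniq // => -[[a b] c] [[a' b'] c']; rewrite !mem_enum !inE.
  move=> /and4P[b0 ba ac /eqP e] /and4P[b0' ba' ac' /eqP e'] [e1 e2].
  have e3 : c = c' :> nat.
    by apply/eqP; rewrite -(@eqn_pmul2l (4 * a)) ?muln_gt0 //; [rewrite e e2 e' e1|lia].
  by congr (_, _, _); apply/val_inj.
move=> p /mapP[[[a b] c]]; rewrite mem_enum inE => /and4P[b0 ba ac /eqP e] ->.
apply/allpairsPdep; exists (b : nat), (a : nat); split => //.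
  rewrite mem_index_iota /= ltnNge; apply/negP => sb.
  by have : (s ^ 2 <= b ^ 2)%N; [rewrite leq_sqr|nia].
by rewrite -dvdn_divisors; [rewrite -[(b ^ 2)%N]mulnn -e -mulnA dvdn_mull // dvdn_mulr|lia].
Qed.

End ClassNumber.

Section HurwitzBound.
Variable R : realType.

Lemma hurwitz_bound (dl : R) : 0 < dl -> exists2 K : R, 0 < K &
  forall n, (0 < n)%N -> hurwitz R n <= K * n%:R `^ dl * Num.sqrt n%:R.
Proof.
move=> dl0; have [K K0 HK] := divisor_bound dl0.
pose c : R := K * 5 `^ dl.
have c0 : 0 < c by rewrite mulr_gt0 // powR_gt0.
exists (10 * c) => [|n n0]; first by rewrite mulr_gt0.
set x := n%:R `^ dl; have x0 : 0 <= x by rewrite powR_ge0.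
have tb k : (0 < k)%N -> (k <= 5 * n)%N -> (tau k)%:R <= c * x.
  move=> k0 kn; apply: le_trans (HK k k0) _; rewrite -mulrA ler_wpM2l ?(ltW K0) //.
  by rewrite -powRM // -natrM ge0_ler_powR ?nnegrE ?ler_nat // ltW.
have [s1 s2] := andP (truncn_itv (sqrtr_ge0 (n%:R : R))).
set s := Num.truncn _ in s1 s2.
have n1 : 1 <= Num.sqrt n%:R :> R by rewrite -[leLHS]sqrtr1 ler_sqrt ?ler1n.
have ns : (n < s.+1 ^ 2)%N.
  rewrite -(ltr_nat R) natrX -[ltLHS](sqr_sqrtr (_ : 0 <= n%:R :> R)) //.
  by rewrite ltrXn2r ?nnegrE ?sqrtr_ge0.
have sn : (s ^ 2 <= n)%N.
  rewrite -(ler_nat R) natrX -[leRHS](sqr_sqrtr (_ : 0 <= n%:R :> R)) //.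
  by rewrite lerXn2r ?nnegrE ?sqrtr_ge0.
have [E /andP[E0 E6] ->] := hurwitz_strict R n0.
have h1 : (#|[pred t : qtriple n | is_strict t]|)%:R <= s.+1%:R * (c * x).
  apply: le_trans (_ : (\sum_(0 <= b < s.+1) tau (n + b ^ 2))%:R <= _).
    by rewrite ler_nat card_strict.
  rewrite natr_sum big_nat; apply: le_trans (ler_sum (G := fun=> c * x) _ _) _.
    move=> b /andP[_ bs]; apply: tb; first by lia.
    by have : (b ^ 2 <= s ^ 2)%N; [rewrite leq_sqr|lia].
  by rewrite -big_nat big_const_nat iter_addr addr0 subn0 -[leLHS]mulr_natl.
have h2 := tb n n0 (leq_pmull _ _).
rewrite !natrM in E6 *; move: h1; rewrite -natr1 => h1.
have cx0 : 0 <= c * x by rewrite mulr_ge0 // ltW.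
have h3 : s%:R * (c * x) <= Num.sqrt n%:R * (c * x) by rewrite ler_wpM2r.
have h4 : c * x <= Num.sqrt n%:R * (c * x) by rewrite ler_peMl.
have h2' := h2 isT.
rewrite (_ : 10 * c * x * _ = 10 * (Num.sqrt n%:R * (c * x))); last by ring.
by lra.
Qed.

End HurwitzBound.

(** * The correlation sum *)

Section Averages.
Variable R : realType.

Lemma sum_inv_multiples (e M : nat) : (0 < e)%N ->
  \sum_(1 <= a < M.+1 | (e %| a)%N) (a%:R^-1 : R) <= harm R M / e%:R.
Proof.
move=> e0; rewrite sum_multiples // /harm (eq_bigr (fun s => s%:R^-1 * e%:R^-1)) => [|s _]; last first.
  by rewrite natrM invfM.
rewrite -mulr_suml ler_wpM2r ?invr_ge0 //; apply: (@harm_le R).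
exact: leq_div.
Qed.

(** The gcd is bounded by the sum of all common divisors [e]; for each [e] the double sum
    factors. *)
Lemma sum_gcd (M : nat) :
  \sum_(1 <= a < M.+1) \sum_(1 <= a' < M.+1) (gcdn a a')%:R / (a%:R * a'%:R) <= harm R M ^+ 3.
Proof.
have h0 := harm_ge0 R M.
pose F (e a : nat) : R := if (e %| a)%N then a%:R^-1 else 0.
have F0 e a : 0 <= F e a by rewrite /F; case: ifP; rewrite ?invr_ge0.
apply: le_trans (_ : \sum_(1 <= a < M.+1) \sum_(1 <= a' < M.+1)
    \sum_(1 <= e < M.+1) e%:R * (F e a * F e a') <= _).
  apply: ler_sum_nat => a /andP[a1 aM]; apply: ler_sum_nat => a' /andP[a'1 a'M].
  have g0 : (0 < gcdn a a')%N by rewrite gcdn_gt0 a1.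
  have gM : (gcdn a a' < M.+1)%N by rewrite (leq_ltn_trans _ aM) // dvdn_leq // dvdn_gcdl.
  rewrite (@bigD1_seq _ _ _ _ _ (gcdn a a')) /= ?iota_uniq ?mem_index_iota ?g0 //.
  have -> : F (gcdn a a') a = a%:R^-1 by rewrite /F dvdn_gcdl.
  have -> : F (gcdn a a') a' = a'%:R^-1 by rewrite /F dvdn_gcdr.
  rewrite invfM lerDl; apply: sumr_ge0 => e _.
  by rewrite !mulr_ge0.
under eq_bigr => a _ do rewrite exchange_big /=.
rewrite exchange_big /=.
apply: le_trans (_ : \sum_(1 <= e < M.+1) harm R M ^+ 2 * e%:R^-1 <= _); last first.
  by rewrite -mulr_sumr -/(harm R M) -exprSr.
apply: ler_sum_nat => e /andP[e1 _].
under eq_bigr => a _ do rewrite -mulr_sumr -mulr_sumr.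
rewrite -mulr_sumr -mulr_suml.
have := sum_inv_multiples M e1; rewrite big_mkcond -/(F e) => h.
have e0 : 0 < e%:R :> R by rewrite ltr0n.
have s0 : 0 <= \sum_(1 <= a < M.+1) F e a by apply: sumr_ge0.
rewrite mulrC -ler_pdivlMr // -mulrA -invfM -!expr2 -expr_div_n.
by rewrite lerXn2r ?nnegrE // divr_ge0.
Qed.

Lemma mw_sqrt (a M : nat) : (0 < a)%N -> mw R a M <= Num.sqrt M%:R / a%:R.
Proof.
move=> a0; have a0' : 0 < a%:R :> R by rewrite ltr0n.
rewrite -(@ler_pXn2r _ 2) // ?nnegrE ?mw_ge0 ?divr_ge0 ?sqrtr_ge0 //.
rewrite expr_div_n sqr_sqrtr //.
apply: le_trans (_ : mw R a M * 1 <= _).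
  by rewrite expr2 ler_wpM2l ?mw_ge0 // /mw ge_min lexx.
by rewrite mulr1 /mw ge_min natrX lexx orbT.
Qed.

(** Uses [min(1, y) <= y^(3/4)] with [y = M/a^2], the power that turns the [sqrt a] of Weyl's bound
    into [1/a]. *)
Lemma mw_three_quarters (a M : nat) : (0 < a)%N ->
  Num.sqrt a%:R * mw R a M <= Num.sqrt (M%:R * Num.sqrt M%:R) / a%:R.
Proof.
move=> a0; have a0' : 0 < a%:R :> R by rewrite ltr0n.
have w0 := @mw_ge0 R a M.
rewrite ler_pdivlMr // -(@ler_pXn2r _ 4) // ?nnegrE ?mulr_ge0 ?sqrtr_ge0 //.
rewrite !exprMn.
have s4 (x : R) : 0 <= x -> Num.sqrt x ^+ 4 = x ^+ 2.
  by move=> x0; rewrite -[4%N]/(2 * 2)%N exprM sqr_sqrtr.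
rewrite !s4 ?mulr_ge0 ?sqrtr_ge0 // exprMn sqr_sqrtr //.
have h1 : mw R a M <= 1 by rewrite /mw ge_min lexx.
have h2 : mw R a M * a%:R ^+ 2 <= M%:R.
  by rewrite -ler_pdivlMr ?exprn_gt0 // /mw ge_min natrX lexx orbT.
have -> : a%:R ^+ 2 * mw R a M ^+ 4 * a%:R ^+ 4 = mw R a M * (mw R a M * a%:R ^+ 2) ^+ 3 by ring.
apply: le_trans (_ : 1 * (mw R a M * a%:R ^+ 2) ^+ 3 <= _).
  by rewrite ler_wpM2r // exprn_ge0 // mulr_ge0 // exprn_ge0.
by rewrite mul1r -exprSr lerXn2r ?nnegrE ?mulr_ge0 // exprn_ge0.
Qed.

Lemma Psi_le_mw (a n M : nat) : (0 < a)%N -> (n <= M)%N -> Psi R a n <= mw R a M.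
Proof.
move=> a0 nM; rewrite /Psi ler_pdivrMr; last by rewrite ltr0n; lia.
apply: le_trans (_ : \sum_(0 <= b < 2 * a) mw R a M <= _).
  by apply: ler_sum => b _; exact: wt_le_mw.
by rewrite big_const_nat iter_addr addr0 subn0 mulr_natr.
Qed.

Lemma PD_le (M D n : nat) : (0 < D)%N -> (n <= M)%N ->
  PD R M D n <= Num.sqrt M%:R * harm R M / D%:R.
Proof.
move=> D0 nM; apply: le_trans (_ : \sum_(1 <= a < M.+1 | (D %| a)%N) Num.sqrt M%:R * a%:R^-1 <= _).
  rewrite /PD big_nat_cond [leRHS]big_nat_cond; apply: ler_sum => a /andP[/andP[a1 _] _].
  by apply: le_trans (Psi_le_mw a1 nM) _; exact: mw_sqrt.
rewrite -mulr_sumr -mulrA ler_wpM2l ?sqrtr_ge0 //; exact: sum_inv_multiples.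
Qed.

End Averages.

Section Correlation.
Variable R : realType.
Variables l N : nat.
Hypotheses (l0 : (0 < l)%N) (N0 : (0 < N)%N) (lN : (l <= N)%N).
(** Larger than every [n] and [n + l] of the sum, as [l <= N]; [PD_asymptotic] needs the strict
    inequality. *)
Let M := (2 * N).+1.
(** One majorant for all the factors of size [X^eps]: divisor functions, harmonic sums and the
    excess of [hurwitz] over a square root. *)
Variable Z : R.
Hypothesis Z1 : 1 <= Z.
Hypothesis Ztau : forall k, (0 < k <= M)%N -> (tau k)%:R <= Z.
Hypothesis Zharm : harm R (4 * M ^ 2) <= Z.
Hypothesis Zhur : forall k, (0 < k <= M)%N -> hurwitz R k <= Z * Num.sqrt M%:R.

Let rM : R := Num.sqrt M%:R.
Let Z0 : 0 <= Z. Proof. exact: le_trans ler01 Z1. Qed.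
Let rM0 : 0 <= rM. Proof. exact: sqrtr_ge0. Qed.
Let rM1 : 1 <= rM. Proof. by rewrite /rM -[leLHS]sqrtr1 ler_sqrt ?ler1n. Qed.

Lemma harm_le_Z : harm R M <= Z.
Proof. by apply: le_trans Zharm; apply: (@harm_le R); lia. Qed.

Lemma sum_gcd_Z :
  \sum_(1 <= a < M.+1) \sum_(1 <= a' < M.+1) (gcdn a a')%:R / (a%:R * a'%:R) <= Z ^+ 3.
Proof. by apply: le_trans (sum_gcd R M) _; rewrite lerXn2r ?nnegrE ?harm_ge0 ?harm_le_Z. Qed.

Definition congsum (a a' n : nat) : R :=
  \sum_(0 <= b < 2 * a) \sum_(0 <= b' < 2 * a')
    (b ^ 2 == l + b' ^ 2 %[mod 4 * gcdn a a'])%:R * (wt R a n b * wt R a' (n + l) b').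

Lemma wcount_correlation :
  \sum_(1 <= n < N.+1) wcount R n M * wcount R (n + l) M =
  \sum_(1 <= a < M.+1) \sum_(1 <= a' < M.+1)
    (pair_diff a a' l N (wt R a) (fun n => wt R a' (n + l)) +
     (gcdn a a')%:R / (4 * (a%:R * a'%:R)) * \sum_(1 <= n < N.+1) congsum a a' n).
Proof.
have -> : \sum_(1 <= n < N.+1) wcount R n M * wcount R (n + l) M =
    \sum_(1 <= n < N.+1) \sum_(1 <= a < M.+1) \sum_(1 <= a' < M.+1)
     \sum_(0 <= b < 2 * a) \sum_(0 <= b' < 2 * a')
      ((4 * a %| n + b ^ 2) && (4 * a' %| n + l + b' ^ 2))%N%:R * (wt R a n b * wt R a' (n + l) b').
  apply: eq_bigr => n _; rewrite /wcount big_distrlr /=.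
  apply: eq_bigr => a _; apply: eq_bigr => a' _; rewrite big_distrlr /=.
  apply: eq_bigr => b _; apply: eq_bigr => b' _.
  by rewrite -mulnb natrM; ring.
rewrite exchange_big /=; apply: eq_big_nat => a /andP[a0 _].
rewrite exchange_big /=; apply: eq_big_nat => a' /andP[a'0 _].
rewrite /pair_diff mulr_sumr -big_split /=; apply: eq_bigr => n _.
rewrite /congsum mulr_sumr -big_split /=; apply: eq_bigr => b _.
rewrite mulr_sumr -big_split /=; apply: eq_bigr => b' _.
rewrite -muln_gcdr !natrM.
have a1 : a%:R != 0 :> R by rewrite pnatr_eq0 -lt0n.
have a1' : a'%:R != 0 :> R by rewrite pnatr_eq0 -lt0n.
by field; rewrite a1 a1'.
Qed.

Lemma pair_diff_bound (a a' : nat) : (0 < a <= M)%N -> (0 < a' <= M)%N ->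
  `|pair_diff a a' l N (wt R a) (fun n => wt R a' (n + l))| <=
  (33 * 40 * 40) * Z ^+ 3 * (M%:R * rM) * ((gcdn a a')%:R / (a%:R * a'%:R)).
Proof.
move=> /andP[a0 aM] /andP[a'0 a'M].
have NM : (N + l <= M)%N by rewrite /M; lia.
have E := @pair_error R a a' l N (wt R a) (fun n => wt R a' (n + l))
  (5 * mw R a M) (5 * mw R a' M) a0 a'0.
have {E} E := E _ _ _ _.
apply: le_trans (E _ _ _ _) _ => {E}.
- by move=> n /andP[_ nN]; apply: bv_wt_mw => //; lia.
- apply: le_trans (@sum_bv_wt_diff R a a0 M); rewrite (@big_cat_nat _ _ _ 1 0 M) //=.
  rewrite (@big_cat_nat _ _ _ N 1 M) //=; last by rewrite /M; lia.
  set x := \sum_(0 <= i < 1) _; set y := \sum_(N <= i < M) _.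
  have x0 : 0 <= x by apply: sumr_ge0 => *; exact: bv_ge0.
  have y0 : 0 <= y by apply: sumr_ge0 => *; exact: bv_ge0.
  by move: (\sum_(1 <= i < N) _) => z; lra.
- by move=> n /andP[_ nN]; apply: bv_wt_mw => //; lia.
(* The shifted increments occupy the indices from [1 + l] to [N + l - 1], part of the range below
   [M]. *)
- apply: le_trans (@sum_bv_wt_diff R a' a'0 M); rewrite (@big_cat_nat _ _ _ (1 + l) 0 M) //=; last by rewrite /M; lia.
  rewrite (@big_cat_nat _ _ _ (N + l) (1 + l) M) //=; last by lia.
  rewrite [X in _ <= _ + (X + _)]big_addn addnK.
  set x := \sum_(0 <= i < 1 + l) _; set y := \sum_(N + l <= i < M) _.
  have x0 : 0 <= x by apply: sumr_ge0 => *; exact: bv_ge0.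
  have y0 : 0 <= y by apply: sumr_ge0 => *; exact: bv_ge0.
  under eq_bigr => n _ do rewrite addSn.
  by move: (\sum_(1 <= i < N) _) => z; lra.
have g0 : (0 < gcdn a a')%N by rewrite gcdn_gt0 a0.
rewrite -muln_gcdr !divnMl // [(4 * _)%:R]natrM.
set g := gcdn a a' in g0 *.
have ga : (g %| a)%N by exact: dvdn_gcdl.
have ga' : (g %| a')%N by exact: dvdn_gcdr.
have t1 : (tau (a %/ g) + tau (a' %/ g))%:R <= 2 * Z.
  have : (tau (a %/ g))%:R <= Z.
    by apply: Ztau; rewrite divn_gt0 // dvdn_leq //=; apply: leq_trans aM; exact: leq_div.
  have : (tau (a' %/ g))%:R <= Z.
    by apply: Ztau; rewrite divn_gt0 // dvdn_leq //=; apply: leq_trans a'M; exact: leq_div.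
  by rewrite natrD; lra.
have t2 : harm R (lcmq (4 * a) (4 * a')) <= Z.
  apply: le_trans Zharm; apply: (@harm_le R).
  rewrite /lcmq -muln_gcdr -/g !divnMl //.
  have e1 := divnK ga; have e2 := divnK ga'.
  move: (a %/ g)%N (a' %/ g)%N e1 e2 => s s' e1 e2.
  by apply: leq_trans (_ : 4 * (a * a') <= _)%N; [nia|rewrite leq_mul2l /= -mulnn leq_mul].
have t3 : Num.sqrt (a * a')%:R * (mw R a M * mw R a' M) <= M%:R * rM / (a%:R * a'%:R).
  rewrite natrM sqrtrM // mulrACA.
  have h1 := mw_three_quarters R M a0; have h2 := mw_three_quarters R M a'0.
  apply: le_trans (ler_pM _ _ h1 h2) _; rewrite ?mulr_ge0 ?sqrtr_ge0 ?mw_ge0 //.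
  by rewrite mulf_div -expr2 sqr_sqrtr // mulr_ge0 // sqrtr_ge0.
(* [264 * 5 * 5 * 4 = 33 * 40 * 20]; the two divisor functions double this below. *)
have -> : 264 * (5 * mw R a M) * (5 * mw R a' M) * Num.sqrt (a * a')%:R * (4 * g%:R) *
    (tau (a %/ g) + tau (a' %/ g))%:R * harm R (lcmq (4 * a) (4 * a')) ^+ 2 =
   (33 * 40 * 20) * g%:R * (Num.sqrt (a * a')%:R * (mw R a M * mw R a' M)) *
    (tau (a %/ g) + tau (a' %/ g))%:R * harm R (lcmq (4 * a) (4 * a')) ^+ 2 by ring.
apply: le_trans (_ : (33 * 40 * 20) * g%:R * (M%:R * rM / (a%:R * a'%:R)) * (2 * Z) * Z ^+ 2 <= _); last first.
  by rewrite le_eqVlt; apply/orP; left; apply/eqP; ring.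
apply: ler_pM; rewrite ?exprn_ge0 ?harm_ge0 ?mulr_ge0 ?sqrtr_ge0 ?mw_ge0 //.
  apply: ler_pM; rewrite ?mulr_ge0 ?sqrtr_ge0 ?mw_ge0 //.
  by rewrite ler_wpM2l // mulr_ge0.
by rewrite lerXn2r ?nnegrE ?harm_ge0.
Qed.

Lemma sum_pair_diff_bound :
  `|\sum_(1 <= a < M.+1) \sum_(1 <= a' < M.+1) pair_diff a a' l N (wt R a) (fun n => wt R a' (n + l))|
  <= (33 * 40 * 40) * Z ^+ 6 * (M%:R * rM).
Proof.
set c : R := 33 * 40 * 40; have c0 : 0 <= c by rewrite !mulr_ge0 ?ler0n.
apply: le_trans (ler_norm_sum _ _ _) _.
apply: le_trans (_ : \sum_(1 <= a < M.+1) \sum_(1 <= a' < M.+1)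
   c * Z ^+ 3 * (M%:R * rM) * ((gcdn a a')%:R / (a%:R * a'%:R)) <= _).
  apply: ler_sum_nat => a aM; apply: le_trans (ler_norm_sum _ _ _) _.
  by apply: ler_sum_nat => a' aM'; exact: pair_diff_bound.
under eq_bigr => a _ do rewrite -mulr_sumr.
rewrite -mulr_sumr.
apply: le_trans (ler_wpM2l _ sum_gcd_Z) _; first by rewrite !mulr_ge0 ?exprn_ge0.
by rewrite le_eqVlt; apply/orP; left; apply/eqP; ring.
Qed.

Lemma sqcount_le (g : nat) : (0 < g <= M)%N -> (sqcount l g)%:R <= 4 * g%:R * Z ^+ 2.
Proof.
move=> /andP[g0 gM]; rewrite sqcountE // ler_wpM2l //.
apply: le_trans (ler_norm _) _; apply: le_trans (ler_norm_sum _ _ _) _.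
apply: le_trans (_ : \sum_(1 <= D < g.+1 | (D %| g)%N) Z <= _).
  rewrite big_nat_cond [leRHS]big_nat_cond; apply: ler_sum => D /andP[/andP[D1 Dg] _].
  apply: le_trans (norm_lam R l D1) _; apply: Ztau; rewrite D1; lia.
rewrite -[X in \sum_(_ <= _ < _ | _) X]mulr1 -mulr_sumr -tau_sum // expr2 ler_wpM2l //.
by apply: Ztau; rewrite g0.
Qed.

(** The three errors of [residue_average] give [35 = 5 + 25 + 5]. Their bound keeps the factor
    [gcd(a, a')/(a a')], so that [sum_gcd_Z] can sum it. *)
Lemma congsum_main (a a' n : nat) : (0 < a <= M)%N -> (0 < a' <= M)%N -> (n <= N)%N ->
  `|(gcdn a a')%:R / (4 * (a%:R * a'%:R)) * congsum a a' n
    - (sqcount l (gcdn a a'))%:R / (4 * (gcdn a a')%:R) * (Psi R a n * Psi R a' (n + l))|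
  <= 35 * Z ^+ 2 * rM * ((gcdn a a')%:R / (a%:R * a'%:R)).
Proof.
move=> /andP[a0 aM] /andP[a'0 a'M] nN.
have nM : (n <= M)%N by rewrite /M; lia.
have nlM : (n + l <= M)%N by rewrite /M; lia.
set g := gcdn a a'; have g0 : (0 < g)%N by rewrite gcdn_gt0 a0.
have ga : (g <= a)%N by rewrite dvdn_leq // dvdn_gcdl.
have ga' : (g <= a')%N by rewrite dvdn_leq // dvdn_gcdr.
have := @residue_average R a a' l g (wt R a n) (wt R a' (n + l)) (dvdn_gcdl _ _) (dvdn_gcdr _ _) a0 a'0
  (fun b => wt_ge0 _ _ _ _) (fun b => wt_ge0 _ _ _ _).
have := @sqcount_le g; rewrite g0 (leq_trans ga aM) => /(_ isT).
rewrite -/(congsum a a' n).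
set sq : R := (sqcount l g)%:R => sqle.
have sq0 : 0 <= sq by [].
have PE c k : (0 < c)%N -> (\sum_(0 <= b < 2 * c) wt R c k b) / (2 * g)%:R = Psi R c k * (c%:R / g%:R).
  move=> c0; rewrite /Psi !natrM.
  have c1 : c%:R != 0 :> R by rewrite pnatr_eq0 -lt0n.
  have g1 : g%:R != 0 :> R by rewrite pnatr_eq0 -lt0n.
  by field; rewrite c1 g1.
rewrite !PE //.
have b1 := @bv_wt_mw R a a0 M n nM; have b2 := @bv_wt_mw R a' a'0 M (n + l) nlM.
have b10 := bv_ge0 (wt R a n) (2 * a); have b20 := bv_ge0 (wt R a' (n + l)) (2 * a').
have p1 := Psi_le_mw R a0 nM; have p2 := Psi_le_mw R a'0 nlM.
have p10 := Psi_ge0 R a n; have p20 := Psi_ge0 R a' (n + l).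
have m1 : mw R a M <= 1 by rewrite /mw ge_min lexx.
have m2 : mw R a' M <= 1 by rewrite /mw ge_min lexx.
have m10 := @mw_ge0 R a M; have m20 := @mw_ge0 R a' M.
have s1 := mw_sqrt R M a0; have s2 := mw_sqrt R M a'0; rewrite -/rM in s1 s2.
move: (bv _ _) (bv _ _) (Psi R a n) (Psi R a' (n + l)) (mw R a M) (mw R a' M) (congsum _ _ _)
  b1 b2 b10 b20 p1 p2 p10 p20 m1 m2 m10 m20 s1 s2 => B' B P P' m m' Q.
have x0 : 0 < a%:R :> R by rewrite ltr0n.
have y0 : 0 < a'%:R :> R by rewrite ltr0n.
have z0 : 0 < g%:R :> R by rewrite ltr0n.
have zx : g%:R <= a%:R :> R by rewrite ler_nat.
have zy : g%:R <= a'%:R :> R by rewrite ler_nat.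
move: sqle; move: (a%:R : R) (a'%:R : R) (g%:R : R) x0 y0 z0 zx zy => x y z x0 y0 z0 zx zy sqle.
move=> b1 b2 b10 b20 p1 p2 p10 p20 m1 m2 m10 m20 s1 s2 H.
have xn : x != 0 by rewrite gt_eqF.
have yn : y != 0 by rewrite gt_eqF.
have zn : z != 0 by rewrite gt_eqF.
have -> : z / (4 * (x * y)) * Q - sq / (4 * z) * (P * P') =
   z / (4 * (x * y)) * (Q - sq * (P * (x / z) * (P' * (y / z)))).
  by field; rewrite xn yn zn.
have k0 : 0 <= z / (4 * (x * y)) by rewrite divr_ge0 ?mulr_ge0 ?ltW.
rewrite normrM (ger0_norm k0).
apply: le_trans (ler_wpM2l k0 H) _.
have xz0 : 0 <= x / z by rewrite divr_ge0 ?ltW.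
have yz0 : 0 <= y / z by rewrite divr_ge0 ?ltW.
have h1 : B * (P' * (y / z)) <= 5 * (m * m') * (y / z).
  rewrite mulrA ler_wpM2r //.
  by rewrite (_ : 5 * (m * m') = 5 * m * m'); [exact: ler_pM|ring].
have h2 : B * B' <= 25 * (m * m').
  by rewrite (_ : 25 * (m * m') = 5 * m * (5 * m')); [exact: ler_pM|ring].
have h3 : P * (x / z) * B' <= 5 * (m * m') * (x / z).
  rewrite mulrAC ler_wpM2r //.
  by rewrite (_ : 5 * (m * m') = m * (5 * m')); [exact: ler_pM|ring].
have mm0 : 0 <= m * m' by rewrite mulr_ge0.
have mx : m * m' <= rM / x by apply: le_trans s1; rewrite ler_piMr.
have my : m * m' <= rM / y by apply: le_trans s2; rewrite ler_piMl.
apply: le_trans (_ : z / (4 * (x * y)) * (4 * z * Z ^+ 2 *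
   (5 * (m * m') * (y / z) + 25 * (m * m') + 5 * (m * m') * (x / z))) <= _).
  rewrite ler_wpM2l //; apply: ler_pM => //; last by rewrite !lerD.
  by apply: addr_ge0; [apply: addr_ge0|]; apply: mulr_ge0 => //; apply: mulr_ge0.
have -> : z / (4 * (x * y)) * (4 * z * Z ^+ 2 *
   (5 * (m * m') * (y / z) + 25 * (m * m') + 5 * (m * m') * (x / z))) =
   Z ^+ 2 * (5 * (m * m' * (z / x)) + 25 * (m * m' * (z / x)) * (z / y) + 5 * (m * m' * (z / y))).
  by field; rewrite xn yn zn.
have -> : 35 * Z ^+ 2 * rM * (z / (x * y)) = Z ^+ 2 * (5 * (rM * (z / (x * y))) + 25 * (rM * (z / (x * y))) * 1 +
   5 * (rM * (z / (x * y)))) by ring.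
have e1 : m * m' * (z / x) <= rM * (z / (x * y)).
  rewrite (_ : rM * (z / (x * y)) = rM / y * (z / x)); last by field; rewrite xn yn.
  by rewrite ler_wpM2r // divr_ge0 ?ltW.
have e2 : m * m' * (z / y) <= rM * (z / (x * y)).
  rewrite (_ : rM * (z / (x * y)) = rM / x * (z / y)); last by field; rewrite xn yn.
  by rewrite ler_wpM2r // divr_ge0 ?ltW.
have e3 : z / y <= 1 by rewrite ler_pdivrMr ?mul1r.
have q0 : 0 <= m * m' * (z / x) by rewrite mulr_ge0 // divr_ge0 ?ltW.
rewrite ler_wpM2l ?exprn_ge0 //; apply: lerD; last by rewrite ler_wpM2l.
apply: lerD; first by rewrite ler_wpM2l.
by apply: ler_pM => //; [rewrite mulr_ge0|rewrite divr_ge0 ?ltW|rewrite ler_wpM2l].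
Qed.

Lemma sum_congsum_main :
  `|\sum_(1 <= a < M.+1) \sum_(1 <= a' < M.+1)
      ((gcdn a a')%:R / (4 * (a%:R * a'%:R)) * (\sum_(1 <= n < N.+1) congsum a a' n)
       - \sum_(1 <= n < N.+1) (sqcount l (gcdn a a'))%:R / (4 * (gcdn a a')%:R) *
           (Psi R a n * Psi R a' (n + l)))|
  <= 35 * Z ^+ 5 * rM * N%:R.
Proof.
apply: le_trans (ler_norm_sum _ _ _) _.
apply: le_trans (_ : \sum_(1 <= a < M.+1) \sum_(1 <= a' < M.+1)
   35 * Z ^+ 2 * rM * N%:R * ((gcdn a a')%:R / (a%:R * a'%:R)) <= _).
  apply: ler_sum_nat => a aM; apply: le_trans (ler_norm_sum _ _ _) _.
  apply: ler_sum_nat => a' aM'; rewrite mulr_sumr -sumrB.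
  apply: le_trans (ler_norm_sum _ _ _) _.
  apply: le_trans (_ : \sum_(1 <= n < N.+1) 35 * Z ^+ 2 * rM * ((gcdn a a')%:R / (a%:R * a'%:R)) <= _).
    by apply: ler_sum_nat => n /andP[_ nN]; exact: congsum_main.
  rewrite big_const_nat iter_addr addr0 subn1 /= -[leLHS]mulr_natr.
  by rewrite le_eqVlt; apply/orP; left; apply/eqP; ring.
under eq_bigr => a _ do rewrite -mulr_sumr.
rewrite -mulr_sumr.
apply: le_trans (ler_wpM2l _ sum_gcd_Z) _; first by rewrite !mulr_ge0 ?exprn_ge0.
by rewrite le_eqVlt; apply/orP; left; apply/eqP; ring.
Qed.

(** By [sqcountE] the density is a sum over [D] dividing the gcd, that is over [D] dividing both
    moduli; for fixed [D] the sums over [a] and [a'] separate. *)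
Lemma sum_sqcount_lam (n : nat) :
  \sum_(1 <= a < M.+1) \sum_(1 <= a' < M.+1)
    (sqcount l (gcdn a a'))%:R / (4 * (gcdn a a')%:R) * (Psi R a n * Psi R a' (n + l)) =
  \sum_(1 <= D < M.+1) lam R l D * (PD R M D n * PD R M D (n + l)).
Proof.
transitivity (\sum_(1 <= a < M.+1) \sum_(1 <= a' < M.+1) \sum_(1 <= D < M.+1)
    lam R l D * ((if (D %| a)%N then Psi R a n else 0) * (if (D %| a')%N then Psi R a' (n + l) else 0))).
  apply: eq_big_nat => a /andP[a0 aM]; apply: eq_big_nat => a' /andP[a'0 a'M].
  set g := gcdn a a'; have g0 : (0 < g)%N by rewrite gcdn_gt0 a0.
  have gM : (g < M.+1)%N by rewrite (leq_ltn_trans _ aM) // dvdn_leq // dvdn_gcdl.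
  have g1 : 4 * g%:R != 0 :> R by rewrite mulf_neq0 // pnatr_eq0 -lt0n.
  rewrite sqcountE // [4 * g%:R * _]mulrC mulfK // mulr_suml.
  rewrite (@big_cat_nat _ _ _ g.+1 1 M.+1) //= [X in _ = _ + X]big_nat_cond [X in _ = _ + X]big1.
    rewrite addr0 big_mkcond; apply: eq_bigr => D _; rewrite /g dvdn_gcd.
    by case: (D %| a)%N; case: (D %| a')%N; rewrite /= ?(mul0r, mulr0).
  move=> D /andP[/andP[gD _] _]; have : ~~ (D %| g)%N by apply/negP => /dvdn_leq; lia.
  by rewrite /g dvdn_gcd; case: (D %| a)%N; case: (D %| a')%N => //= _; rewrite ?(mul0r, mulr0).
under eq_bigr => a _ do rewrite exchange_big /=.
rewrite exchange_big /=; apply: eq_bigr => D _.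
rewrite /PD !(big_mkcond (fun a => D %| a)%N) big_distrlr /= mulr_sumr; apply: eq_bigr => a _.
by rewrite mulr_sumr.
Qed.

Lemma pi_div6_bounds : 0 <= (pi / 6 : R) <= 1.
Proof. by have := @pi_ge2 R; have := @pihalf_lt2 R; lra. Qed.

Lemma PD_product (D n : nat) : (0 < D)%N -> (0 < n <= N)%N ->
  `|PD R M D n * PD R M D (n + l)
    - (pi / 6) ^+ 2 * (Num.sqrt n%:R * Num.sqrt (n + l)%:R) / D%:R ^+ 2| <= 16 * Z ^+ 2 * rM * D%:R^-1.
Proof.
move=> D0 /andP[n0 nN].
have nM : (n < M)%N by rewrite /M; lia.
have nlM : (n + l < M)%N by rewrite /M; lia.
have nl0 : (0 < n + l)%N by lia.
have d0 : 0 <= D%:R^-1 :> R by rewrite invr_ge0.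
have Hh := harm_le_Z.
have h1 := PD_asymptotic R n0 D0 nM; have h2 := PD_asymptotic R nl0 D0 nlM.
have u := PD_le R D0 (ltnW nlM).
have u0 := PD_ge0 R M D (n + l).
have [p0 p1] := andP pi_div6_bounds.
have s : Num.sqrt n%:R <= rM by rewrite /rM ler_wsqrtr // ler_nat ltnW.
have s0 := sqrtr_ge0 (n%:R : R).
have v : pi / 6 * Num.sqrt n%:R / D%:R <= rM * Z * D%:R^-1.
  rewrite ler_wpM2r // mulrC; apply: ler_pM => //.
  by apply: le_trans p1 _.
have v0 : 0 <= pi / 6 * Num.sqrt n%:R / D%:R :> R by apply: mulr_ge0 => //; apply: mulr_ge0.
have {}u : PD R M D (n + l) <= rM * Z * D%:R^-1.
  by apply: le_trans u _; rewrite ler_wpM2r // ler_wpM2l.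
have -> : (pi / 6) ^+ 2 * (Num.sqrt n%:R * Num.sqrt (n + l)%:R) / D%:R ^+ 2 =
    (pi / 6 * Num.sqrt n%:R / D%:R) * (pi / 6 * Num.sqrt (n + l)%:R / D%:R) :> R.
  have Dn : D%:R != 0 :> R by rewrite pnatr_eq0 -lt0n.
  by move: (pi / 6) (Num.sqrt _) (Num.sqrt _) => p t1 t2; field.
move: (PD _ _ _ _) (PD _ _ _ _) (_ / D%:R) (_ / D%:R) h1 h2 u u0 v v0 => A A' B B' h1 h2 u u0 v v0.
have -> : A' * A - B' * B = (A' - B') * A + B' * (A - B) by ring.
apply: le_trans (ler_normD _ _) _; rewrite !normrM.
rewrite (_ : 16 * Z ^+ 2 * rM * D%:R^-1 = 8 * Z * (rM * Z * D%:R^-1) + rM * Z * D%:R^-1 * (8 * Z)); last by ring.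
rewrite (ger0_norm u0) (ger0_norm v0).
have e1 : `|A' - B'| <= 8 * Z by apply: le_trans h1 _; rewrite ler_wpM2l.
have e2 : `|A - B| <= 8 * Z by apply: le_trans h2 _; rewrite ler_wpM2l.
by apply: lerD; apply: ler_pM.
Qed.

Lemma sum_lam_PD :
  `|\sum_(1 <= n < N.+1) \sum_(1 <= D < M.+1) lam R l D * (PD R M D n * PD R M D (n + l))
    - (pi / 6) ^+ 2 * (\sum_(1 <= n < N.+1) Num.sqrt n%:R * Num.sqrt (n + l)%:R)
        * \sum_(1 <= D < M.+1) lam R l D / D%:R ^+ 2| <= 16 * Z ^+ 4 * rM * N%:R.
Proof.
set L := \sum_(1 <= D < M.+1) _ / _.
rewrite [_ ^+ 2 * _]mulr_sumr mulr_suml -sumrB; apply: le_trans (ler_norm_sum _ _ _) _.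
apply: le_trans (_ : \sum_(1 <= n < N.+1) 16 * Z ^+ 4 * rM <= _); last first.
  by rewrite big_const_nat iter_addr addr0 subn1 -[leLHS]mulr_natr.
apply: ler_sum_nat => n /andP[n0 nN]; rewrite /L mulr_sumr -sumrB.
apply: le_trans (ler_norm_sum _ _ _) _.
apply: le_trans (_ : \sum_(1 <= D < M.+1) Z * (16 * Z ^+ 2 * rM) * D%:R^-1 <= _); last first.
  rewrite -mulr_sumr -/(harm R M) (_ : 16 * Z ^+ 4 * rM = Z * (16 * Z ^+ 2 * rM) * Z); last by ring.
  by rewrite ler_wpM2l ?harm_le_Z // !mulr_ge0 // exprn_ge0.
apply: ler_sum_nat => D /andP[D0 DM].
rewrite (_ : _ - _ = lam R l D * (PD R M D n * PD R M D (n + l)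
    - (pi / 6) ^+ 2 * (Num.sqrt n%:R * Num.sqrt (n + l)%:R) / D%:R ^+ 2)); last by ring.
rewrite normrM -[leRHS]mulrA; apply: ler_pM => //; last by apply: PD_product => //; rewrite n0.
by apply: le_trans (norm_lam R l D0) _; apply: Ztau; rewrite D0.
Qed.

(** Each product lies between [n] and [n + l]. This is the source of the error [X l]. *)
Lemma sum_sqrt_sqrt :
  `|(\sum_(1 <= n < N.+1) Num.sqrt n%:R * Num.sqrt (n + l)%:R) - N%:R * (N%:R + 1) / 2| <= N%:R * l%:R :> R.
Proof.
have -> : N%:R * (N%:R + 1) / 2 = \sum_(1 <= n < N.+1) n%:R :> R.
  elim: (N) => [|k IH]; first by rewrite big_geq // !mul0r.
  by rewrite big_nat_recr //= -IH -natr1; field.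
rewrite -sumrB; apply: le_trans (ler_norm_sum _ _ _) _.
apply: le_trans (_ : \sum_(1 <= n < N.+1) l%:R <= _); last first.
  by rewrite big_const_nat iter_addr addr0 subn1 -[leLHS]mulr_natl.
apply: ler_sum_nat => n _; rewrite natrD.
have n0 : 0 <= n%:R :> R by []. have l1 : 0 <= l%:R :> R by [].
have s0 := sqrtr_ge0 (n%:R : R).
have e : Num.sqrt n%:R * Num.sqrt n%:R = n%:R :> R by rewrite -expr2 sqr_sqrtr.
have h1 : Num.sqrt n%:R <= Num.sqrt (n%:R + l%:R) :> R by rewrite ler_wsqrtr // lerDl.
have e2 : Num.sqrt (n%:R + l%:R) * Num.sqrt (n%:R + l%:R) = n%:R + l%:R :> R.
  by rewrite -expr2 sqr_sqrtr // addr_ge0.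
move: (Num.sqrt (n%:R + l%:R : R)) (Num.sqrt (n%:R : R)) s0 e h1 e2 => y x x0 e xy e2.
by rewrite ler_norml; apply/andP; split; nra.
Qed.

Lemma wcount_main :
  `|(\sum_(1 <= n < N.+1) wcount R n M * wcount R (n + l) M)
    - (pi / 6) ^+ 2 * sing R l * (N%:R * (N%:R + 1) / 2)|
  <= (33 * 40 * 40) * Z ^+ 6 * (M%:R * rM) + 35 * Z ^+ 5 * rM * N%:R + 16 * Z ^+ 4 * rM * N%:R
     + 2 * Z * N%:R + N%:R * l%:R.
Proof.
have lM : (l <= M)%N by rewrite /M; lia.
have nM n : (n < N.+1)%N -> (n <= M)%N && (n + l <= M)%N by rewrite /M; lia.
rewrite wcount_correlation.
under eq_bigr => a _ do rewrite big_split /=.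
rewrite big_split /=.
have h1 := sum_pair_diff_bound; have h2 := sum_congsum_main; have h3 := sum_lam_PD.
set T := \sum_(1 <= n < N.+1) Num.sqrt _ * _ in h3.
set L := \sum_(1 <= D < M.+1) _ in h3.
have T1 := sum_sqrt_sqrt; rewrite -/T in T1.
have Tle : 0 <= T <= N%:R * M%:R.
  apply/andP; split; first by apply: sumr_ge0 => n _; rewrite mulr_ge0.
  apply: le_trans (_ : \sum_(1 <= n < N.+1) M%:R <= _); last first.
    by rewrite big_const_nat iter_addr addr0 subn1 -[leLHS]mulr_natl.
  apply: ler_sum_nat => n /andP[_ nN]; rewrite -[leRHS](sqr_sqrtr (_ : 0 <= M%:R :> R)) // expr2.
  by have /andP[n1 n2] := nM n nN; apply: ler_pM => //; rewrite ler_wsqrtr // ler_nat.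
have S1 : `|L - sing R l| <= 2 * Z / M.+1%:R.
  apply: le_trans (singular_series R l0 lM) _.
  by rewrite ler_wpM2r ?invr_ge0 // ler_wpM2l // Ztau // l0.
have [s0 s1] := andP (sing_bounds R l).
have [p0 p1] := andP pi_div6_bounds.
have TS : `|T * (L - sing R l)| <= 2 * Z * N%:R.
  rewrite normrM; case/andP: Tle => T0 TN; rewrite (ger0_norm T0).
  apply: le_trans (ler_pM T0 _ TN S1) _ => //.
  rewrite (_ : N%:R * M%:R * _ = 2 * Z * N%:R * (M%:R / M.+1%:R)); last by ring.
  by rewrite ler_piMr ?mulr_ge0 // ler_pdivrMr ?mul1r ?ler_nat.
have h4 : `|(pi / 6) ^+ 2 * T * L - (pi / 6) ^+ 2 * sing R l * (N%:R * (N%:R + 1) / 2)|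
    <= 2 * Z * N%:R + N%:R * l%:R.
  rewrite (_ : _ - _ = (pi / 6) ^+ 2 * (T * (L - sing R l) + sing R l * (T - N%:R * (N%:R + 1) / 2))); last first.
    by move: (pi / 6) => p; field.
  rewrite normrM ger0_norm ?exprn_ge0 //.
  apply: le_trans (_ : 1 * (2 * Z * N%:R + N%:R * l%:R) <= _); last by rewrite mul1r.
  apply: ler_pM; rewrite ?exprn_ge0 ?exprn_ile1 //.
  apply: le_trans (ler_normD _ _) _; apply: lerD => //.
  rewrite normrM ger0_norm // -[leRHS]mul1r; exact: ler_pM.
have e : \sum_(1 <= a < M.+1) \sum_(1 <= a' < M.+1)
    (gcdn a a')%:R / (4 * (a%:R * a'%:R)) * (\sum_(1 <= n < N.+1) congsum a a' n) =
  (\sum_(1 <= a < M.+1) \sum_(1 <= a' < M.+1)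
      ((gcdn a a')%:R / (4 * (a%:R * a'%:R)) * (\sum_(1 <= n < N.+1) congsum a a' n)
       - \sum_(1 <= n < N.+1) (sqcount l (gcdn a a'))%:R / (4 * (gcdn a a')%:R) *
           (Psi R a n * Psi R a' (n + l)))) +
  \sum_(1 <= n < N.+1) \sum_(1 <= D < M.+1) lam R l D * (PD R M D n * PD R M D (n + l)).
  under [X in _ = _ + X]eq_bigr => n _ do rewrite -sum_sqcount_lam.
  rewrite [X in _ = _ + X]exchange_big /= -big_split; apply: eq_bigr => a _ /=.
  rewrite [X in _ = _ + X]exchange_big /= -big_split; apply: eq_bigr => a' _ /=.
  by rewrite subrK.
rewrite e.
move: (\sum_(1 <= a < M.+1) \sum_(1 <= a' < M.+1) pair_diff _ _ _ _ _ _) h1 => A h1.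
move: (\sum_(1 <= a < M.+1) _) h2 => B h2.
move: (\sum_(1 <= n < N.+1) \sum_(1 <= D < M.+1) _) h3 => C h3.
move: ((pi / 6) ^+ 2 * T * L) h3 h4 => U h3 h4.
move: ((pi / 6) ^+ 2 * sing R l * _) h4 => V h4.
rewrite (_ : A + (B + C) - V = A + B + (C - U) + (U - V)); last by ring.
apply: le_trans (ler_normD _ _) _; rewrite -[leRHS]addrA; apply: lerD => //.
apply: le_trans (ler_normD _ _) _; apply: lerD => //.
by apply: le_trans (ler_normD _ _) _; apply: lerD.
Qed.

(** All errors but the last are absorbed into one: [116 = 35 + 16 + 2 + 63], where [63 = 7 + 7 * 8]
    is the cost of replacing [hurwitz] by [wcount]. *)
Lemma hurwitz_correlation :
  `|(\sum_(1 <= n < N.+1) hurwitz R n * hurwitz R (n + l))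
    - (pi / 6) ^+ 2 * sing R l * (N%:R * (N%:R + 1) / 2)|
  <= (33 * 40 * 40 + 116) * Z ^+ 6 * (M%:R * rM) + N%:R * l%:R.
Proof.
have h1 : `|(\sum_(1 <= n < N.+1) hurwitz R n * hurwitz R (n + l))
    - \sum_(1 <= n < N.+1) wcount R n M * wcount R (n + l) M| <= 63 * Z ^+ 2 * rM * N%:R.
  rewrite -sumrB; apply: le_trans (ler_norm_sum _ _ _) _.
  apply: le_trans (_ : \sum_(1 <= n < N.+1) 63 * Z ^+ 2 * rM <= _); last first.
    by rewrite big_const_nat iter_addr addr0 subn1 -[leLHS]mulr_natr.
  apply: ler_sum_nat => n /andP[n0 nN].
  have nM : (n <= M)%N by rewrite /M; lia.
  have nlM : (n + l <= M)%N by rewrite /M; lia.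
  have nl0 : (0 < n + l)%N by lia.
  have a1 := hurwitz_wcount R n0 nM; have a2 := hurwitz_wcount R nl0 nlM.
  have t1 : (tau n)%:R <= Z by apply: Ztau; rewrite n0.
  have t2 : (tau (n + l))%:R <= Z by apply: Ztau; rewrite nl0.
  have b1 : hurwitz R n <= Z * rM by apply: Zhur; rewrite n0.
  have b2 : hurwitz R (n + l) <= Z * rM by apply: Zhur; rewrite nl0.
  have c1 := hurwitz_ge0 R n0; have c2 := hurwitz_ge0 R nl0.
  have d2 := wcount_ge0 R (n + l) M.
  move: (hurwitz R n) (hurwitz R (n + l)) (wcount R n M) (wcount R (n + l) M) a1 a2 b1 b2 c1 c2 d2
    => H H' W W' a1 a2 b1 b2 c1 c2 d2.
  have {}a1 : `|H - W| <= 7 * Z by apply: le_trans a1 _; rewrite ler_wpM2l.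
  have {}a2 : `|H' - W'| <= 7 * Z by apply: le_trans a2 _; rewrite ler_wpM2l.
  have ZZ : Z <= Z * rM by rewrite ler_peMr.
  have w2 : W' <= 8 * (Z * rM) by move: a2; rewrite ler_norml => /andP[]; lra.
  rewrite (_ : _ - _ = H * (H' - W') + (H - W) * W'); last by ring.
  apply: le_trans (ler_normD _ _) _; rewrite !normrM (ger0_norm c1) (ger0_norm d2).
  rewrite (_ : 63 * _ * _ = Z * rM * (7 * Z) + 7 * Z * (8 * (Z * rM))); last by ring.
  by apply: lerD; apply: ler_pM.
have h2 := wcount_main.
set V := (pi / 6) ^+ 2 * _ * _ in h2 *.
move: (\sum_(1 <= n < _) _) (\sum_(1 <= n < _) _) h1 h2 => W H h1 h2.
have := ler_normD (H - W) (W - V); rewrite addrA subrK => h3.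
have NM : N%:R <= M%:R :> R by rewrite ler_nat /M; lia.
have p k : (k <= 6)%N -> Z ^+ k * (rM * N%:R) <= Z ^+ 6 * (M%:R * rM).
  move=> k6; apply: ler_pM; rewrite ?exprn_ge0 ?mulr_ge0 //; first exact: ler_weXn2l.
  by rewrite [leRHS]mulrC ler_wpM2l.
have p2 := p 2 isT; have p4 := p 4 isT; have p5 := p 5 isT.
have p1 : Z * N%:R <= Z ^+ 6 * (M%:R * rM).
  by apply: le_trans (p 1%N isT); rewrite expr1 ler_wpM2l // ler_peMl.
have r x k : x * Z ^+ k * rM * N%:R = x * (Z ^+ k * (rM * N%:R)) by rewrite !mulrA.
rewrite !r -[2 * Z * _]mulrA -[33 * 40 * 40 * _ * _]mulrA in h1 h2; rewrite -[(_ + _) * Z ^+ 6 * _]mulrA.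
apply: le_trans h3 _.
move: h1 h2 p1 p2 p4 p5.
move: (Z ^+ 6 * (M%:R * rM)) (Z ^+ 5 * (rM * N%:R)) (Z ^+ 4 * (rM * N%:R)) (Z ^+ 2 * (rM * N%:R))
  (Z * N%:R) (N%:R * l%:R) => z6 z5 z4 z2 z1 nl h1 h2 p1 p2 p4 p5; lra.
Qed.

End Correlation.

(** * The main term *)

Lemma odd_partE (l : nat) : (0 < l)%N -> odd_part l = (l`_(2^'))%N.
Proof.
move=> l0; apply/eqP; rewrite eqn_leq; apply/andP; split.
  apply/bigmax_leqP_seq => d; rewrite -dvdn_divisors // => dl od.
  rewrite dvdn_leq ?part_gt0 // -(part_pnat_id (pi := (2^')%N) (n := d)); first exact: partn_dvd.
  by rewrite -odd_2'nat.
apply: (leq_bigmax_seq (F := id)); first by rewrite -dvdn_divisors // dvdn_part.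
by rewrite odd_2'nat part_pnat.
Qed.

Lemma odd_part_double (m : nat) : (0 < m)%N -> odd_part (2 * m) = odd_part m.
Proof.
move=> m0; rewrite !odd_partE ?muln_gt0 // partnM //.
by rewrite part_p'nat ?mul1n // pnatNK pnat_id.
Qed.

Lemma odd_part_id (m : nat) : odd m -> odd_part m = m.
Proof. by move=> om; rewrite odd_partE ?odd_gt0 // part_pnat_id -?odd_2'nat. Qed.

Section Bracket.
Variable R : realType.

Lemma sigma_nat (k : nat) : (0 < k)%N -> sigma R (- 2) k%:Q = s2 R k.
Proof.
by move=> k0; rewrite /sigma intr_int numq_int /= sum_divisors.
Qed.

Lemma sigma_div (l q : nat) : (0 < l)%N -> (0 < q)%N ->
  sigma R (- 2) (l%:Q / q%:Q) = if (q %| l)%N then s2 R (l %/ q) else 0.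
Proof.
move=> l0 q0; have qn : q%:Q != 0 by rewrite pnatr_eq0 -lt0n.
case: ifP => [/dvdnP[k e]|ndv].
  by rewrite e mulnK // PoszM intrM mulfK // sigma_nat //; lia.
rewrite /sigma ifF //; apply/negP => /intrP[z e].
have {}e : l%:Z = z * q%:Z.
  by apply: (intr_inj (R := rat)); rewrite intrM -e divfK.
by move/negP: ndv; apply; apply/dvdnP; exists `|z|%N; lia.
Qed.

Lemma s2_odd_part (l : nat) : (0 < l)%N ->
  s2 R (odd_part l) = \sum_(1 <= e < l.+1 | (e %| l)%N && odd e) (e%:R ^+ 2)^-1.
Proof.
move=> l0; rewrite odd_partE //; set o := (l`_(2^'))%N.
have o0 : (0 < o)%N by exact: part_gt0.
have ol : (o <= l)%N by rewrite dvdn_leq // dvdn_part.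
rewrite (@big_cat_nat _ _ _ o.+1 1 l.+1) //= [X in _ = _ + X]big_nat_cond [X in _ = _ + X]big1.
  rewrite addr0; apply: eq_bigl => e; apply/idP/andP => [eo|[el oe]].
    split; first by apply: dvdn_trans eo _; exact: dvdn_part.
    by apply: dvdn_odd eo _; rewrite odd_2'nat part_pnat.
  rewrite -(part_pnat_id (pi := (2^')%N) (n := e)) -?odd_2'nat //; exact: partn_dvd.
move=> e /andP[/andP[oe _] /andP[el od]]; exfalso.
suff : (e %| o)%N by move=> /dvdn_leq; lia.
rewrite -(part_pnat_id (pi := (2^')%N) (n := e)) -?odd_2'nat //; exact: partn_dvd.
Qed.

(* Even divisors of [2m] are the doubles of the divisors of [m]. *)
Lemma s2_double (m : nat) : (0 < m)%N -> s2 R (2 * m) = s2 R (odd_part (2 * m)) + s2 R m / 4.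
Proof.
move=> m0; rewrite s2_odd_part; last by lia.
rewrite {1}/s2 (bigID odd) /=; congr (_ + _).
transitivity (\sum_(1 <= e < (2 * m).+1 | (2 %| e)%N)
   if (e %/ 2 %| m)%N then (e%:R ^+ 2)^-1 else 0 : R).
  rewrite [LHS]big_mkcond [RHS]big_mkcond; apply: eq_bigr => e _.
  rewrite dvdn2; case: (boolP (odd e)) => oe /=; first by rewrite andbF.
  rewrite andbT; congr (if _ then _ else _).
  by rewrite -[X in (X %| _)%N](divnK (d := 2)) ?dvdn2 // mulnC dvdn_pmul2l.
rewrite sum_multiples // mulKn // /s2 mulr_suml [RHS]big_mkcond; apply: eq_bigr => e _.
rewrite mulnK //; case: ifP => // _; rewrite natrM exprMn invfM; congr (_ * _).
by rewrite -natrX.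
Qed.

(** For odd [l] only the last term remains. For [l = 2] modulo 4 the last two cancel. For [l = 4 m],
    [s2_double] turns the bracket into [2 s2(m) - s2(m)/4 = 7/4 s2(m)]. *)
Lemma bracketE (l : nat) : (0 < l)%N ->
  2 * sigma R (- 2) (l%:Q / 4) - sigma R (- 2) (l%:Q / 2) + sigma R (- 2) (odd_part l)%:Q
  = 7 / 2 * zeta (3 : R) * sing R l.
Proof.
move=> l0; have z0 : zeta (3 : R) != 0 by rewrite gt_eqF // (lt_le_trans _ (zeta3_ge1 R)).
rewrite (sigma_div l0 (isT : 0 < 4)%N) (sigma_div l0 (isT : 0 < 2)%N).
rewrite sigma_nat; last by rewrite odd_partE ?part_gt0.
rewrite /sing; case: (boolP (odd l)) => ol.
  have -> : (4 %| l)%N = false by apply/negP => /(dvdn_trans (isT : 2 %| 4)%N); rewrite dvdn2 ol.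
  rewrite dvdn2 ol /= odd_part_id //.
  by field.
rewrite dvdn2 ol; case: ifP => l4.
  have [m e] := dvdnP l4; rewrite e mulnK //.
  have -> : (m * 4 %/ 2 = 2 * m)%N by lia.
  have m0 : (0 < m)%N by lia.
  rewrite s2_double //.
  have -> : odd_part (m * 4) = odd_part (2 * m).
    by rewrite (_ : (m * 4 = 2 * (2 * m))%N) ?odd_part_double; lia.
  by field.
have h : odd (l %/ 2) by lia.
have -> : odd_part l = (l %/ 2)%N.
  by rewrite {1}(_ : l = 2 * (l %/ 2))%N ?odd_part_double ?odd_part_id //; lia.
by ring.
Qed.

End Bracket.

(** * The theorem *)

Section Final.
Variable R : realType.

Lemma harm_ln (n : nat) : (0 < n)%N -> harm R n <= 1 + ln n%:R.
Proof.
elim: n => // n IH _; case: n IH => [_|n IH]; first by rewrite /harm big_nat1 invr1 ln1 addr0.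
rewrite /harm big_nat_recr //= -/(harm R n.+1).
have := IH isT; set y : R := n.+1%:R; set z : R := n.+2%:R => h.
have y0 : 0 < y by rewrite ltr0n.
have z0 : 0 < z by rewrite ltr0n.
have zy : z = y + 1 by rewrite /z -natr1.
have z1 : z^-1 < 1 by rewrite invf_lt1 // zy; lra.
have := @le_ln1Dx R (- z^-1); rewrite ltrN2 => /(_ z1).
have -> : 1 + - z^-1 = y / z by rewrite (_ : y = z - 1) ?mulrBl ?divff ?gt_eqF ?mul1r // zy addrK.
by rewrite ln_div ?posrE //; move: h; move: (z^-1) (ln y) (ln z) => *; lra.
Qed.

Lemma harm_powR (dl : R) (n : nat) : 0 < dl -> (0 < n)%N -> harm R n <= (1 + dl^-1) * n%:R `^ dl.
Proof.
move=> dl0 n0; apply: le_trans (harm_ln n0) _.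
have n1 : 1 <= n%:R :> R by rewrite ler1n.
set y := n%:R `^ dl; have y1 : 1 <= y by rewrite -(powRr0 (n%:R : R)) ler_powR // ltW.
have e : dl * ln n%:R <= y - 1.
  by rewrite -ln_powR -/y -{1}(subrK 1 y) addrC le_ln1Dx // ltrBrDr; lra.
rewrite mulrDl mul1r lerD // -(ler_pM2l dl0) mulrA divff ?gt_eqF // mul1r.
by apply: le_trans e _; rewrite lerBlDr lerDl.
Qed.

Lemma triangular_square (N : nat) (X : R) : N%:R <= X < N.+1%:R -> 1 <= X ->
  `|N%:R * (N%:R + 1) / 2 - X ^+ 2 / 2| <= X.
Proof.
rewrite -natr1 => /andP[h1 h2] X1; have : 0 <= N%:R :> R by [].
by move: (N%:R) h1 h2 => y h1 h2 y0; rewrite ler_norml; apply/andP; split; nra.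
Qed.

Variable eps : R.
Hypothesis eps0 : 0 < eps.
(** The sixth power of a majorant of size [X^(2 dl)] must stay below [X^eps], hence [eps/12];
    [large_shift] needs [1/2 - dl >= 0]. *)
Let dl : R := Num.min (eps / 12) 2^-1.
Let dl0 : 0 < dl. Proof. by rewrite lt_min divr_gt0 // invr_gt0 ltr0n. Qed.
Let dl_eps : dl * 12 <= eps. Proof. by rewrite -ler_pdivlMr // ge_min lexx. Qed.
Let dl_half : dl <= 2^-1. Proof. by rewrite ge_min lexx orbT. Qed.

Lemma small_shift : exists2 K : R, 0 <= K & forall (l : nat) (X : R), (0 < l)%N -> 1 <= X -> l%:R <= X ->
  `|(\sum_(1 <= n < (Num.truncn X).+1) hurwitz R n * hurwitz R (n + l))
    - (pi / 6) ^+ 2 * sing R l * (X ^+ 2 / 2)| <=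
  K * (X `^ (5 / 3 + eps) + X `^ (1 + eps) * l%:R).
Proof.
have [K1 K10 H1] := divisor_bound dl0; have [K2 K20 H2] := hurwitz_bound dl0.
(* One summand for each requirement on [Z]: [3] comes from [2 N + 1 <= 3 X] and [36] from
   [4 (3 X)^2]. *)
pose K0 := 1 + K1 * 3 `^ dl + (1 + dl^-1) * 36 `^ dl + K2 * 3 `^ dl.
have k1 : 0 <= K1 * 3 `^ dl by rewrite mulr_ge0 ?powR_ge0 // ltW.
have k2 : 0 <= K2 * 3 `^ dl by rewrite mulr_ge0 ?powR_ge0 // ltW.
have k3 : 0 <= (1 + dl^-1) * 36 `^ dl by rewrite mulr_ge0 ?powR_ge0 // addr_ge0 // invr_ge0 ltW.
have K01 : 1 <= K0 by rewrite /K0; lra.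
have K00 : 0 <= K0 by exact: le_trans ler01 K01.
set c : R := 33 * 40 * 40 + 116; have c0 : 0 <= c by rewrite addr_ge0 // !mulr_ge0.
exists (c * K0 ^+ 6 * 9 + 2).
  by apply: addr_ge0 => //; apply: mulr_ge0 => //; apply: mulr_ge0 => //; apply: exprn_ge0.
move=> l X l0 X1 lX; have X0 : 0 < X by exact: lt_le_trans X1.
have NX := truncn_itv (ltW X0); move: (Num.truncn X) NX => N NX.
have [N1 N2] := andP NX.
have lN : (l <= N)%N by rewrite -ltnS -(ltr_nat R); exact: le_lt_trans lX N2.
have N0 : (0 < N)%N by exact: leq_trans l0 lN.
set x := X `^ dl; set x2 := X `^ (2 * dl).
have x1 : 1 <= x by rewrite -(powRr0 X) ler_powR // ltW.
have x22 : x2 = x ^+ 2 by rewrite /x2 mulrC powRrM powR_mulrn ?powR_ge0.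
have xx2 : x <= x2 by rewrite x22 expr2 ler_peMl // (le_trans ler01).
have x21 : 1 <= x2 by exact: le_trans xx2.
have MX : (2 * N).+1%:R <= 3 * X by rewrite -natr1 natrM; lra.
(* The square of [X^dl] is due to the harmonic sum, whose length is of order [X^2]. *)
pose Z := K0 * x2.
have pw k : (k <= (2 * N).+1)%N -> k%:R `^ dl <= 3 `^ dl * x.
  move=> kM; rewrite /x -powRM ?(ltW X0) //.
  apply: ge0_ler_powR; rewrite ?nnegrE ?mulr_ge0 ?(ltW dl0) ?(ltW X0) //.
  by apply: le_trans MX; rewrite ler_nat.
have pos (a b c' : R) : 0 <= a -> a * x <= a * x2 by move=> a0; rewrite ler_wpM2l.
have Z1 : 1 <= Z by rewrite /Z -[leLHS]mulr1; exact: ler_pM.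
have KZ a : 0 <= a -> a <= K0 -> a * x <= Z by move=> a0 aK; apply: ler_pM => //; exact: le_trans x1.
have Zt k : (0 < k <= (2 * N).+1)%N -> (tau k)%:R <= Z.
  move=> /andP[k0 kM]; apply: le_trans (H1 k k0) _.
  apply: le_trans (ler_wpM2l (ltW K10) (pw k kM)) _; rewrite mulrA; apply: KZ => //.
  by rewrite /K0; lra.
have Zh k : (0 < k <= (2 * N).+1)%N -> hurwitz R k <= Z * Num.sqrt (2 * N).+1%:R.
  move=> /andP[k0 kM]; apply: le_trans (H2 k k0) _.
  apply: ler_pM; rewrite ?sqrtr_ge0 ?mulr_ge0 ?powR_ge0 ?(ltW K20) //.
    apply: le_trans (ler_wpM2l (ltW K20) (pw k kM)) _; rewrite mulrA; apply: KZ => //.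
    by rewrite /K0; lra.
  by rewrite ler_wsqrtr // ler_nat.
have Zm : harm R (4 * (2 * N).+1 ^ 2) <= Z.
  apply: le_trans (harm_powR dl0 _) _; first by rewrite muln_gt0 expn_gt0.
  have d1 : 0 <= 1 + dl^-1 by rewrite addr_ge0 // invr_ge0 ltW.
  apply: le_trans (_ : (1 + dl^-1) * (36 `^ dl * x2) <= _).
    rewrite ler_wpM2l // /x2 powRrM powR_mulrn ?(ltW X0) //.
    rewrite -powRM ?exprn_ge0 ?(ltW X0) //.
    apply: ge0_ler_powR; rewrite ?nnegrE ?mulr_ge0 ?exprn_ge0 ?(ltW dl0) ?(ltW X0) //.
    rewrite natrM natrX (_ : 36 * X ^+ 2 = 4 * (3 * X) ^+ 2); last by ring.
    by rewrite ler_wpM2l // lerXn2r ?nnegrE ?mulr_ge0 ?(ltW X0).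
  rewrite mulrA; apply: ler_pM => //; first exact: le_trans x21.
  by rewrite /K0; lra.
have := hurwitz_correlation l0 N0 lN Z1 Zt Zm Zh.
set S := \sum_(1 <= n < _) _; rewrite -/c => main.
have tri := triangular_square NX X1.
have [s0 s1] := andP (sing_bounds R l).
have [p0 p1] := andP (@pi_div6_bounds R).
set V := (pi / 6) ^+ 2 * sing R l in main *.
have V1 : 0 <= V <= 1.
  by rewrite mulr_ge0 ?exprn_ge0 //= -[leRHS]mulr1 ler_pM ?exprn_ge0 ?exprn_ile1.
set Y := X `^ (5 / 3 + eps); set W := X `^ (1 + eps).
have YE : Y = X `^ (2 / 3) * X * X `^ eps.
  rewrite /Y -[X in _ * X * _]powRr1 ?(ltW X0) // -!powRD ?(gt_eqF X0) ?implybT //.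
  by congr powR; field.
have WE : W = X * X `^ eps.
  by rewrite /W -[X in X * _]powRr1 ?(ltW X0) // -powRD ?(gt_eqF X0) ?implybT.
have Xe1 : 1 <= X `^ eps by rewrite -(powRr0 X) ler_powR // ltW.
have X23 : 1 <= X `^ (2 / 3) by rewrite -[leLHS](powRr0 X) ler_powR // divr_ge0.
have XY : X <= Y.
  by rewrite YE -mulrA -[leLHS]mul1r; apply: ler_pM => //; rewrite ?(ltW X0) // ler_peMr // ltW.
have XW : X * l%:R <= W * l%:R by rewrite ler_wpM2r // WE ler_peMr // ltW.
have NlW : N%:R * l%:R <= W * l%:R by apply: le_trans XW; rewrite ler_wpM2r.
have Z6 : Z ^+ 6 <= K0 ^+ 6 * X `^ eps.
  rewrite exprMn ler_wpM2l ?exprn_ge0 //.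
  rewrite -powR_mulrn ?powR_ge0 // -powRrM ler_powR // (_ : 2 * dl * 6%:R = dl * 12) //.
  by ring.
(* The power [X^(3/2)] is weakened here to the [X^(5/3)] of the statement. *)
have sM : (2 * N).+1%:R * Num.sqrt (2 * N).+1%:R <= 9 * (X `^ (2 / 3) * X).
  have h : Num.sqrt (2 * N).+1%:R <= 3 * X `^ (2 / 3).
    apply: le_trans (_ : 3 * Num.sqrt X <= _).
      rewrite -(@ler_pXn2r _ 2) ?nnegrE ?mulr_ge0 ?sqrtr_ge0 // exprMn !sqr_sqrtr ?(ltW X0) //.
      by apply: le_trans MX _; rewrite ler_wpM2r ?(ltW X0) // expr2 ler_peMl // ler1n.
    rewrite ler_wpM2l // -powR12_sqrt ?(ltW X0) // ler_powR //; lra.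
  apply: le_trans (ler_pM _ _ MX h) _; rewrite ?sqrtr_ge0 //.
  by rewrite le_eqVlt; apply/orP; left; apply/eqP; ring.
have sZ : Z ^+ 6 * ((2 * N).+1%:R * Num.sqrt (2 * N).+1%:R) <= 9 * (K0 ^+ 6 * Y).
  have Z60 : 0 <= Z ^+ 6 by apply: exprn_ge0; exact: le_trans ler01 Z1.
  apply: le_trans (ler_pM Z60 _ Z6 sM) _; first by apply: mulr_ge0 => //; exact: sqrtr_ge0.
  by rewrite le_eqVlt YE; apply/orP; left; apply/eqP; ring.
have Y0 : 0 <= Y by rewrite powR_ge0.
have W0 : 0 <= W * l%:R by rewrite mulr_ge0 ?powR_ge0.
have -> : S - V * (X ^+ 2 / 2) = (S - V * (N%:R * (N%:R + 1) / 2)) +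
    V * (N%:R * (N%:R + 1) / 2 - X ^+ 2 / 2) by ring.
apply: le_trans (ler_normD _ _) _.
have VX : `|V * (N%:R * (N%:R + 1) / 2 - X ^+ 2 / 2)| <= Y.
  apply: le_trans XY; rewrite normrM; have [v0 v1] := andP V1.
  by rewrite (ger0_norm v0) -[leRHS]mul1r; apply: ler_pM.
apply: le_trans (lerD main VX) _.
have K06 : 0 <= K0 ^+ 6 by rewrite exprn_ge0 // (le_trans ler01).
have h1 : c * Z ^+ 6 * ((2 * N).+1%:R * Num.sqrt (2 * N).+1%:R) <= c * (9 * (K0 ^+ 6 * Y)).
  by rewrite -mulrA ler_wpM2l.
have h2 : 0 <= c * K0 ^+ 6 * 9 * (W * l%:R) by rewrite !mulr_ge0 ?powR_ge0.
rewrite (_ : (c * K0 ^+ 6 * 9 + 2) * (Y + W * l%:R) = c * (9 * (K0 ^+ 6 * Y)) +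
  c * K0 ^+ 6 * 9 * (W * l%:R) + 2 * Y + 2 * (W * l%:R)); last by ring.
move: h1 h2 NlW W0 Y0.
move: (c * Z ^+ 6 * _) (c * (9 * _)) (N%:R * l%:R) (W * l%:R) (c * K0 ^+ 6 * 9 * (W * l%:R)) => *; lra.
Qed.

(** The sum has at most [X] terms of size [(X l)^(1/2 + dl)]. Since [X <= l], trading [X^(1/2 - dl)]
    for [l^(1/2 - dl)] bounds a term by [X^(2 dl) l]; the main term is itself at most [X l]. *)
Lemma large_shift : exists2 K : R, 0 <= K & forall (l : nat) (X : R), (0 < l)%N -> 1 <= X -> X <= l%:R ->
  `|(\sum_(1 <= n < (Num.truncn X).+1) hurwitz R n * hurwitz R (n + l))
    - (pi / 6) ^+ 2 * sing R l * (X ^+ 2 / 2)| <= K * (X `^ (1 + eps) * l%:R).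
Proof.
have [K2 K20 H2] := hurwitz_bound dl0.
pose K0 := K2 ^+ 2 * (2 `^ dl * Num.sqrt 2).
have K00 : 0 <= K0 by rewrite !mulr_ge0 ?exprn_ge0 ?powR_ge0 ?sqrtr_ge0 // ltW.
exists (K0 + 1) => [|l X l0 X1 Xl]; first by rewrite addr_ge0.
have X0 : 0 < X by exact: lt_le_trans X1.
have L0 : 0 < l%:R :> R by rewrite ltr0n.
have NX := truncn_itv (ltW X0); move: (Num.truncn X) NX => N /andP[N1 N2].
have Xe1 : 1 <= X `^ eps by rewrite -(powRr0 X) ler_powR // ltW.
set W := X `^ (1 + eps).
have WE : W = X * X `^ eps.
  by rewrite /W -[X in X * _]powRr1 ?(ltW X0) // -powRD ?(gt_eqF X0) ?implybT.
have main : (pi / 6) ^+ 2 * sing R l * (X ^+ 2 / 2) <= W * l%:R.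
  have [s0 s1] := andP (sing_bounds R l); have [p0 p1] := andP (@pi_div6_bounds R).
  apply: le_trans (_ : 1 * (X * l%:R) <= _); last first.
    by rewrite mul1r ler_wpM2r // WE ler_peMr // ltW.
  have v0 : 0 <= (pi / 6) ^+ 2 * sing R l by rewrite mulr_ge0 ?exprn_ge0.
  have v1 : (pi / 6) ^+ 2 * sing R l <= 1 by rewrite -[leRHS]mulr1 ler_pM ?exprn_ge0 ?exprn_ile1.
  apply: ler_pM => //; first by rewrite divr_ge0 ?exprn_ge0 ?(ltW X0).
  apply: le_trans (_ : X * X <= _); last by rewrite ler_wpM2l ?(ltW X0).
  by rewrite -expr2 ler_pdivrMr // ler_peMr ?exprn_ge0 ?(ltW X0) // ler1n.
have main0 : 0 <= (pi / 6) ^+ 2 * sing R l * (X ^+ 2 / 2).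
  have [s0 _] := andP (sing_bounds R l); have [p0 _] := andP (@pi_div6_bounds R).
  apply: mulr_ge0; first by rewrite mulr_ge0 ?exprn_ge0.
  by rewrite divr_ge0 ?exprn_ge0 ?(ltW X0).
have hX n : (0 < n <= N)%N -> hurwitz R n <= K2 * X `^ dl * Num.sqrt X.
  move=> /andP[n0 nN]; have nX : n%:R <= X by apply: le_trans N1; rewrite ler_nat.
  apply: le_trans (H2 n n0) _; apply: ler_pM; rewrite ?mulr_ge0 ?powR_ge0 ?sqrtr_ge0 ?(ltW K20) //.
    by rewrite ler_wpM2l ?(ltW K20) // ge0_ler_powR ?nnegrE ?(ltW dl0) ?(ltW X0).
  exact: ler_wsqrtr.
have hl n : (0 < n <= N)%N -> hurwitz R (n + l) <= K2 * (2 `^ dl * l%:R `^ dl) * (Num.sqrt 2 * Num.sqrt l%:R).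
  move=> /andP[n0 nN]; have nX : (n + l)%:R <= 2 * l%:R :> R.
    have : n%:R <= l%:R :> R by apply: le_trans Xl; apply: le_trans N1; rewrite ler_nat.
    by rewrite natrD; lra.
  apply: le_trans (H2 _ _) _; first by rewrite addn_gt0 n0.
  rewrite -powRM ?(ltW L0) // -sqrtrM //.
  apply: ler_pM; rewrite ?mulr_ge0 ?powR_ge0 ?sqrtr_ge0 ?(ltW K20) //.
    by rewrite ler_wpM2l ?(ltW K20) // ge0_ler_powR ?nnegrE ?mulr_ge0 ?(ltW dl0).
  exact: ler_wsqrtr.
have key : X `^ dl * Num.sqrt X * (l%:R `^ dl * Num.sqrt l%:R) <= X `^ eps * l%:R.
  rewrite -!powR12_sqrt ?(ltW X0) ?(ltW L0) //.
  have e1 : X `^ dl * X `^ 2^-1 = X `^ (2 * dl) * X `^ (2^-1 - dl).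
    by rewrite -!powRD ?(gt_eqF X0) ?implybT //; congr powR; ring.
  have e2 : l%:R = l%:R `^ (2^-1 - dl) * (l%:R `^ dl * l%:R `^ 2^-1) :> R.
    by rewrite -!powRD ?(gt_eqF L0) ?implybT // -[LHS]powRr1 //; congr powR; field.
  rewrite e1 [in leRHS]e2 -mulrA; apply: ler_pM; rewrite ?mulr_ge0 ?powR_ge0 //.
    by rewrite ler_powR //; move: dl_eps dl0; lra.
  by rewrite ler_wpM2r ?mulr_ge0 ?powR_ge0 // ge0_ler_powR ?nnegrE ?(ltW X0) ?(ltW L0) // subr_ge0.
have sum : 0 <= \sum_(1 <= n < N.+1) hurwitz R n * hurwitz R (n + l) <= K0 * (W * l%:R).
  apply/andP; split.
    rewrite big_nat; apply: sumr_ge0 => n /andP[n0 _].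
    by rewrite mulr_ge0 ?hurwitz_ge0 // addn_gt0 n0.
  apply: le_trans (_ : \sum_(1 <= n < N.+1) K0 * (X `^ eps * l%:R) <= _).
    apply: ler_sum_nat => n /andP[n0 nN].
    apply: le_trans (ler_pM _ _ (hX n _) (hl n _)) _; rewrite ?n0 ?hurwitz_ge0 ?addn_gt0 ?n0 //.
    apply: le_trans (ler_wpM2l K00 key); rewrite le_eqVlt /K0; apply/orP; left; apply/eqP.
    by move: (X `^ dl) (l%:R `^ dl) (2 `^ dl) (Num.sqrt 2) => *; ring.
  rewrite big_const_nat iter_addr addr0 subn1 /= -[leLHS]mulr_natl WE.
  rewrite (_ : K0 * (X * X `^ eps * l%:R) = X * (K0 * (X `^ eps * l%:R))); last by ring.
  by rewrite ler_wpM2r // mulr_ge0 // mulr_ge0 // powR_ge0.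
have W0 : 0 <= W * l%:R by rewrite mulr_ge0 // powR_ge0.
have [s0 s1] := andP sum; have t0 := mulr_ge0 K00 W0.
rewrite [leRHS]mulrDl [X in _ <= _ + X]mul1r ler_norml; move: s0 s1 t0 main main0 W0.
move: (\sum_(_ <= _ < _) _) (_ * _ * (X ^+ 2 / 2)) (W * l%:R) (K0 * (W * l%:R)) => *; apply/andP; split; lra.
Qed.

End Final.

Theorem theorem1p1 (R : realType) (eps : R) (eps_gt0 : 0 < eps) :
  exists K : R, forall (l : nat) (X : R), (1 <= l)%N -> 1 <= X ->
    `| (\sum_(1 <= n < (Num.truncn X).+1) hurwitz R n * hurwitz R (n + l))
       - pi ^+ 2 * X ^+ 2 / (252 * zeta (3 : R))
         * (2 * sigma R (- 2) (l%:Q / 4) - sigma R (- 2) (l%:Q / 2)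
            + sigma R (- 2) (odd_part l)%:Q) |
    <= K * (X `^ (5 / 3 + eps) + X `^ (1 + eps) * l%:R).
Proof.
have [K1 K10 H1] := small_shift eps_gt0; have [K2 K20 H2] := large_shift eps_gt0.
exists (K1 + K2) => l X l1 X1; rewrite bracketE //.
have z0 : zeta (3 : R) != 0 by rewrite gt_eqF // (lt_le_trans _ (zeta3_ge1 R)).
(* [252 = 36 * 2 * 7/2]. *)
have -> : pi ^+ 2 * X ^+ 2 / (252 * zeta (3 : R)) * (7 / 2 * zeta (3 : R) * sing R l) =
    (pi / 6) ^+ 2 * sing R l * (X ^+ 2 / 2).
  by move: (pi : R) (zeta _) z0 => p z z0; field.
set Y := X `^ _; set W := X `^ (1 + eps) * _.
have Y0 : 0 <= Y by rewrite powR_ge0.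
have W0 : 0 <= W by rewrite mulr_ge0 // powR_ge0.
have YW : 0 <= Y + W by rewrite addr_ge0.
have [lX|/ltW Xl] := leP l%:R X.
  by apply: le_trans (H1 l X l1 X1 lX) _; rewrite ler_wpM2r // lerDl.
apply: le_trans (H2 l X l1 X1 Xl) _; rewrite -/W.
by apply: ler_pM => //; [rewrite lerDr|rewrite lerDr].
Qed.
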